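(* Let $\mathbb{G}=[H\rtimes_\alpha G\rightrightarrows G]$ be the Lie $2$-group of a Lie crossed module $(G,H,\tau,\alpha)$, let $\pi\colon\mathbb{E}\to\mathbb{X}$ be a principal $\mathbb{G}$-bundle over a Lie groupoid $\mathbb{X}$, $\mathcal{G}(\mathbb{E})$ its gauge $2$-group, and $\widehat{\Omega}^{\mathbb{G}}(E_0,L(H))$ the category whose objects are the functors $\overline\lambda\colon T\mathbb{E}\to L(\mathbb{G})$ defined by $G$-equivariant $L(H)$-valued $1$-forms $\lambda$ on $E_0$ and whose morphisms are the smooth $\mathbb{G}$-equivariant fibrewise linear natural transformations. Then $\mathcal{G}^{\mathrm{ext}}:=\mathcal{G}(\mathbb{E})\times\widehat{\Omega}^{\mathbb{G}}(E_0,L(H))$ is a strict $2$-group with group products on objects and morphisms $$(F,\overline\lambda)(F',\overline{\lambda'})=\bigl(FF',\ \overline\lambda+\overline{\lambda'}\circ F_*^{-1}\bigr),\qquad (\Psi,\theta)(\Psi',\theta')=\bigl(\Psi\Psi',\ \theta+(\theta'\circ_H\Psi_*^{-1})\bigr),$$ and $$\bigl((F,\overline\lambda),\omega\bigr)\mapsto\omega\circ F_*^{-1}+\overline\lambda,\qquad \bigl((\Psi,\theta),\zeta\bigr)\mapsto\zeta\circ_H\Psi_*^{-1}+\theta$$ defines a left action of $\mathcal{G}^{\mathrm{ext}}$ on the category $\Omega^{\mathrm{semi}}_{\mathbb{E}}$ of semi-strict connection $1$-forms on $\mathbb{E}$.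
   Context: In a Lie groupoid, source $s$ and target $t$ are surjective submersions and $f_2\circ f_1$ is defined when $t(f_1)=s(f_2)$. A Lie crossed module $(G,H,\tau,\alpha)$: Lie groups $G,H$, a smooth action $\alpha\colon G\times H\to H$ by automorphisms ($\alpha_g=\alpha(g,\cdot)$, also its differential on $L(H)$), a homomorphism $\tau\colon H\to G$ (also its differential on $L(H)$) with $\tau(\alpha(g,h))=g\tau(h)g^{-1}$, $\alpha(\tau(h),h')=hh'h^{-1}$. Its Lie $2$-group (strict group object in Lie groupoids) is $\mathbb{G}=[G_1\rightrightarrows G_0]=[H\rtimes_\alpha G\rightrightarrows G]$ with $s(h,g)=g$, $t(h,g)=\tau(h)g$, $(h_2,g_2)\circ(h_1,g_1)=(h_2h_1,g_1)$, $(h_2,g_2)(h_1,g_1)=(h_2\alpha(g_2,h_1),g_2g_1)$. $L(\cdot)$ denotes Lie algebra; $L(\mathbb{G})=[L(H)\oplus L(G)\rightrightarrows L(G)]$ with $s(A,B)=B$, $t(A,B)=\tau(A)+B$, $(A_2,B_2)\circ(A_1,B_1)=(A_2+A_1,B_1)$. $\mathrm{ad}$ is the adjoint action of a group on its Lie algebra. $T\mathbb{E}$ is the tangent groupoid. A principal $\mathbb{G}$-bundle over $\mathbb{X}$ is a morphism of Lie groupoids $\pi\colon\mathbb{E}\to\mathbb{X}$ with a morphism of Lie groupoids $\mathbb{E}\times\mathbb{G}\to\mathbb{E}$ whose components are right Lie group actions, such that $\pi_i\colon E_i\to X_i$ is a principal $G_i$-bundle, $i=0,1$. The gauge $2$-group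 $\mathcal{G}(\mathbb{E})$ is the strict $2$-group whose objects are the automorphisms $F$ of the Lie groupoid $\mathbb{E}$ with each $F_i$ $G_i$-equivariant and $\pi\circ F=\pi$, and whose morphisms $\Psi\colon F\Rightarrow F'$ are smooth natural isomorphisms with $\Psi(pg)=\Psi(p)1_g$ and $\pi_1(\Psi(p))=1_{\pi_0(p)}$; product is composition of functors and horizontal composition $\circ_H$; $F^{-1}$ and $\Psi^{-1}\colon F^{-1}\Rightarrow F'^{-1}$ are inverses for this product. $F_*,\Psi_*$ are the differentials on $T\mathbb{E}$. For an $L(H)$-valued $1$-form $\lambda$ on $E_0$ with $\lambda_{pg}(v\cdot g)=\alpha_{g^{-1}}(\lambda_p(v))$, the functor $\overline\lambda\colon T\mathbb{E}\to L(\mathbb{G})$ is $\tau(\lambda)$ on $TE_0$ and $(t^*\lambda-s^*\lambda,\ \tau(s^*\lambda))\in L(H)\oplus L(G)$ on $TE_1$. Natural transformations between functors $T\mathbb{E}\to L(\mathbb{G})$ are viewed as maps $\theta\colon TE_0\to L(G_1)$; $\mathbb{G}$-equivariance means $\theta((p,v)\cdot g)=\mathrm{ad}_{1_g^{-1}}\theta(p,v)$. Sums of functors and of natural transformations are pointwise. Let $\delta\colon\mathbb{E}\times L(\mathbb{G})\to T\mathbb{E}$ be the functor $(x,B)\mapsto\delta_x(B)$, with $\delta_x$ the differential at $e$ of $g\mapsto xg$. A semi-strict connection $1$-form is a morphism of Lie groupoids $\omega=(\omega_1,\omega_0)\colon T\mathbb{E}\to L(\mathbb{G})$ with $\omega_i$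 an $L(G_i)$-valued $1$-form on $E_i$, $\omega_i(v\cdot g)=\mathrm{ad}_{g^{-1}}\omega_i(v)$, for which there exists a smooth natural isomorphism $\kappa\colon\omega\circ\delta\Rightarrow\mathrm{pr}_2$, linear in $B\in L(G_0)$, with $\kappa(pg,\mathrm{ad}_{g^{-1}}B)=\mathrm{ad}_{1_g^{-1}}\kappa(p,B)$. Morphisms in $\Omega^{\mathrm{semi}}_{\mathbb{E}}$ are smooth, $\mathbb{G}$-equivariant, fibrewise linear natural isomorphisms. An action of a strict $2$-group on a category is a functor that is a group action on objects and on morphisms. *)

(* Defs.v *)
From HB Require Import structures.
From mathcomp Require Import all_boot all_order all_algebra.
From mathcomp Require Import all_classical all_reals all_analysis.

Set Implicit Arguments.
Unset Strict Implicit.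
Unset Printing Implicit Defensive.

Import Order.TTheory GRing.Theory Num.Theory.
Import numFieldNormedType.Exports.

Local Open Scope classical_set_scope.
Local Open Scope ring_scope.

(* ------------------------------------------------------------------------ *)
(* Smooth manifolds                                                         *)
(* ------------------------------------------------------------------------ *)

Section Manifolds.
Context {R : realType}.

Fixpoint Ck (k : nat) {m n : nat} (U : set 'rV[R]_m)
    (f : 'rV[R]_m -> 'rV[R]_n) : Prop :=
  match k with
  | 0 => forall x, U x -> {for x, continuous f}
  | k'.+1 => (forall x, U x -> differentiable f x) /\
             forall v, Ck k' U (fun x => 'd f x v)
  end.

(* Only used for open U. *)
Definition Cinfty {m n : nat} (U : set 'rV[R]_m)
    (f : 'rV[R]_m -> 'rV[R]_n) : Prop := forall k, Ck k U f.

(* A set with charts chart i : dom i -> R^dim, whose inverses are the        *)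
(* param i, and with a preferred chart chartat p around each point p.  The   *)
(* functions are total, their values off dom i and off the image of dom i    *)
(* being irrelevant.  The axioms of an atlas are in is_manifold.             *)
Record space := Space {
  pt :> Type;
  dim : nat;
  idx : Type;
  dom : idx -> set pt;
  chart : idx -> pt -> 'rV[R]_dim;
  param : idx -> 'rV[R]_dim -> pt;
  chartat : pt -> idx
}.

(* The topology generated by the charts. *)
Definition top (M : space) : Type := pt M.

Definition chart_open (M : space) : set (set (top M)) :=
  [set A | exists i O, open O /\ A = @dom M i `&` chart i @^-1` O].

HB.instance Definition _ (M : space) := gen_eqMixin (top M).
HB.instance Definition _ (M : space) := gen_choiceMixin (top M).
HB.instance Definition _ (M : space) :=
  @isSubBaseTopological.Build (top M) (set (top M)) (@chart_open M) id.

Definition is_manifold (M : space) : Prop :=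
  [/\ forall p : M, dom (chartat p) p,
      forall (i : idx M) (p : M), dom i p -> param i (chart i p) = p,
      forall i j : idx M, open (chart i @` (dom i `&` dom j)),
      forall i j : idx M,
        Cinfty (chart i @` (dom i `&` dom j)) (chart j \o param i) &
      hausdorff_space (top M) /\ @second_countable (top M)].

(* Smoothness of f on the open subset W of M. *)
Definition smooth_in {M N : space} (W : set M) (f : M -> N) : Prop :=
  forall (i : idx M) (j : idx N),
    let D := chart i @` (dom i `&` W `&` f @^-1` dom j) in
    open D /\ Cinfty D (chart j \o f \o param i).

Definition smooth {M N : space} (f : M -> N) : Prop := smooth_in setT f.

Definition eucl (n : nat) : space :=
  {| pt := 'rV[R]_n; dim := n; idx := unit; dom := fun=> setT;
     chart := fun=> id; param := fun=> id; chartat := fun=> tt |}.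

Definition prodS (M N : space) : space :=
  {| pt := (M * N)%type; dim := (dim M + dim N)%N; idx := (idx M * idx N)%type;
     dom := fun i => [set x | dom i.1 x.1 /\ dom i.2 x.2];
     chart := fun i x => row_mx (chart i.1 x.1) (chart i.2 x.2);
     param := fun i v => (param i.1 (lsubmx v), param i.2 (rsubmx v));
     chartat := fun x => (chartat x.1, chartat x.2) |}.

(* The tangent space at p is R^dim, a vector being given by its coordinates  *)
(* in the preferred chart at p.  mder f p is the differential of f at p.     *)
Definition mder {M N : space} (f : M -> N) (p : M) (v : 'rV[R]_(dim M)) :
    'rV[R]_(dim N) :=
  'd (chart (chartat (f p)) \o f \o param (chartat p)) (chart (chartat p) p) v.

(* The chart of the tangent bundle over dom i takes (p, v) to the            *)
(* coordinates of p and of v in the chart i.                                 *)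
Definition tanS (M : space) : space :=
  {| pt := (M * 'rV[R]_(dim M))%type; dim := (dim M + dim M)%N; idx := idx M;
     dom := fun i => [set x | dom i x.1];
     chart := fun i x => row_mx (chart i x.1)
       ('d (chart i \o param (chartat x.1)) (chart (chartat x.1) x.1) x.2);
     param := fun i w => let p := param i (lsubmx w) in
       (p, 'd (chart (chartat p) \o param i) (lsubmx w) (rsubmx w));
     chartat := fun x => chartat x.1 |}.

Definition tmap {M N : space} (f : M -> N) (x : tanS M) : tanS N :=
  (f x.1, mder f x.1 x.2).

Definition surjective_submersion {M N : space} (f : M -> N) : Prop :=
  [/\ smooth f, forall q, exists p, f p = q &
      forall p w, exists v, mder f p v = w].

Definition fibre_linear {M : space} {n : nat} (w : tanS M -> eucl n) : Prop :=
  forall p : M, linear (fun v : 'rV[R]_(dim M) => (w (p, v) : 'rV[R]_n)).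

Definition one_form {M : space} {n : nat} (w : tanS M -> eucl n) : Prop :=
  smooth w /\ fibre_linear w.

End Manifolds.

Arguments space R : clear implicits.

(* ------------------------------------------------------------------------ *)
(* Lie groups, crossed modules                                              *)
(* ------------------------------------------------------------------------ *)

Definition is_group (T : Type) (mul : T -> T -> T) (one : T) (inv : T -> T) :
    Prop :=
  [/\ associative mul, left_id one mul, right_id one mul,
      left_inverse one inv mul & right_inverse one inv mul].

Section LieGroups.
Context {R : realType}.

Record group_data := GroupData {
  gsp :> space R;
  gmul : gsp -> gsp -> gsp;
  gone : gsp;
  ginv : gsp -> gsp
}.

Definition is_lie_group (K : group_data) : Prop :=
  [/\ is_manifold K,
      is_group (@gmul K) (gone K) (@ginv K),
      smooth (fun x : prodS K K => gmul x.1 x.2) &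
      smooth (@ginv K)].

Definition Lie (K : group_data) : space R := eucl (dim K).

Definition Ad (K : group_data) (k : K) : Lie K -> Lie K :=
  mder (fun x : K => gmul (gmul k x) (ginv k)) (gone K).

Record xmod := XMod {
  xG : group_data;
  xH : group_data;
  xtau : xH -> xG;
  xalpha : xG -> xH -> xH
}.

Definition is_lie_crossed_module (X : xmod) : Prop :=
  let tau := @xtau X in let alpha := @xalpha X in
  [/\ is_lie_group (xG X) /\ is_lie_group (xH X),
      [/\ smooth (fun x : prodS (xG X) (xH X) => alpha x.1 x.2),
          forall h, alpha (gone (xG X)) h = h,
          forall g g' h, alpha (gmul g g') h = alpha g (alpha g' h) &
          forall g h h', alpha g (gmul h h') = gmul (alpha g h) (alpha g h')],
      smooth tau /\ (forall h h', tau (gmul h h') = gmul (tau h) (tau h')),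
      forall g h, tau (alpha g h) = gmul (gmul g (tau h)) (ginv g) &
      forall h h', alpha (tau h) h' = gmul (gmul h h') (ginv h)].

(* H ><| G, with (h2, g2) (h1, g1) = (h2 alpha(g2, h1), g2 g1).  As its chart *)
(* at the identity is a product of charts, its Lie algebra consists of the    *)
(* row_mx A B with A in L(H) and B in L(G).                                   *)
Definition semi (X : xmod) : group_data :=
  {| gsp := prodS (xH X) (xG X);
     gmul := fun x2 x1 =>
       (gmul x2.1 (xalpha x2.2 x1.1), gmul x2.2 x1.2);
     gone := (gone (xH X), gone (xG X));
     ginv := fun x => (xalpha (ginv x.2) (ginv x.1), ginv x.2) |}.

Definition dtau (X : xmod) : Lie (xH X) -> Lie (xG X) :=
  mder (@xtau X) (gone (xH X)).

Definition dalpha (X : xmod) (g : xG X) : Lie (xH X) -> Lie (xH X) :=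
  mder (xalpha g) (gone (xH X)).

End LieGroups.

Arguments group_data R : clear implicits.
Arguments xmod R : clear implicits.

(* ------------------------------------------------------------------------ *)
(* Lie groupoids, functors, natural transformations                         *)
(* ------------------------------------------------------------------------ *)

Section LieGroupoids.
Context {R : realType}.

(* cp is the manifold of composable pairs: z stands for the pair             *)
(* (pr2 z, pr1 z), with composite mul z = pr2 z o pr1 z.                     *)
Record sgrpd := Sgrpd {
  ob : space R;
  ar : space R;
  cp : space R;
  src : ar -> ob;
  tgt : ar -> ob;
  unit1 : ob -> ar;
  inv1 : ar -> ar;
  pr2 : cp -> ar;
  pr1 : cp -> ar;
  mul : cp -> ar
}.

Definition composite (X : sgrpd) (g f h : ar X) : Prop :=
  exists z : cp X, [/\ pr2 z = g, pr1 z = f & mul z = h].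

(* cp X is the fibre product ar X x_{ob X} ar X in the category of smooth    *)
(* manifolds: its points are the composable pairs, and a map into it is      *)
(* smooth as soon as its two components are.                                 *)
Definition is_fibre_product (X : sgrpd) : Prop :=
  [/\ smooth (@pr2 X) /\ smooth (@pr1 X),
      forall z : cp X, tgt (pr1 z) = src (pr2 z),
      forall g f : ar X, tgt f = src g ->
        exists! z : cp X, pr2 z = g /\ pr1 z = f &
      forall (Z : space R) (c : Z -> cp X), is_manifold Z ->
        smooth (@pr2 X \o c) -> smooth (@pr1 X \o c) -> smooth c].

Definition is_lie_groupoid (X : sgrpd) : Prop :=
  [/\ [/\ is_manifold (ob X), is_manifold (ar X) & is_manifold (cp X)],
      surjective_submersion (@src X) /\ surjective_submersion (@tgt X),
      is_fibre_product X,
      [/\ smooth (@unit1 X), smooth (@inv1 X) & smooth (@mul X)] &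
      [/\ forall x : ob X, src (unit1 x) = x /\ tgt (unit1 x) = x,
          forall g f h : ar X, composite g f h ->
            src h = src f /\ tgt h = tgt g,
          forall f : ar X, composite f (unit1 (src f)) f /\
                           composite (unit1 (tgt f)) f f,
          forall h g f gf hg k : ar X, composite g f gf ->
            composite h g hg -> composite h gf k -> composite hg f k &
          forall f : ar X, [/\ src (inv1 f) = tgt f, tgt (inv1 f) = src f,
            composite (inv1 f) f (unit1 (src f)) &
            composite f (inv1 f) (unit1 (tgt f))]]].

Record grpd_map (X Y : sgrpd) := GrpdMap {
  fob : ob X -> ob Y;
  far : ar X -> ar Y
}.

Definition is_functor (X Y : sgrpd) (F : grpd_map X Y) : Prop :=
  [/\ smooth (fob F) /\ smooth (far F),
      forall f, src (far F f) = fob F (src f),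
      forall f, tgt (far F f) = fob F (tgt f),
      forall x, far F (unit1 x) = unit1 (fob F x) &
      forall g f h, composite g f h ->
        composite (far F g) (far F f) (far F h)].

Definition idF (X : sgrpd) : grpd_map X X := {| fob := id; far := id |}.

Definition compF (X Y Z : sgrpd) (G : grpd_map Y Z) (F : grpd_map X Y) : grpd_map X Z :=
  {| fob := fob G \o fob F; far := far G \o far F |}.

(* Smooth natural transformations K => K'; these are isomorphisms when Y is  *)
(* a groupoid.                                                               *)
Definition is_nat (X Y : sgrpd) (K K' : grpd_map X Y) (th : ob X -> ar Y) : Prop :=
  [/\ smooth th,
      forall x, src (th x) = fob K x,
      forall x, tgt (th x) = fob K' x &
      forall f, exists h, composite (th (tgt f)) (far K f) h /\
                          composite (far K' f) (th (src f)) h].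

(* r is the horizontal composite th o_H Ph of Ph : L => L' (between functors *)
(* X -> Y) and th : K => K' (between functors Y -> Z).                       *)
Definition is_hcomp (X Y Z : sgrpd) (K : grpd_map Y Z) (th : ob Y -> ar Z)
    (L' : grpd_map X Y) (Ph : ob X -> ar Y) (r : ob X -> ar Z) : Prop :=
  forall x, composite (th (fob L' x)) (far K (Ph x)) (r x).

Definition prodG (X Y : sgrpd) : sgrpd :=
  {| ob := prodS (ob X) (ob Y);
     ar := prodS (ar X) (ar Y);
     cp := prodS (cp X) (cp Y);
     src := fun f => (src f.1, src f.2);
     tgt := fun f => (tgt f.1, tgt f.2);
     unit1 := fun x => (unit1 x.1, unit1 x.2);
     inv1 := fun f => (inv1 f.1, inv1 f.2);
     pr2 := fun z => (pr2 z.1, pr2 z.2);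
     pr1 := fun z => (pr1 z.1, pr1 z.2);
     mul := fun z => (mul z.1, mul z.2) |}.

Definition sndF (X Y : sgrpd) : grpd_map (prodG X Y) Y :=
  @GrpdMap (prodG X Y) Y (fun x => x.2) (fun f => f.2).

(* The tangent groupoid; T(ar x_ob ar) is T(ar) x_T(ob) T(ar), as src and    *)
(* tgt are submersions.                                                      *)
Definition tanG (X : sgrpd) : sgrpd :=
  {| ob := tanS (ob X);
     ar := tanS (ar X);
     cp := tanS (cp X);
     src := tmap (@src X);
     tgt := tmap (@tgt X);
     unit1 := tmap (@unit1 X);
     inv1 := tmap (@inv1 X);
     pr2 := tmap (@pr2 X);
     pr1 := tmap (@pr1 X);
     mul := tmap (@mul X) |}.

Definition tanF (X Y : sgrpd) (F : grpd_map X Y) : grpd_map (tanG X) (tanG Y) :=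
  @GrpdMap (tanG X) (tanG Y) (tmap (fob F)) (tmap (far F)).

(* In the next two definitions the composable pair                           *)
(* ((h2, tau(h1) g1), (h1, g1)) is encoded as (h2, (h1, g1)), and            *)
(* ((A2, tau(A1) + B1), (A1, B1)) as (A2, (A1, B1)).                         *)
Definition grpd2 (X : xmod R) : sgrpd :=
  {| ob := xG X;
     ar := semi X;
     cp := prodS (xH X) (semi X);
     src := fun x => x.2;
     tgt := fun x => gmul (xtau x.1) x.2;
     unit1 := fun g => (gone (xH X), g);
     inv1 := fun x => (ginv x.1, gmul (xtau x.1) x.2);
     pr2 := fun z => (z.1, gmul (xtau z.2.1) z.2.2);
     pr1 := fun z => z.2;
     mul := fun z => (gmul z.1 z.2.1, z.2.2) |}.

Definition LH (X : xmod R) (a : Lie (semi X)) : 'rV[R]_(dim (xH X)) :=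
  lsubmx (a : 'rV[R]_(dim (xH X) + dim (xG X))%N).

Definition LG (X : xmod R) (a : Lie (semi X)) : 'rV[R]_(dim (xG X)) :=
  rsubmx (a : 'rV[R]_(dim (xH X) + dim (xG X))%N).

Definition Lpair (X : xmod R) (A : 'rV[R]_(dim (xH X)))
    (B : 'rV[R]_(dim (xG X))) : Lie (semi X) := row_mx A B.

Definition lie2 (X : xmod R) : sgrpd :=
  {| ob := Lie (xG X);
     ar := Lie (semi X);
     cp := prodS (Lie (xH X)) (Lie (semi X));
     src := fun a => LG a;
     tgt := fun a => (dtau (LH a : Lie (xH X)) : 'rV[R]_(dim (xG X))) + LG a;
     unit1 := fun B => Lpair 0 B;
     inv1 := fun a => Lpair (- LH a)
       ((dtau (LH a : Lie (xH X)) : 'rV[R]_(dim (xG X))) + LG a);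
     pr2 := fun z => Lpair z.1
       ((dtau (LH z.2 : Lie (xH X)) : 'rV[R]_(dim (xG X))) + LG z.2);
     pr1 := fun z => z.2;
     mul := fun z =>
       Lpair ((z.1 : 'rV[R]_(dim (xH X))) + LH z.2) (LG z.2) |}.

Definition addF (Y : sgrpd) (X : xmod R) (F F' : grpd_map Y (lie2 X)) :
    grpd_map Y (lie2 X) :=
  @GrpdMap Y (lie2 X)
    (fun x => (fob F x : 'rV[R]_(dim (xG X))) + fob F' x)
    (fun f => (far F f : 'rV[R]_(dim (semi X))) + far F' f).

Definition addN (Y : sgrpd) (X : xmod R) (th th' : ob Y -> ar (lie2 X)) :
    ob Y -> ar (lie2 X) :=
  fun x => (th x : 'rV[R]_(dim (semi X))) + th' x.

End LieGroupoids.

Arguments sgrpd R : clear implicits.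

(* ------------------------------------------------------------------------ *)
(* Principal 2-bundles                                                      *)
(* ------------------------------------------------------------------------ *)

Section Bundles.
Context {R : realType}.

Definition principal_bundle (K : group_data R) (P M : space R) (pi : P -> M)
    (act : P -> K -> P) : Prop :=
  [/\ smooth pi,
      smooth (fun x : prodS P K => act x.1 x.2),
      (forall p, act p (gone K) = p) /\
        (forall p g h, act (act p g) h = act p (gmul g h)),
      forall p g, pi (act p g) = pi p &
      forall x : M, exists U : set M, [/\ open (U : set (top M)), U x &
        (* (pi, phi) and psi are mutually inverse equivariant diffeomorphisms *)
        (* between the restriction of P to U and U x K                        *)
        exists (phi : P -> K) (psi : M -> K -> P),
        [/\ smooth_in (pi @^-1` U) phi,
            smooth_in (M := prodS M K) (U `*` setT) (fun y => psi y.1 y.2),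
            forall y k, U y -> pi (psi y k) = y /\ phi (psi y k) = k,
            forall p, U (pi p) -> psi (pi p) (phi p) = p &
            forall p k, U (pi p) -> phi (act p k) = gmul (phi p) k]]].

Record bundle_data (X : xmod R) := BundleData {
  tot : sgrpd R;
  base : sgrpd R;
  proj : grpd_map tot base;
  rho : grpd_map (prodG tot (grpd2 X)) tot
}.

Definition act0 (X : xmod R) (E : bundle_data X) (p : ob (tot E)) (g : xG X) :
    ob (tot E) := fob (rho E) (p, g).

Definition act1 (X : xmod R) (E : bundle_data X) (p : ar (tot E)) (k : semi X) :
    ar (tot E) := far (rho E) (p, k).

Definition is_principal_2bundle (X : xmod R) (E : bundle_data X) : Prop :=
  [/\ is_lie_groupoid (tot E) /\ is_lie_groupoid (base E),
      is_functor (proj E),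
      is_functor (rho E),
      principal_bundle (fob (proj E)) (@act0 X E) &
      principal_bundle (K := semi X) (far (proj E)) (@act1 X E)].

Section FixedBundle.
Variables (X : xmod R) (E : bundle_data X).

(* 1_g in the group of arrows of the 2-group. *)
Definition one1 (g : xG X) : semi X := @unit1 R (grpd2 X) g.

Definition is_automorphism (F : grpd_map (tot E) (tot E)) : Prop :=
  is_functor F /\ exists F', [/\ is_functor F',
    compF F F' = idF (tot E) & compF F' F = idF (tot E)].

Record gauge_ob := GaugeOb {
  gfun :> grpd_map (tot E) (tot E);
  gfunP : [/\ is_automorphism gfun,
    forall p g, fob gfun (act0 p g) = act0 (fob gfun p) g,
    forall p k, far gfun (act1 p k) = act1 (far gfun p) k &
    compF (proj E) gfun = proj E]
}.

Record gauge_mor := GaugeMor {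
  gdom : gauge_ob;
  gcod : gauge_ob;
  gmap : ob (tot E) -> ar (tot E);
  gmapP : [/\ is_nat gdom gcod gmap,
    forall p g, gmap (act0 p g) = act1 (gmap p) (one1 g) &
    forall p, far (proj E) (gmap p) = unit1 (fob (proj E) p)]
}.

(* (p, v) . g *)
Definition tact0 (x : tanS (ob (tot E))) (g : xG X) : tanS (ob (tot E)) :=
  tmap (fun p => act0 p g) x.

Definition tact1 (x : tanS (ar (tot E))) (k : semi X) : tanS (ar (tot E)) :=
  tmap (fun p => act1 p k) x.

Definition equivariant_form (lam : tanS (ob (tot E)) -> Lie (xH X)) : Prop :=
  one_form lam /\
  forall x g, lam (tact0 x g) = dalpha (ginv g) (lam x).

(* The functor bar(lambda), which is automatically smooth and functorial.     *)
Definition olam (lam : tanS (ob (tot E)) -> Lie (xH X)) :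
    grpd_map (tanG (tot E)) (lie2 X) :=
  @GrpdMap R (tanG (tot E)) (lie2 X)
    (fun x => dtau (lam x))
    (fun w => Lpair
       ((lam (tmap (@tgt R (tot E)) w) : 'rV[R]_(dim (xH X)))
          - lam (tmap (@src R (tot E)) w))
       (dtau (lam (tmap (@src R (tot E)) w)))).

Definition is_olam (w : grpd_map (tanG (tot E)) (lie2 X)) : Prop :=
  exists2 lam, equivariant_form lam & w = olam lam.

Definition deltaF : grpd_map (prodG (tot E) (lie2 X)) (tanG (tot E)) :=
  @GrpdMap R (prodG (tot E) (lie2 X)) (tanG (tot E))
    (fun y => tmap (@act0 X E y.1) (gone (xG X), y.2))
    (fun y => tmap (@act1 X E y.1) (gone (semi X), y.2)).

Definition is_semistrict (w : grpd_map (tanG (tot E)) (lie2 X)) : Prop :=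
  [/\ is_functor w,
      one_form (fob w : _ -> Lie (xG X)) /\
        one_form (far w : _ -> Lie (semi X)),
      forall x g, fob w (tact0 x g) = Ad (ginv g) (fob w x),
      forall x k, far w (tact1 x k) = Ad (ginv k) (far w x) &
      exists kappa : ob (prodG (tot E) (lie2 X)) -> ar (lie2 X),
        [/\ is_nat (compF w deltaF) (sndF (tot E) (lie2 X)) kappa,
            forall p, linear (fun B : 'rV[R]_(dim (xG X)) =>
              (kappa (p, B) : 'rV[R]_(dim (semi X)))) &
            forall p g B, kappa (act0 p g, Ad (ginv g) B) =
              Ad (ginv (one1 g)) (kappa (p, B))]].

(* Objects and morphisms of the category of those functors TE -> L(G) that   *)
(* satisfy P, and smooth equivariant fibrewise linear natural                *)
(* transformations: P is is_olam or is_semistrict.                           *)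
Record form_ob (P : grpd_map (tanG (tot E)) (lie2 X) -> Prop) := FormOb {
  wfun :> grpd_map (tanG (tot E)) (lie2 X);
  wfunP : P wfun
}.

Record form_mor (P : grpd_map (tanG (tot E)) (lie2 X) -> Prop) := FormMor {
  wdom : form_ob P;
  wcod : form_ob P;
  wmap : ob (tanG (tot E)) -> ar (lie2 X);
  wmapP : [/\ is_nat wdom wcod wmap,
    forall x g, wmap (tact0 x g) = Ad (ginv (one1 g)) (wmap x) &
    fibre_linear (wmap : tanS (ob (tot E)) -> Lie (semi X))]
}.

End FixedBundle.
End Bundles.

Arguments is_olam {R X} E w.
Arguments is_semistrict {R X} E w.

(* ------------------------------------------------------------------------ *)
(* Categories, strict 2-groups, actions                                     *)
(* ------------------------------------------------------------------------ *)

Record category (O M : Type) (cdom ccod : M -> O) := Category {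
  idm : O -> M;
  vcomp : forall g f : M, ccod f = cdom g -> M;
  cdom_id : forall x, cdom (idm x) = x;
  ccod_id : forall x, ccod (idm x) = x;
  cdom_vcomp : forall g f e, cdom (@vcomp g f e) = cdom f;
  ccod_vcomp : forall g f e, ccod (@vcomp g f e) = ccod g;
  vcomp_idl : forall f e, @vcomp (idm (ccod f)) f e = f;
  vcomp_idr : forall f e, @vcomp f (idm (cdom f)) e = f;
  vcompA : forall h g f gf hg e e',
    @vcomp h (@vcomp g f gf) e = @vcomp (@vcomp h g hg) f e'
}.

(* A group object in the category of groupoids. *)
Record two_group (O M : Type) (cdom ccod : M -> O)
    (C : category cdom ccod) := TwoGroup {
  ob_mul : O -> O -> O;
  ob_one : O;
  ob_inv : O -> O;
  mor_mul : M -> M -> M;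
  mor_one : M;
  mor_inv : M -> M;
  ob_mulP : is_group ob_mul ob_one ob_inv;
  mor_mulP : is_group mor_mul mor_one mor_inv;
  cdom_mul : forall a b, cdom (mor_mul a b) = ob_mul (cdom a) (cdom b);
  ccod_mul : forall a b, ccod (mor_mul a b) = ob_mul (ccod a) (ccod b);
  idm_mul : forall x y, idm C (ob_mul x y) = mor_mul (idm C x) (idm C y);
  vcomp_mul : forall g f g' f' e e' e2,
    vcomp C (g := mor_mul g g') (f := mor_mul f f') e2 =
    mor_mul (vcomp C (g := g) (f := f) e) (vcomp C (g := g') (f := f') e');
  vcomp_inv : forall f, exists g e e',
    vcomp C (g := g) (f := f) e = idm C (cdom f) /\
    vcomp C (g := f) (f := g) e' = idm C (ccod f)
}.

Definition is_2action (O M : Type) (cdom ccod : M -> O)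
    (C : category cdom ccod) (S : two_group C)
    (O' M' : Type) (cdom' ccod' : M' -> O') (D : category cdom' ccod')
    (oact : O -> O' -> O') (mact : M -> M' -> M') : Prop :=
  [/\ (forall a z, cdom' (mact a z) = oact (cdom a) (cdom' z)) /\
        (forall a z, ccod' (mact a z) = oact (ccod a) (ccod' z)),
      forall x w, mact (idm C x) (idm D w) = idm D (oact x w),
      forall b a z' z e e' e2,
        mact (vcomp C (g := b) (f := a) e) (vcomp D (g := z') (f := z) e') =
        vcomp D (g := mact b z') (f := mact a z) e2,
      (forall w, oact (ob_one S) w = w) /\
        (forall x y w, oact (ob_mul S x y) w = oact x (oact y w)) &
      (forall z, mact (mor_one S) z = z) /\
        (forall a b z, mact (mor_mul S a b) z = mact a (mact b z))].

Section ProductCategory.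
Variables (O M O' M' : Type) (cdom ccod : M -> O) (cdom' ccod' : M' -> O').
Variables (C : category cdom ccod) (D : category cdom' ccod').

Definition pdom (a : M * M') : O * O' := (cdom a.1, cdom' a.2).
Definition pcod (a : M * M') : O * O' := (ccod a.1, ccod' a.2).

Definition prod_category : category pdom pcod.
Proof.
refine (@Category _ _ pdom pcod (fun x => (idm C x.1, idm D x.2))
  (fun g f e => (vcomp C (g := g.1) (f := f.1) (congr1 fst e),
                 vcomp D (g := g.2) (f := f.2) (congr1 snd e)))
  _ _ _ _ _ _ _).
- by case=> x y; rewrite /pdom /= !cdom_id.
- by case=> x y; rewrite /pcod /= !ccod_id.
- by move=> g f e; rewrite /pdom /= !cdom_vcomp.
- by move=> g f e; rewrite /pcod /= !ccod_vcomp.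
- by case=> f1 f2 e; rewrite /= !vcomp_idl.
- by case=> f1 f2 e; rewrite /= !vcomp_idr.
- move=> h g f gf hg e e' /=; congr pair; exact: vcompA.
Defined.

End ProductCategory.

(* The identities and the composition of C, whose objects x are functors     *)
(* fn x and whose morphisms a are natural transformations mp a, are the      *)
(* usual pointwise ones.                                                     *)
Definition vertical (R : realType) (X Y : sgrpd R) (O M : Type)
    (cdom ccod : M -> O) (fn : O -> grpd_map X Y) (mp : M -> ob X -> ar Y)
    (C : category cdom ccod) : Prop :=
  (forall x p, mp (idm C x) p = unit1 (fob (fn x) p)) /\
  (forall g f e p, composite (mp g p) (mp f p) (mp (vcomp C (g := g) (f := f) e) p)).

Definition is_gauge_2group (R : realType) (X : xmod R) (E : bundle_data X)
    (C : category (@gdom R X E) (@gcod R X E)) (S : two_group C) : Prop :=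
  (forall F F' : gauge_ob E, gfun (ob_mul S F F') = compF F F') /\
  (forall Ps Ps' : gauge_mor E,
     is_hcomp (gdom Ps) (gmap Ps) (gcod Ps') (gmap Ps') (gmap (mor_mul S Ps Ps'))).

(* Main.v *)
(** All tangent-level identities come from identities between the underlying
    smooth maps by the chain rule; for composable tangent arrows one first lifts
    a pair of composable maps to the fibre product of composable arrows by its
    universal property and then differentiates, so that its tangent spaces need
    not be described.

    A natural transformation into the Lie 2-algebra is its domain together with
    an L(H)-valued map, and vertical composition adds these maps.  Horizontal
    composition with the differential of a gauge transformation therefore
    defines a right action of the gauge 2-group by additive maps, and the
    extended 2-group is the resulting semidirect product with the abelian
    2-group of the forms olam lambda.

    Two points are specific to semi-strict connections.  Equivariance of
    olam lambda under all arrows of the 2-group holds because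
    (a, c) |-> (a c^-1, tau c) is a homomorphism H x H -> H ><| G which carries
    alpha_(t k) x alpha_(s k) to conjugation by k.  And omega + olam lambda is
    again semi-strict because -lambda is a natural isomorphism from olam lambda
    to 0, which corrects kappa. *)

From HB Require Import structures.
From mathcomp Require Import all_boot all_order all_algebra.
From mathcomp Require Import all_classical all_reals all_analysis.
Require Import Defs.

Set Implicit Arguments.
Unset Strict Implicit.
Unset Printing Implicit Defensive.

Import Order.TTheory GRing.Theory Num.Theory.
Import numFieldNormedType.Exports.

Local Open Scope classical_set_scope.
Local Open Scope ring_scope.

(** * Smooth maps between spaces of row vectors *)

(** Tangent vectors are coordinates in a preferred chart that changes abruptly from point to point,
    so a tangent map has to be compared with its expression in fixed charts. This is again the chain
    rule, applied to identity maps, whose coordinate expressions are the chart transitions.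

    The universal property of composable pairs is granted only for test spaces that are manifolds,
    whereas tangent spaces are merely shown to carry an atlas. The test spaces are therefore the
    manifolds of objects, of arrows and of composable pairs themselves, and [tmap] is applied
    afterwards.

    Composition is a relation; it is made total by [gc] in the gauge 2-group, and on forms it
    becomes addition of L(H)-components. Morphisms are compared by their ends and pointwise, the
    proofs stored in the records being irrelevant.

    The forms [olam] and the semi-strict connections admit the same two operations, adding some
    [olam lam] and pulling back. Their laws are proved once, for a predicate [P] on functors, and
    serve both for the group law and for the action. *)

Section Differentials.
Context {R : realType}.
Implicit Types m n p k : nat.

Lemma differentiable_is_diff m n (f : 'rV[R]_m -> 'rV[R]_n) x :
  differentiable f x -> is_diff x f ('d f x).
Proof. by move=> df; apply: DiffDef. Qed.

Lemma is_diffE m n (f df : 'rV[R]_m -> 'rV[R]_n) x v :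
  is_diff x f df -> 'd f x v = df v.
Proof. by case=> _ ->. Qed.

Lemma is_diff_val m n (f df : 'rV[R]_m -> 'rV[R]_n) x :
  is_diff x f df -> 'd f x = df :> ('rV[R]_m -> 'rV[R]_n).
Proof. by case. Qed.

(* Unlike in ['d f x v], the point [x] can be rewritten in [dif f x v]. *)
Definition dif m n (f : 'rV[R]_m -> 'rV[R]_n) (x v : 'rV[R]_m) : 'rV[R]_n :=
  'd f x v.

(** In coordinates the map is a finite sum of coordinate functions times fixed vectors, each of them
    continuous. *)
Lemma linear_rV_continuous m n (f : {linear 'rV[R]_m -> 'rV[R]_n}) :
  continuous f.
Proof.
have -> : (f : _ -> _) = fun x => \sum_j x ord0 j *: f (delta_mx ord0 j).
  apply/funext => x; rewrite {1}(row_sum_delta x) linear_sum.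
  by apply: eq_bigr => j _; rewrite linearZ.
have H : forall j, continuous (fun x : 'rV[R]_m => x ord0 j *: f (delta_mx ord0 j)).
  move=> j x.
  have c : (fun y : 'rV[R]_m => y ord0 j) @ x --> x ord0 j by exact: coord_continuous.
  exact: cvgZr_tmp c.
apply: continuous_big => //; exact: add_continuous.
Qed.

Lemma is_diff_linear m n (f : 'rV[R]_m -> 'rV[R]_n) (x : 'rV[R]_m) :
  linear f -> is_diff x f f.
Proof.
move=> lf; pose fL : {linear 'rV[R]_m -> 'rV[R]_n} :=
  HB.pack f (GRing.isLinear.Build _ _ _ _ _ lf).
have cf : continuous fL by exact: linear_rV_continuous.
apply: DiffDef; first exact: (@linear_differentiable _ _ _ fL).
exact: (@diff_lin _ _ _ fL).
Qed.

(** A map that vanishes near [x] is negligible against any increment, which is what characterises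
    the differential 0. This is the seed of [is_diff_near]: coordinate expressions of maps agree
    only near a point, so differentials must be seen to depend on germs alone. *)
Lemma is_diff_near0 m n (h : 'rV[R]_m -> 'rV[R]_n) x :
  (\forall y \near x, h y = 0) -> is_diff x h 0.
Proof.
move=> h0.
have hx : h x = 0 by exact: nbhs_singleton h0.
have o : h \o shift x = cst (h x) + (0 : 'rV[R]_m -> 'rV[R]_n) +o_ 0 id.
  apply/eqaddoE; rewrite hx.
  suff -> : h \o shift x = [o_ 0 id of h \o shift x].
    by apply/funext => y /=; rewrite /cst /= !fctE !add0r.
  apply/eqoP => _/posnumP[e]; rewrite near_simpl.
  have : \forall y \near (0 : 'rV[R]_m), h (y + x) = 0.
    have c : continuous (fun y : 'rV[R]_m => y + x).
      move=> y; apply: (@differentiable_continuous R _ _ y (id + cst x)).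
      by have [] := is_diffD (is_diff_id y) (is_diff_cst x y).
    have c0 := c 0; rewrite /continuous_at add0r in c0.
    exact: c0 h0.
  by apply: filterS => y /= ->; rewrite normr0 mulr_ge0.
have d0 : 'd h x = (0 : 'rV[R]_m -> 'rV[R]_n) :> (_ -> _).
  by apply/diff_unique; [exact: cst_continuous|].
apply: DiffDef; last by rewrite d0.
apply/diff_locallyP; rewrite d0; split; first exact: cst_continuous.
exact: o.
Qed.

Lemma is_diff_near m n (f g : 'rV[R]_m -> 'rV[R]_n) x :
  differentiable f x -> (\forall y \near x, f y = g y) -> is_diff x g ('d f x).
Proof.
move=> df fg.
have h0 : is_diff x (g - f) 0.
  by apply: is_diff_near0; apply: filterS fg => y e; rewrite !fctE e subrr.
have -> : g = f + (g - f) by apply/funext => y; rewrite !fctE addrC subrK.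
have := is_diffD (differentiable_is_diff df) h0.
by rewrite addr0.
Qed.

(** Product rule. The scalar factor is a coordinate of a vector-valued map because [Ck] speaks only
    of maps between row vectors. *)
Lemma is_diff_scale m n q (a : 'rV[R]_m -> 'rV[R]_q) (b : 'rV[R]_m -> 'rV[R]_n)
    (j : 'I_q) x :
  differentiable a x -> differentiable b x ->
  is_diff x (fun y => a y ord0 j *: b y)
    (fun v => 'd a x v ord0 j *: b x + a x ord0 j *: 'd b x v).
Proof.
move=> da db.
pose aj (y : 'rV[R]_m) : R := a y ord0 j.
have daj : is_diff x aj (fun v => 'd a x v ord0 j).
  have -> : aj = (fun N : 'rV[R]_q => N ord0 j) \o a by [].
  have lc : linear (fun N : 'rV[R]_q => N ord0 j : R) by move=> c u v; rewrite !mxE.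
  pose L : {linear 'rV[R]_q -> R} :=
    HB.pack (fun N : 'rV[R]_q => N ord0 j : R) (GRing.isLinear.Build _ _ _ _ _ lc).
  have cL : continuous L by exact: coord_continuous.
  have dL : is_diff (a x) (fun N : 'rV[R]_q => N ord0 j : R) L.
    apply: DiffDef; first exact: (@linear_differentiable _ _ _ L).
    exact: (@diff_lin _ _ _ L).
  exact: is_diff_comp (differentiable_is_diff da) dL.
have bs : bilinear_for (GRing.Scale.Law.clone _ _ *:%R _)
    (GRing.Scale.Law.clone _ _ *:%R _) ( *:%R : R -> 'rV[R]_n -> 'rV[R]_n).
  split=> [u'|u'] c u v /=.
  - by rewrite scalerDl scalerA.
  - by rewrite scalerDr !scalerA mulrC.
pose B : {bilinear R -> 'rV[R]_n -> 'rV[R]_n} :=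
  HB.pack ( *:%R : R -> 'rV[R]_n -> 'rV[R]_n)
    (bilinear_isBilinear.Build _ _ _ _ _ _ _ bs).
have cB : continuous (fun p : R * 'rV[R]_n => B p.1 p.2) by exact: scale_continuous.
have dB : is_diff (aj x, b x) (fun p : R * 'rV[R]_n => B p.1 p.2)
    (fun q => B (aj x) q.2 + B q.1 (b x)).
  apply: DiffDef; first exact: differentiable_bilin.
  by rewrite diff_bilin.
have := is_diff_comp (is_diff_pair daj (differentiable_is_diff db)) dB.
by move=> H; apply: is_diff_eq H _; apply/funext => v /=; rewrite addrC.
Qed.

(** * Iterated differentiability on a set *)

Lemma CkS_Ck k m n (U : set 'rV[R]_m) (f : 'rV[R]_m -> 'rV[R]_n) :
  Ck k.+1 U f -> Ck k U f.
Proof.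
elim: k f => [|k IH] f [df dfv] /=.
  by move=> x Ux; exact: differentiable_continuous (df x Ux).
by split=> // v; exact: IH.
Qed.

Lemma Ck_sub k m n (U V : set 'rV[R]_m) (f : 'rV[R]_m -> 'rV[R]_n) :
  V `<=` U -> Ck k U f -> Ck k V f.
Proof.
move=> VU; elim: k f => [|k IH] f /=; first by move=> H x /VU; exact: H.
by move=> [df dfv]; split=> [x /VU|v]; [exact: df|exact: IH].
Qed.

(** Each clause of [Ck] is a condition on the points of [U] one at a time, so it may be checked on
    sets chosen point by point. *)
Lemma Ck_local k m n (U : set 'rV[R]_m) (f : 'rV[R]_m -> 'rV[R]_n) :
  (forall x, U x -> exists2 V, V x & Ck k V f) -> Ck k U f.
Proof.
elim: k f => [|k IH] f H /=; first by move=> x /H [V Vx Hf]; exact: Hf.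
split=> [x /H [V Vx [df _]]|v]; first exact: df.
by apply: IH => x /H [V Vx [_ dfv]]; exists V => //; exact: dfv.
Qed.

Lemma open_near m (U : set 'rV[R]_m) (P : set 'rV[R]_m) :
  open U -> U `<=` P -> forall x, U x -> \forall y \near x, P y.
Proof.
by move=> oU UP x Ux; apply: filterS (open_nbhs_nbhs (conj oU Ux)).
Qed.

(** Continuity and differentials at a point see only a neighbourhood, which the open set [U]
    provides. The directional derivatives then agree on [U] as well, and the induction goes on. *)
Lemma Ck_eq k m n (U : set 'rV[R]_m) (f g : 'rV[R]_m -> 'rV[R]_n) :
  open U -> (forall x, U x -> f x = g x) -> Ck k U f -> Ck k U g.
Proof.
move=> oU; elim: k f g => [|k IH] f g fg /=.
  move=> H x Ux; have : f @ x --> f x := H x Ux.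
  rewrite (fg x Ux) => Hx; change (g @ x --> g x).
  exact: cvg_trans (near_eq_cvg (F := nbhs x) (open_near oU fg Ux)) Hx.
move=> [df dfv].
have D x : U x -> is_diff x g ('d f x).
  by move=> Ux; apply: is_diff_near; [exact: df|exact: (open_near oU fg Ux)].
split=> [x /D [d _]|v]; first exact: d.
refine (IH _ _ _ (dfv v)) => x Ux.
exact: esym (is_diffE v (D x Ux)).
Qed.

Lemma Ck_cst k m n (U : set 'rV[R]_m) (c : 'rV[R]_n) : Ck k U (fun=> c).
Proof.
elim: k c => [|k IH] c /=; first by move=> x _; exact: cst_continuous.
split=> [x _|v]; first exact: differentiable_cst.
suff -> : (fun x => 'd (fun=> c) x v) = (fun=> 0) :> (_ -> 'rV[R]_n) by [].
by apply/funext => x; rewrite (diff_cst c x).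
Qed.

Lemma Ck_lin k m n (U : set 'rV[R]_m) (f : 'rV[R]_m -> 'rV[R]_n) :
  linear f -> Ck k U f.
Proof.
move=> lf; case: k => [|k] /=.
  move=> x _; have [d _] := is_diff_linear x lf.
  exact: differentiable_continuous d.
split=> [x _|v]; first by have [] := is_diff_linear x lf.
suff -> : (fun x => 'd f x v) = (fun=> f v) by exact: Ck_cst.
by apply/funext => x; exact: is_diffE v (is_diff_linear x lf).
Qed.

Lemma Ck_linl k m n q (U : set 'rV[R]_m) (f : 'rV[R]_m -> 'rV[R]_n)
    (L : 'rV[R]_n -> 'rV[R]_q) : open U ->
  linear L -> Ck k U f -> Ck k U (L \o f).
Proof.
move=> oU lL; elim: k f => [|k IH] f /=.
  move=> H x /H cf; apply: continuous_comp => //.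
  by have [d _] := is_diff_linear (f x) lL; exact: differentiable_continuous d.
move=> [df dfv].
have D x : U x -> is_diff x (L \o f) (L \o 'd f x).
  by move=> /df d; exact: is_diff_comp (differentiable_is_diff d) (is_diff_linear _ lL).
split=> [x /D [d _]|v]; first exact: d.
apply: (Ck_eq oU (f := L \o (fun x => 'd f x v))).
  by move=> x Ux; exact: esym (is_diffE v (D x Ux)).
exact: IH.
Qed.

Lemma Ck_add k m n (U : set 'rV[R]_m) (f g : 'rV[R]_m -> 'rV[R]_n) : open U ->
  Ck k U f -> Ck k U g -> Ck k U (fun x => f x + g x).
Proof.
move=> oU; elim: k f g => [|k IH] f g /=.
  move=> Hf Hg x Ux; have cf : f @ x --> f x := Hf x Ux.
  have cg : g @ x --> g x := Hg x Ux; exact: cvgD cf cg.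
move=> [df dfv] [dg dgv].
have D x : U x -> is_diff x (fun y => f y + g y) (fun v => 'd f x v + 'd g x v).
  move=> Ux; exact: is_diffD (differentiable_is_diff (df x Ux)) (differentiable_is_diff (dg x Ux)).
split=> [x /D [d _]|v]; first exact: d.
apply: (Ck_eq oU (f := fun x => 'd f x v + 'd g x v)).
  by move=> x Ux; exact: esym (is_diffE v (D x Ux)).
exact: IH (dfv v) (dgv v).
Qed.

Lemma Ck_scale k m n q (U : set 'rV[R]_m) (a : 'rV[R]_m -> 'rV[R]_q)
    (b : 'rV[R]_m -> 'rV[R]_n) (j : 'I_q) : open U ->
  Ck k U a -> Ck k U b -> Ck k U (fun x => a x ord0 j *: b x).
Proof.
move=> oU; elim: k a b => [|k IH] a b.
  move=> /= Ha Hb x Ux; have cb : b @ x --> b x := Hb x Ux.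
  have ca : (fun y => a y ord0 j) @ x --> a x ord0 j.
    apply: (@continuous_comp _ _ _ a (fun N : 'rV[R]_q => N ord0 j)).
      exact: Ha.
    exact: coord_continuous.
  exact: cvgZ ca cb.
move=> Ha Hb; have [da dav] := Ha; have [db dbv] := Hb.
have D x (Ux : U x) := is_diff_scale j (da x Ux) (db x Ux).
split=> [x /D [d _]|v]; first exact: d.
apply: (Ck_eq oU (f := fun x => 'd a x v ord0 j *: b x + a x ord0 j *: 'd b x v)).
  by move=> x Ux; exact: esym (is_diffE v (D x Ux)).
exact: (Ck_add oU (IH _ _ (dav v) (CkS_Ck Hb)) (IH _ _ (CkS_Ck Ha) (dbv v))).
Qed.

Lemma Ck_sum k m n (I : Type) (r : seq I) (U : set 'rV[R]_m)
    (f : I -> 'rV[R]_m -> 'rV[R]_n) : open U ->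
  (forall i, Ck k U (f i)) -> Ck k U (fun x => \sum_(i <- r) f i x).
Proof.
move=> oU H; elim: r => [|i r IH].
  by under eq_fun do rewrite big_nil; exact: Ck_cst.
by under eq_fun do rewrite big_cons; exact: Ck_add.
Qed.

Lemma linear_rowE m n (f : 'rV[R]_m -> 'rV[R]_n) x : linear f ->
  f x = \sum_j x ord0 j *: f (delta_mx ord0 j).
Proof.
move=> lf; pose fL : {linear 'rV[R]_m -> 'rV[R]_n} :=
  HB.pack f (GRing.isLinear.Build _ _ _ _ _ lf).
rewrite -[f]/(fL : _ -> _) {1}(row_sum_delta x) linear_sum.
by apply: eq_bigr => j _; rewrite linearZ.
Qed.

(** [Ck] controls derivatives in fixed directions only, whereas the chain rule differentiates [g] in
    the moving direction ['d f x v]. Expanding that direction in the standard basis gives a sum of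
    products of a coordinate of ['d f x v] and a composite of [f] with a partial derivative of [g];
    these are handled by the product rule and the induction hypothesis. *)
Lemma Ck_comp k m n q (U : set 'rV[R]_m) (V : set 'rV[R]_n)
    (f : 'rV[R]_m -> 'rV[R]_n) (g : 'rV[R]_n -> 'rV[R]_q) :
  open U -> (forall x, U x -> V (f x)) ->
  Ck k U f -> Ck k V g -> Ck k U (g \o f).
Proof.
move=> oU UV; elim: k f g UV => [|k IH] f g UV.
  move=> Hf Hg x Ux; apply: continuous_comp; first exact: Hf.
  by apply: Hg; exact: UV.
move=> Hf Hg; have [df dfv] := Hf; have [dg dgv] := Hg.
have D x (Ux : U x) : is_diff x (g \o f) ('d g (f x) \o 'd f x).
  exact: is_diff_comp (differentiable_is_diff (df x Ux)) (differentiable_is_diff (dg _ (UV x Ux))).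
split=> [x /D [d _]|v]; first exact: d.
apply: (Ck_eq oU (f := fun x => \sum_j ('d f x v) ord0 j *: 'd g (f x) (delta_mx ord0 j))).
  move=> x Ux; rewrite (is_diffE v (D x Ux)) /=.
  by rewrite -(linear_rowE (f := 'd g (f x))) //; exact: linearP.
apply: Ck_sum => // j; apply: (Ck_scale j oU (dfv v)).
exact: (IH f (fun y => 'd g y (delta_mx ord0 j)) UV (CkS_Ck Hf) (dgv _)).
Qed.

Lemma Cinfty_differentiable m n (U : set 'rV[R]_m) (f : 'rV[R]_m -> 'rV[R]_n) x :
  Cinfty U f -> U x -> differentiable f x.
Proof. by move=> /(_ 1%N) [df _]; exact: df. Qed.

Lemma Cinfty_dir m n (U : set 'rV[R]_m) (f : 'rV[R]_m -> 'rV[R]_n) v :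
  Cinfty U f -> Cinfty U (fun x => 'd f x v).
Proof. by move=> H k; have [_ h] := H k.+1; exact: (h v). Qed.

Lemma Cinfty_eq m n (U : set 'rV[R]_m) (f g : 'rV[R]_m -> 'rV[R]_n) :
  open U -> (forall x, U x -> f x = g x) -> Cinfty U f -> Cinfty U g.
Proof. by move=> oU fg H k; apply: (Ck_eq oU fg). Qed.

Lemma Cinfty_comp m n q (U : set 'rV[R]_m) (V : set 'rV[R]_n)
    (f : 'rV[R]_m -> 'rV[R]_n) (g : 'rV[R]_n -> 'rV[R]_q) :
  open U -> (forall x, U x -> V (f x)) ->
  Cinfty U f -> Cinfty V g -> Cinfty U (g \o f).
Proof. by move=> oU UV Hf Hg k; apply: (Ck_comp oU UV). Qed.

Lemma row_mx0_linear m n : linear (fun x : 'rV[R]_m => row_mx x (0 : 'rV[R]_n)).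
Proof. by move=> a u v; rewrite scale_row_mx add_row_mx scaler0 addr0. Qed.

Lemma row_0mx_linear m n : linear (fun x : 'rV[R]_n => row_mx (0 : 'rV[R]_m) x).
Proof. by move=> a u v; rewrite scale_row_mx add_row_mx scaler0 addr0. Qed.

Lemma row_mx_split m n (u : 'rV[R]_m) (v : 'rV[R]_n) :
  row_mx u v = row_mx u 0 + row_mx 0 v.
Proof. by rewrite add_row_mx addr0 add0r. Qed.

Lemma Cinfty_row_mx m n q (U : set 'rV[R]_m)
    (f : 'rV[R]_m -> 'rV[R]_n) (g : 'rV[R]_m -> 'rV[R]_q) : open U ->
  Cinfty U f -> Cinfty U g -> Cinfty U (fun x => row_mx (f x) (g x)).
Proof.
move=> oU Hf Hg k; under eq_fun do rewrite row_mx_split.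
apply: Ck_add => //.
- exact: (Ck_linl oU (@row_mx0_linear n q) (Hf k)).
- exact: (Ck_linl oU (@row_0mx_linear n q) (Hg k)).
Qed.

Lemma is_diff_row_mx m n q (f df : 'rV[R]_m -> 'rV[R]_n)
    (g dg : 'rV[R]_m -> 'rV[R]_q) x : is_diff x f df -> is_diff x g dg ->
  is_diff x (fun x => row_mx (f x) (g x)) (fun v => row_mx (df v) (dg v)).
Proof.
move=> Hf Hg; have L := is_diffD
  (is_diff_comp Hf (is_diff_linear (f x) (@row_mx0_linear n q)))
  (is_diff_comp Hg (is_diff_linear (g x) (@row_0mx_linear n q))).
have -> : (fun x => row_mx (f x) (g x)) =
    ((fun u : 'rV[R]_n => row_mx u (0 : 'rV[R]_q)) \o f) +
    ((fun u : 'rV[R]_q => row_mx (0 : 'rV[R]_n) u) \o g).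
  by apply/funext => y /=; rewrite row_mx_split.
by apply: is_diff_eq L _; apply/funext => y /=; rewrite [RHS]row_mx_split.
Qed.

Lemma lsubmx_linear m n : linear (fun x : 'rV[R]_(m + n) => lsubmx x).
Proof. by move=> a u v; apply/rowP => i; rewrite !mxE. Qed.

Lemma rsubmx_linear m n : linear (fun x : 'rV[R]_(m + n) => rsubmx x).
Proof. by move=> a u v; apply/rowP => i; rewrite !mxE. Qed.

Lemma linear_continuous m n (f : 'rV[R]_m -> 'rV[R]_n) : linear f -> continuous f.
Proof.
by move=> lf x; have [d _] := is_diff_linear x lf; exact: differentiable_continuous d.
Qed.

Lemma open_lsub_preimage m n (A : set 'rV[R]_m) :
  open A -> open [set w : 'rV[R]_(m + n) | A (lsubmx w)].
Proof.
by move=> oA; apply: open_comp oA => x _; exact: (linear_continuous (@lsubmx_linear m n)).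
Qed.

Lemma open_rsub_preimage m n (A : set 'rV[R]_n) :
  open A -> open [set w : 'rV[R]_(m + n) | A (rsubmx w)].
Proof.
by move=> oA; apply: open_comp oA => x _; exact: (linear_continuous (@rsubmx_linear m n)).
Qed.

Lemma open_local m (U : set 'rV[R]_m) :
  (forall x, U x -> exists V, [/\ open V, V x & V `<=` U]) -> open U.
Proof.
move=> H; rewrite openE => x /H [V [oV Vx VU]].
exact: filterS VU (open_nbhs_nbhs (conj oV Vx)).
Qed.

Lemma open_preimage_in m n (A : set 'rV[R]_m) (B : set 'rV[R]_n)
    (f : 'rV[R]_m -> 'rV[R]_n) :
  open A -> (forall x, A x -> {for x, continuous f}) -> open B ->
  open (A `&` f @^-1` B).
Proof.
move=> oA cf oB; rewrite openE => x [Ax Bfx].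
have HA : nbhs x A by exact: open_nbhs_nbhs.
have HB : nbhs (f x) B by exact: open_nbhs_nbhs.
exact: filterI HA (cf x Ax _ HB).
Qed.

(** Joint smoothness in the point and the vector: as in [Ck_comp], the vector is expanded in the
    standard basis, leaving partial derivatives of [f] with coordinates as coefficients. *)
Lemma Cinfty_tangent m n (D : set 'rV[R]_m) (f : 'rV[R]_m -> 'rV[R]_n) :
  open D -> Cinfty D f ->
  Cinfty [set w : 'rV[R]_(m + m) | D (lsubmx w)] (fun w => 'd f (lsubmx w) (rsubmx w)).
Proof.
move=> oD Hf k; set U := [set w | _].
have oU : open U by exact: open_lsub_preimage.
apply: (Ck_eq oU (f := fun w : 'rV[R]_(m + m) =>
  \sum_j (rsubmx w) ord0 j *: 'd f (lsubmx w) (delta_mx ord0 j))).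
  move=> w _; rewrite -(linear_rowE (f := 'd f (lsubmx w))) //; exact: linearP.
apply: Ck_sum => // j; apply: Ck_scale => //; first exact: (Ck_lin _ _ (@rsubmx_linear m m)).
apply: (Ck_comp oU _ (Ck_lin _ _ (@lsubmx_linear m m)) (Cinfty_dir (delta_mx ord0 j) Hf k)).
by [].
Qed.

End Differentials.

(** * Atlases and the chain rule *)

Section Atlases.
Context {R : realType}.
Implicit Types M N P : space R.

(** Enough for charts and parametrisations to cancel in the chain rule. The conditions on
    transitions added in [is_atlas] amount to smoothness of the identity map. *)
Definition charted M :=
  (forall p : M, dom (chartat p) p) /\
  (forall (i : idx M) (p : M), dom i p -> param i (chart i p) = p).

Definition is_atlas M :=
  [/\ charted M,
      forall i j : idx M, open (chart i @` (dom i `&` dom j)) &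
      forall i j : idx M,
        Cinfty (chart i @` (dom i `&` dom j)) (chart j \o param i)].

Lemma manifold_atlas M : is_manifold M -> is_atlas M.
Proof. by case=> a b c d _; split. Qed.

Lemma atlas_charted M : is_atlas M -> charted M.
Proof. by case. Qed.

Lemma smoothP M N (f : M -> N) : smooth f <->
  forall i j, let D := chart i @` (dom i `&` f @^-1` dom j) in
    open D /\ Cinfty D (chart j \o f \o param i).
Proof. by rewrite /smooth /smooth_in; split=> H i j; have := H i j; rewrite setIT. Qed.

Lemma chart_image M (i : idx M) (A : set M) w : charted M ->
  (chart i @` (dom i `&` A)) w <->
  [/\ dom i (param i w), A (param i w) & chart i (param i w) = w].
Proof.
move=> [_ c]; split; first by case=> p [ip Ap] <-; rewrite c.
by case=> a b e; exists (param i w).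
Qed.

Lemma smooth_diff M N (f : M -> N) i j p : charted M -> smooth f ->
  dom i p -> dom j (f p) -> differentiable (chart j \o f \o param i) (chart i p).
Proof.
move=> cM /smoothP /(_ i j) [_ C] ip jf.
by apply: (Cinfty_differentiable C); exists p.
Qed.

(** The image of [f] may need many charts of [N]. Near a given point the preferred chart at its
    image is used, on the set of coordinates that [f] sends into this chart and on which [g] lands
    in the chart [k]; openness and [Ck] are both local. *)
Lemma smooth_comp M N P (f : M -> N) (g : N -> P) : charted M -> charted N ->
  smooth f -> smooth g -> smooth (g \o f).
Proof.
move=> cM cN /smoothP sf /smoothP sg; apply/smoothP => i k D.
have Hw w : D w -> exists V, [/\ open V, V w, V `<=` D &
    Cinfty V (chart k \o (g \o f) \o param i)].
  case=> p [ip kp] <-; pose j := chartat (f p); have jf : dom j (f p) by apply cN.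
  have [ o1 C1] := sf i j; have [ o2 C2] := sg j k.
  set D1 := _ @` _ in o1 C1; set D2 := _ @` _ in o2 C2.
  exists (D1 `&` (chart j \o f \o param i) @^-1` D2).
  have oV : open (D1 `&` (chart j \o f \o param i) @^-1` D2).
    exact: open_preimage_in o1 (C1 0%N) o2.
  have Ev u : D1 u -> param j (chart j (f (param i u))) = f (param i u).
    by move=> /(chart_image _ _ _ cM) [] _ jv _; apply cN.
  split=> //.
  - split; first by exists p.
    by rewrite /= (cM.2 _ _ ip); exists (f p).
  - move=> v [D1v]; have := D1v; move/(chart_image _ _ _ cM) => [iv jv ev].
    move=> /(chart_image _ _ _ cN) /= [_ + _]; rewrite (Ev v D1v) => kv.
    by apply/(chart_image _ _ _ cM).
  - apply: (Cinfty_eq oV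
      (f := (chart k \o g \o param j) \o (chart j \o f \o param i))).
      by move=> v [D1v _] /=; rewrite (Ev v D1v).
    apply: (Cinfty_comp oV _ _ C2); first by move=> v [].
    by move=> q; apply: (Ck_sub _ (C1 q)) => v [].
split; first by apply: open_local => w /Hw [V [? ? ? _]]; exists V.
by move=> q; apply: Ck_local => w /Hw [V [? ? ? C]]; exists V.
Qed.

(** The chain rule in arbitrary charts around the three points. Taking [f] or [g] to be the identity
    yields all the rules for changing charts that follow. *)
Lemma is_diff_rep_comp M N P (f : M -> N) (g : N -> P) i j k p :
  charted M -> charted N -> smooth f -> smooth g ->
  dom i p -> dom j (f p) -> dom k (g (f p)) ->
  'd (chart k \o (g \o f) \o param i) (chart i p) =
  'd (chart k \o g \o param j) (chart j (f p)) \o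
  'd (chart j \o f \o param i) (chart i p) :> (_ -> _).
Proof.
move=> cM cN sf sg ip jf kg.
have d1 := smooth_diff cM sf ip jf.
have d2 := smooth_diff cN sg jf kg.
have e : (chart j \o f \o param i) (chart i p) = chart j (f p).
  by rewrite /= (cM.2 _ _ ip).
have d2' := d2; rewrite -e in d2'.
have [d12 E] := is_diff_comp (differentiable_is_diff d1) (differentiable_is_diff d2').
rewrite e in E; have [ o _] := (smoothP _).1 sf i j.
(* Inserting [param j \o chart j] between the two maps changes nothing only where [f] lands in the
   chart [j], that is, near [chart i p]. *)
have H : is_diff (chart i p) (chart k \o (g \o f) \o param i)
    ('d ((chart k \o g \o param j) \o (chart j \o f \o param i)) (chart i p)).
  apply: is_diff_near d12 _; apply: (open_near o); last by exists p.
  by move=> v /(chart_image _ _ _ cM) [_ jv _] /=; rewrite cN.2.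
exact: etrans (is_diff_val H) E.
Qed.

Lemma dif_rep_comp M N P (f : M -> N) (g : N -> P) i j k p v :
  charted M -> charted N -> smooth f -> smooth g ->
  dom i p -> dom j (f p) -> dom k (g (f p)) ->
  dif (chart k \o (g \o f) \o param i) (chart i p) v =
  dif (chart k \o g \o param j) (chart j (f p))
    (dif (chart j \o f \o param i) (chart i p) v).
Proof.
move=> cM cN sf sg ip jf kg.
exact: (congr1 (fun h => h v) (is_diff_rep_comp cM cN sf sg ip jf kg)).
Qed.

Lemma mder_comp M N P (f : M -> N) (g : N -> P) p v : charted M -> charted N ->
  charted P -> smooth f -> smooth g ->
  mder (g \o f) p v = mder g (f p) (mder f p v).
Proof.
move=> cM cN cP sf sg; rewrite /mder.
rewrite (is_diff_rep_comp (j := chartat (f p)) cM cN sf sg) //.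
- by apply cM.
- by apply cN.
- by apply cP.
Qed.

Lemma eq_mder M N (f g : M -> N) p v : f =1 g -> mder f p v = mder g p v.
Proof. by move=> /funext ->. Qed.

Lemma tmap_comp M N P (f : M -> N) (g : N -> P) (x : tanS M) : charted M ->
  charted N -> charted P -> smooth f -> smooth g ->
  tmap (g \o f) x = tmap g (tmap f x).
Proof. by move=> *; rewrite /tmap /= mder_comp. Qed.

Lemma smooth_id M : is_atlas M -> smooth (fun x : M => x).
Proof. by move=> [_ o C]; apply/smoothP => i j; split; [exact: o|exact: C]. Qed.

Lemma is_diff_rep_id M (i : idx M) p : is_atlas M -> dom i p ->
  'd (chart i \o param i) (chart i p) = id :> (_ -> _).
Proof.
move=> [cM o C] ip.
have [d e] := is_diff_id (chart i p).
have H : is_diff (chart i p) (chart i \o param i) ('d id (chart i p)).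
  apply: is_diff_near d _; apply: (open_near (o i i)); last by exists p.
  by move=> v /(chart_image _ _ _ cM) [_ _ /= ->].
exact: etrans (is_diff_val H) e.
Qed.

Lemma mder_id M p v : is_atlas M -> mder (fun x : M => x) p v = v.
Proof.
move=> aM; have cp := (atlas_charted aM).1 p.
exact: (congr1 (fun h => h v) (is_diff_rep_id aM cp)).
Qed.

Lemma tmap_id M (x : tanS M) : is_atlas M -> tmap (fun x : M => x) x = x.
Proof. by case: x => p v aM; rewrite /tmap /= mder_id. Qed.

Lemma mder_linear M N (f : M -> N) p : linear (mder f p).
Proof. exact: linearP. Qed.

Lemma diff_trans M (i j k : idx M) p : is_atlas M -> dom i p -> dom j p -> dom k p ->
  'd (chart k \o param i) (chart i p) =
  'd (chart k \o param j) (chart j p) \o 'd (chart j \o param i) (chart i p)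
  :> (_ -> 'rV[R]_(dim M)).
Proof.
move=> aM ip jp kp; have cM := atlas_charted aM.
exact: (@is_diff_rep_comp M M M id id i j k p cM cM (smooth_id aM) (smooth_id aM)).
Qed.

Lemma diff_transK M (i j : idx M) p v : is_atlas M -> dom i p -> dom j p ->
  'd (chart i \o param j) (chart j p) ('d (chart j \o param i) (chart i p) v) = v.
Proof.
move=> aM ip jp.
by have /(congr1 (@^~ v)) /= <- := diff_trans aM ip jp ip; rewrite is_diff_rep_id.
Qed.

Lemma dif_rep_dom M N (f : M -> N) (i i' : idx M) (j : idx N) p v :
  is_atlas M -> smooth f -> dom i p -> dom i' p -> dom j (f p) ->
  dif (chart j \o f \o param i) (chart i p) v =
  dif (chart j \o f \o param i') (chart i' p)
    (dif (chart i' \o param i) (chart i p) v).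
Proof.
move=> aM sf ip ip' jf; have cM := atlas_charted aM.
exact: (@dif_rep_comp M M N id f i i' j p v cM cM (smooth_id aM) sf ip ip' jf).
Qed.

Lemma dif_rep_cod M N (f : M -> N) (i : idx M) (j j' : idx N) p v :
  charted M -> is_atlas N -> smooth f -> dom i p -> dom j (f p) -> dom j' (f p) ->
  dif (chart j \o f \o param i) (chart i p) v =
  dif (chart j \o param j') (chart j' (f p))
    (dif (chart j' \o f \o param i) (chart i p) v).
Proof.
move=> cM aN sf ip jf jf'; have cN := atlas_charted aN.
exact: (@dif_rep_comp M N N f id i j' j p v cM cN sf (smooth_id aN) ip jf' jf).
Qed.

Lemma tanS_charted M : is_atlas M -> charted (tanS M).
Proof.
move=> aM; have [cM o C] := aM; split; first by move=> [p v]; apply cM.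
move=> i [p v] /= ip; rewrite !row_mxKl !row_mxKr !cM.2 //; congr pair.
by apply: diff_transK => //; apply cM.
Qed.

(** A tangent chart imposes no condition on the vector: every vector of coordinates occurs, since
    the change from the chart [i] to the preferred chart is inverted by [diff_transK]. *)
Lemma tanS_image M (i : idx M) (A : set M) w : is_atlas M ->
  (chart (s := tanS M) i @` [set x | dom i x.1 /\ A x.1]) w <->
  (chart i @` (dom i `&` A)) (lsubmx w).
Proof.
move=> aM; have cM := atlas_charted aM; split.
  by case=> -[p v] /= [ip Ap] <-; rewrite row_mxKl; exists p.
move=> /(chart_image _ _ _ cM) [a b e].
set p := param i (lsubmx w) in a b e *.
exists (p, 'd (chart (chartat p) \o param i) (lsubmx w) (rsubmx w)) => //=.
rewrite e -[RHS]hsubmxK; congr row_mx.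
pose d w' v := dif (chart i \o param (chartat p)) (chart (chartat p) p)
  (dif (chart (chartat p) \o param i) w' v).
change (d (lsubmx w) (rsubmx w) = rsubmx w); rewrite -e.
by apply: diff_transK => //; exact: cM.1.
Qed.

Lemma smooth_tmap M N (f : M -> N) : is_atlas M -> is_atlas N -> smooth f ->
  smooth (tmap f).
Proof.
move=> aM aN sf; have cM := atlas_charted aM; have cN := atlas_charted aN.
apply/smoothP; suff H (i : idx M) (j : idx N) :
  let D := chart (s := tanS M) i @` (dom (s := tanS M) i `&` tmap f @^-1`
    dom (s := tanS N) j) in
  open D /\ Cinfty D (chart (s := tanS N) j \o tmap f \o param (s := tanS M) i).
  exact: H.
move=> D; have [ o C] := (smoothP f).1 sf i j.
set D0 := _ @` _ in o C.
have -> : D = [set w | D0 (lsubmx w)].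
  apply/seteqP; split=> w; first exact: (tanS_image i (f @^-1` dom j) w aM).1.
  exact: (tanS_image i (f @^-1` dom j) w aM).2.
have oD := open_lsub_preimage (n := dim M) o; split=> //.
apply: (Cinfty_eq oD (f := fun w => row_mx
  ((chart j \o f \o param i) (lsubmx w))
  ('d (chart j \o f \o param i) (lsubmx w) (rsubmx w)))).
  move=> w /= /(chart_image _ _ _ cM) [ip jf e]; congr row_mx.
  set p := param i (lsubmx w) in ip jf e *.
  have cp := cM.1 p; have cf := cN.1 (f p).
  (* The right-hand side passes through the preferred charts at [p] and at [f p]; the two chart
     changes are absorbed by the chain rule, which leaves the differential of the expression of [f]
     in the fixed charts. *)
  change (dif (chart j \o f \o param i) (lsubmx w) (rsubmx w) =
    dif (chart j \o param (chartat (f p))) (chart (chartat (f p)) (f p))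
     (dif (chart (chartat (f p)) \o f \o param (chartat p)) (chart (chartat p) p)
      (dif (chart (chartat p) \o param i) (lsubmx w) (rsubmx w)))).
  rewrite -e; move: (rsubmx w) => v.
  by rewrite (dif_rep_dom v aM sf ip cp jf) (dif_rep_cod _ cM aN sf cp jf cf).
apply: Cinfty_row_mx => //; last exact: Cinfty_tangent.
apply: (Cinfty_comp oD _ _ C) => // k; exact: (Ck_lin _ _ (@lsubmx_linear R _ _)).
Qed.
End Atlases.

(** * Products *)

Section Products.
Context {R : realType}.
Implicit Types M N P : space R.

Lemma eucl_atlas n : is_atlas (eucl n : space R).
Proof.
split=> [||i j k]; first by [].
  move=> i j; rewrite (_ : _ @` _ = setT); first exact: openT.
  by apply/seteqP; split=> // x _; exists x.
by apply: Ck_lin => a u v.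
Qed.

Lemma prod_image M N (i : idx (prodS M N)) (A : set M) (B : set N) :
  chart i @` [set x : prodS M N | A x.1 /\ B x.2] =
  [set w | (chart i.1 @` A) (lsubmx w)] `&` [set w | (chart i.2 @` B) (rsubmx w)].
Proof.
apply/seteqP; split=> [w [x [Ax Bx] <-]|w [[p Ap ep] [q Bq eq]]].
  by rewrite /= row_mxKl row_mxKr; split; [exists x.1|exists x.2].
by exists (p, q) => //=; rewrite ep eq hsubmxK.
Qed.

Lemma open_prod_image M N (i : idx (prodS M N)) (A : set M) (B : set N) :
  open (chart i.1 @` A) -> open (chart i.2 @` B) ->
  open (chart i @` [set x : prodS M N | A x.1 /\ B x.2]).
Proof.
move=> oA oB; rewrite prod_image; apply: openI.
  exact: open_lsub_preimage.
exact: open_rsub_preimage.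
Qed.

Lemma Cinfty_lsub m n q (U : set 'rV[R]_(m + n)) (D : set 'rV[R]_m)
    (f : 'rV[R]_m -> 'rV[R]_q) : open U -> (forall w, U w -> D (lsubmx w)) ->
  Cinfty D f -> Cinfty U (fun w => f (lsubmx w)).
Proof.
move=> oU UD; apply: (Cinfty_comp oU UD) => k.
exact: (Ck_lin _ _ (@lsubmx_linear R m n)).
Qed.

Lemma Cinfty_rsub m n q (U : set 'rV[R]_(m + n)) (D : set 'rV[R]_n)
    (f : 'rV[R]_n -> 'rV[R]_q) : open U -> (forall w, U w -> D (rsubmx w)) ->
  Cinfty D f -> Cinfty U (fun w => f (rsubmx w)).
Proof.
move=> oU UD; apply: (Cinfty_comp oU UD) => k.
exact: (Ck_lin _ _ (@rsubmx_linear R m n)).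
Qed.

Lemma prodS_atlas M N : is_atlas M -> is_atlas N -> is_atlas (prodS M N).
Proof.
move=> [[cM1 cM2] oM CM] [[cN1 cN2] oN CN].
have E (i j : idx (prodS M N)) : dom i `&` dom j = [set x : prodS M N |
    (dom i.1 `&` dom j.1) x.1 /\ (dom i.2 `&` dom j.2) x.2].
  by apply/seteqP; split=> x /= [[? ?] [? ?]].
split.
- split; first by move=> p /=; split; [exact: cM1|exact: cN1].
  move=> i [p q] /= [ip jq]; rewrite row_mxKl row_mxKr.
  by rewrite (cM2 _ _ ip) (cN2 _ _ jq).
- by move=> i j; rewrite E; apply: open_prod_image; [exact: oM|exact: oN].
- move=> i j; set D := _ @` _.
  have oD : open D by rewrite /D E; apply: open_prod_image; [exact: oM|exact: oN].
  apply: (Cinfty_row_mx oD).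
    apply: (Cinfty_lsub oD _ (CM i.1 j.1)) => w.
    by rewrite /D E prod_image => -[].
  apply: (Cinfty_rsub oD _ (CN i.2 j.2)) => w.
  by rewrite /D E prod_image => -[].
Qed.

Lemma atlas_open M (i : idx M) : is_atlas M -> open (chart i @` dom i).
Proof. by move=> [_ o _]; have := o i i; rewrite setIid. Qed.

Lemma smooth_cst M N (q : N) : is_atlas M -> smooth (fun _ : M => q : N).
Proof.
move=> aM; apply/smoothP => i j; split; last by move=> k; exact: Ck_cst.
have [jq|jq] := pselect (dom j q).
  rewrite (_ : _ `&` _ = dom i); first exact: atlas_open.
  by apply/seteqP; split=> [p []|p ip]; last split.
rewrite (_ : _ `&` _ = set0); first by rewrite image_set0; exact: open0.
by apply/seteqP; split=> // p [].
Qed.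

Lemma smooth_pair M N P (f : M -> N) (g : M -> P) : charted M ->
  smooth f -> smooth g -> smooth (fun x => (f x, g x) : prodS N P).
Proof.
move=> cM /smoothP sf /smoothP sg; apply/smoothP => i j.
have [ o1 C1] := sf i j.1; have [ o2 C2] := sg i j.2.
set D1 := _ @` _ in o1 C1; set D2 := _ @` _ in o2 C2 => D.
have E : D = D1 `&` D2.
  apply/seteqP; split=> w.
    by case=> p [ip [f1 g2]] <-; split; exists p.
  move=> [/(chart_image _ _ _ cM) [a b c] /(chart_image _ _ _ cM) [_ b' _]].
  by apply/(chart_image _ _ _ cM).
have oD : open D by rewrite E; exact: openI.
split=> //; apply: (Cinfty_row_mx oD) => k.
  by apply: (Ck_sub _ (C1 k)); rewrite E => w [].
by apply: (Ck_sub _ (C2 k)); rewrite E => w [].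
Qed.

Lemma smooth_fst M N : is_atlas M -> is_atlas N ->
  smooth (fun x : prodS M N => x.1).
Proof.
move=> [cM oM CM] aN; apply/smoothP => i j D.
have E : D = chart i @` [set x : prodS M N | (dom i.1 `&` dom j) x.1 /\ dom i.2 x.2].
  by congr (_ @` _); apply/seteqP; split=> x /= [[? ?] ?].
have oD : open D by rewrite E; apply: open_prod_image; [exact: oM|exact: atlas_open].
split=> //; apply: (Cinfty_lsub oD _ (CM i.1 j)) => w.
by rewrite E prod_image => -[].
Qed.

Lemma smooth_snd M N : is_atlas M -> is_atlas N ->
  smooth (fun x : prodS M N => x.2).
Proof.
move=> aM [cN oN CN]; apply/smoothP => i j D.
have E : D = chart i @` [set x : prodS M N | dom i.1 x.1 /\ (dom i.2 `&` dom j) x.2].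
  by congr (_ @` _); apply/seteqP; split=> x /= => [[[? ?] ?]|[? [? ?]]].
have oD : open D by rewrite E; apply: open_prod_image; [exact: atlas_open|exact: oN].
split=> //; apply: (Cinfty_rsub oD _ (CN i.2 j)) => w.
by rewrite E prod_image => -[].
Qed.

Lemma mder_pair M N P (f : M -> N) (g : M -> P) p v : charted M -> charted N ->
  charted P -> smooth f -> smooth g ->
  mder (fun x => (f x, g x) : prodS N P) p v = row_mx (mder f p v) (mder g p v).
Proof.
move=> cM cN cP sf sg.
have d1 := smooth_diff cM sf (cM.1 p) (cN.1 (f p)).
have d2 := smooth_diff cM sg (cM.1 p) (cP.1 (g p)).
exact: (is_diffE v (is_diff_row_mx (differentiable_is_diff d1)
  (differentiable_is_diff d2))).
Qed.

Lemma mder_cst M N (q : N) p v : mder (fun _ : M => q : N) p v = 0.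
Proof.
exact: (is_diffE v (is_diff_cst (chart (chartat q) q) (chart (chartat p) p))).
Qed.

(** In preferred charts the projection is [lsubmx] followed by a chart after its own
    parametrisation, whose differential is the identity. *)
Lemma mder_fst M N p v : is_atlas M -> is_atlas N ->
  mder (fun x : prodS M N => x.1) p v = lsubmx v.
Proof.
move=> aM aN; have cM := atlas_charted aM.
have L := is_diff_linear (chart (chartat p) p) (@lsubmx_linear R (dim M) (dim N)).
have e : lsubmx (chart (chartat p) p) = chart (chartat p.1) p.1 by rewrite /= row_mxKl.
have d : differentiable (chart (chartat p.1) \o param (chartat p.1))
    (lsubmx (chart (chartat p) p)).
  by rewrite e; apply: (smooth_diff cM (smooth_id aM)); exact: cM.1.
apply: etrans (is_diffE v (is_diff_comp L (differentiable_is_diff d))) _.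
have E := is_diff_rep_id aM (cM.1 p.1); rewrite -e in E.
exact: (congr1 (fun h => h (lsubmx v)) E).
Qed.

Lemma mder_snd M N p v : is_atlas M -> is_atlas N ->
  mder (fun x : prodS M N => x.2) p v = rsubmx v.
Proof.
move=> aM aN; have cN := atlas_charted aN.
have L := is_diff_linear (chart (chartat p) p) (@rsubmx_linear R (dim M) (dim N)).
have e : rsubmx (chart (chartat p) p) = chart (chartat p.2) p.2 by rewrite /= row_mxKr.
have d : differentiable (chart (chartat p.2) \o param (chartat p.2))
    (rsubmx (chart (chartat p) p)).
  by rewrite e; apply: (smooth_diff cN (smooth_id aN)); exact: cN.1.
apply: etrans (is_diffE v (is_diff_comp L (differentiable_is_diff d))) _.
have E := is_diff_rep_id aN (cN.1 p.2); rewrite -e in E.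
exact: (congr1 (fun h => h (rsubmx v)) E).
Qed.

Lemma smooth_add M n (f g : M -> eucl n) : smooth f -> smooth g ->
  smooth (fun x => (f x : 'rV[R]_n) + g x : eucl n).
Proof.
move=> /smoothP sf /smoothP sg; apply/smoothP => i j.
have [ o1 C1] := sf i j; have [_ C2] := sg i j; split; first exact: o1.
by move=> k; exact: Ck_add o1 (C1 k) (C2 k).
Qed.

Lemma smooth_lin M m n (f : M -> eucl m) (L : 'rV[R]_m -> 'rV[R]_n) :
  linear L -> smooth f -> smooth (fun x => L (f x) : eucl n).
Proof.
move=> lL /smoothP sf; apply/smoothP => i j.
have [ o1 C1] := sf i j; split; first exact: o1.
by move=> k; exact: Ck_linl o1 lL (C1 k).
Qed.

Lemma smooth_row_mx M m n (f : M -> eucl m) (g : M -> eucl n) :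
  smooth f -> smooth g -> smooth (fun x => row_mx (f x : 'rV[R]_m) (g x) : eucl (m + n)).
Proof.
move=> /smoothP sf /smoothP sg; apply/smoothP => i j.
have [ o1 C1] := sf i j; have [_ C2] := sg i j; split; first exact: o1.
exact: Cinfty_row_mx o1 C1 C2.
Qed.

(* The map takes (p, B) to the vector (0_p, B) tangent at (p, q). *)
Lemma smooth_vertical M N (q : N) : is_atlas M -> is_atlas N ->
  smooth (fun y : prodS M (eucl (dim N)) =>
    ((y.1, q), row_mx (0 : 'rV[R]_(dim M)) y.2) : tanS (prodS M N)).
Proof.
move=> aM aN; have cM := atlas_charted aM; have cN := atlas_charted aN.
have cP := atlas_charted (prodS_atlas aM aN).
apply/smoothP; suff H (i : idx (prodS M (eucl (dim N)))) (j : idx (prodS M N)) :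
  let f := fun y : prodS M (eucl (dim N)) =>
    ((y.1, q), row_mx (0 : 'rV[R]_(dim M)) y.2) : tanS (prodS M N) in
  let D := chart i @` (dom i `&` f @^-1` dom (s := tanS (prodS M N)) j) in
  open D /\ Cinfty D (chart (s := tanS (prodS M N)) j \o f \o param i).
  exact: H.
move=> f D; have [_ oM CM] := aM.
have [jq|jq] := pselect (dom j.2 q); last first.
  have -> : D = set0.
    by rewrite /D (_ : _ `&` _ = set0) ?image_set0 //; apply/seteqP; split=> // y [_ []].
  by split=> [|k]; [exact: open0|apply: Ck_local => x []].
have E : D = chart i @`
    [set x : prodS M (eucl (dim N)) | (dom i.1 `&` dom j.1) x.1 /\ setT x.2].
  congr (_ @` _); apply/seteqP; split=> x.
    by move=> [[? ?] [? ?]].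
  by move=> [[? ?] ?].
have oD : open D.
  rewrite E; apply: open_prod_image; first exact: oM.
  exact: (atlas_open (eucl_atlas _)).
split=> //.
pose d := dif (chart j.2 \o param (chartat q)) (chart (chartat q) q).
have C1 : Cinfty D (fun w => chart j.1 (param i.1 (lsubmx w))).
  apply: (Cinfty_lsub oD _ (CM i.1 j.1)) => w.
  by rewrite E prod_image => -[].
have C2 : Cinfty D (fun w : 'rV[R]_(dim M + dim N) => d (rsubmx w)).
  apply: (Cinfty_rsub oD (D := setT)) => // k; apply: Ck_lin; exact: linearP.
have C3 : Cinfty D (fun w : 'rV[R]_(dim M + dim N) => row_mx
    (row_mx (chart j.1 (param i.1 (lsubmx w))) (chart j.2 q))
    (row_mx (0 : 'rV[R]_(dim M)) (d (rsubmx w)))).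
  apply: (Cinfty_row_mx oD); apply: (Cinfty_row_mx oD) => // k; exact: Ck_cst.
apply: (Cinfty_eq oD _ C3) => w Dw /=; congr row_mx.
set p := param i.1 (lsubmx w); set B := rsubmx w.
have jp : dom j.1 p.
  have := Dw; rewrite E prod_image => -[/(chart_image _ _ _ cM) [_ ]].
  by [].
have dM := smooth_diff cM (smooth_id aM) (cM.1 p) jp.
have dN := smooth_diff cN (smooth_id aN) (cN.1 q) jq.
(* A transition between product charts acts on each block separately, so its differential is block
   diagonal and preserves the zero first block. *)
pose x0 : 'rV[R]_(dim M + dim N) := row_mx (chart (chartat p) p) (chart (chartat q) q).
have L1 := is_diff_linear x0 (@lsubmx_linear R (dim M) (dim N)).
have L2 := is_diff_linear x0 (@rsubmx_linear R (dim M) (dim N)).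
rewrite -(row_mxKl (chart (chartat p) p) (chart (chartat q) q)) in dM.
rewrite -(row_mxKr (chart (chartat p) p) (chart (chartat q) q)) in dN.
have H := is_diff_row_mx (is_diff_comp L1 (differentiable_is_diff dM))
  (is_diff_comp L2 (differentiable_is_diff dN)).
apply/esym; apply: etrans (is_diffE (row_mx 0 B) H) _.
change (row_mx (dif (chart j.1 \o param (chartat p)) (lsubmx x0) (lsubmx (row_mx 0 B)))
  (dif (chart j.2 \o param (chartat q)) (rsubmx x0) (rsubmx (row_mx (0 : 'rV[R]_(dim M)) B))) =
  row_mx 0 (d B)).
by rewrite /x0 !row_mxKl !row_mxKr /dif linear0.
Qed.

End Products.

(** * Lie crossed modules *)

Section Groups.
Context {R : realType} (K : group_data R).
Hypothesis gK : is_group (@gmul R K) (gone K) (@ginv R K).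

Lemma gmulA : associative (@gmul R K). Proof. by case: gK. Qed.
Lemma gmul1g : left_id (gone K) (@gmul R K). Proof. by case: gK. Qed.
Lemma gmulg1 : right_id (gone K) (@gmul R K). Proof. by case: gK. Qed.
Lemma gmulVg : left_inverse (gone K) (@ginv R K) (@gmul R K).
Proof. by case: gK. Qed.
Lemma gmulgV : right_inverse (gone K) (@ginv R K) (@gmul R K).
Proof. by case: gK. Qed.
Lemma gmulKV (x y : K) : gmul (ginv x) (gmul x y) = y.
Proof. by rewrite gmulA gmulVg gmul1g. Qed.
Lemma gmulKg (x y : K) : gmul (gmul y x) (ginv x) = y.
Proof. by rewrite -gmulA gmulgV gmulg1. Qed.
Lemma gmulgK (x y : K) : gmul (gmul y (ginv x)) x = y.
Proof. by rewrite -gmulA gmulVg gmulg1. Qed.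
Lemma ginv_uniq (x y : K) : gmul x y = gone K -> y = ginv x.
Proof. by move=> e; rewrite -(gmulKV x y) e gmulg1. Qed.
Lemma ginvK : involutive (@ginv R K).
Proof. by move=> x; apply/esym/ginv_uniq; exact: gmulVg. Qed.
Lemma ginv1 : ginv (gone K) = gone K.
Proof. by apply/esym/ginv_uniq; exact: gmul1g. Qed.
Lemma ginvM (x y : K) : ginv (gmul x y) = gmul (ginv y) (ginv x).
Proof. by apply/esym/ginv_uniq; rewrite gmulA gmulKg gmulgV. Qed.
(** Serves to derive from multiplicativity that [xtau] and each [xalpha g] preserve the identity. *)
Lemma gidem (x : K) : gmul x x = x -> x = gone K.
Proof. by move=> e; rewrite -(gmulKV x x) e gmulVg. Qed.
End Groups.

Section CrossedModules.
Context {R : realType} (X : xmod R).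
Hypothesis hX : is_lie_crossed_module X.
Let G := xG X.
Let H := xH X.
Let S := semi X.

Lemma xG_lie : is_lie_group (xG X). Proof. by case: hX => -[]. Qed.
Lemma xH_lie : is_lie_group (xH X). Proof. by case: hX => -[]. Qed.
Lemma xG_group : is_group (@gmul R (xG X)) (gone _) (@ginv R (xG X)).
Proof. by case: xG_lie. Qed.
Lemma xH_group : is_group (@gmul R (xH X)) (gone _) (@ginv R (xH X)).
Proof. by case: xH_lie. Qed.
Lemma xG_atlas : is_atlas (xG X). Proof. by case: xG_lie => /manifold_atlas. Qed.
Lemma xH_atlas : is_atlas (xH X). Proof. by case: xH_lie => /manifold_atlas. Qed.
Lemma semi_atlas : is_atlas (semi X).
Proof. exact: prodS_atlas xH_atlas xG_atlas. Qed.

Let aG := xG_group.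
Let aH := xH_group.
Let atG := xG_atlas.
Let atH := xH_atlas.
Let atS := semi_atlas.
Let cG := atlas_charted atG.
Let cH := atlas_charted atH.
Let cS := atlas_charted atS.
Let atHH := prodS_atlas atH atH.
Let cHH := atlas_charted atHH.

Lemma smooth_tau : smooth (@xtau R X). Proof. by case: hX => _ _ []. Qed.
Lemma tauM h h' : xtau (gmul h h') = gmul (xtau h) (xtau h') :> xG X.
Proof. by case: hX => _ _ []. Qed.
Lemma tau1 : xtau (gone (xH X)) = gone (xG X).
Proof. by apply: (gidem aG); rewrite -tauM (gmul1g aH). Qed.
Lemma tauV h : xtau (ginv h) = ginv (xtau h) :> xG X.
Proof. by apply: (ginv_uniq aG); rewrite -tauM (gmulgV aH) tau1. Qed.
Lemma tau_alpha g h : xtau (xalpha g h) = gmul (gmul g (xtau h)) (ginv g) :> xG X.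
Proof. by case: hX. Qed.
Lemma alpha_tau h h' : xalpha (xtau h) h' = gmul (gmul h h') (ginv h) :> xH X.
Proof. by case: hX. Qed.
Lemma alphaMg g g' h : xalpha (gmul g g') h = xalpha g (xalpha g' h) :> xH X.
Proof. by case: hX => _ []. Qed.
Lemma alphaM g h h' : xalpha g (gmul h h') = gmul (xalpha g h) (xalpha g h') :> xH X.
Proof. by case: hX => _ []. Qed.
Lemma alpha1 g : xalpha g (gone _) = gone (xH X).
Proof. by apply: (gidem aH); rewrite -alphaM (gmul1g aH). Qed.
Lemma alphaV g h : xalpha g (ginv h) = ginv (xalpha g h) :> xH X.
Proof. by apply: (ginv_uniq aH); rewrite -alphaM (gmulgV aH) alpha1. Qed.
Lemma smooth_alpha2 : smooth (fun x : prodS (xG X) (xH X) => xalpha x.1 x.2).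
Proof. by case: hX => _ []. Qed.

Lemma smooth_mulr (K : group_data R) (M : space R) (f g : M -> K) :
  is_lie_group K -> charted M -> smooth f -> smooth g ->
  smooth (fun x => gmul (f x) (g x)).
Proof.
move=> lK cM sf sg; have aK : is_atlas K by case: lK => /manifold_atlas.
apply: (smooth_comp (f := fun x => (f x, g x) : prodS K K)
   (g := fun y : prodS K K => gmul y.1 y.2)) => //.
- exact: atlas_charted (prodS_atlas aK aK).
- exact: (smooth_pair cM).
- by case: lK.
Qed.

Lemma smooth_ginv (K : group_data R) (M : space R) (f : M -> K) :
  is_lie_group K -> charted M -> smooth f -> smooth (fun x => ginv (f x)).
Proof.
move=> lK cM sf; have aK : is_atlas K by case: lK => /manifold_atlas.
apply: (smooth_comp cM (atlas_charted aK) sf (g := @ginv R K)); by case: lK.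
Qed.

Lemma smooth_xalpha (M : space R) (f : M -> xG X) (g : M -> xH X) :
  charted M -> smooth f -> smooth g -> smooth (fun x => xalpha (f x) (g x)).
Proof.
move=> cM sf sg.
apply: (smooth_comp (f := fun x => (f x, g x) : prodS G H)
   (g := fun y : prodS G H => xalpha y.1 y.2)) => //.
- exact: atlas_charted (prodS_atlas atG atH).
- exact: (smooth_pair cM).
- exact: smooth_alpha2.
Qed.

Lemma smooth_conj (K : group_data R) (k : K) : is_lie_group K ->
  smooth (fun x : K => gmul (gmul k x) (ginv k)).
Proof.
move=> lK; have aK : is_atlas K by case: lK => /manifold_atlas.
have cK := atlas_charted aK.
apply: smooth_mulr => //; last exact: smooth_cst.
by apply: smooth_mulr => //; [exact: smooth_cst|exact: smooth_id].
Qed.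

Lemma smooth_alpha g : smooth (xalpha g : xH X -> xH X).
Proof. by apply: smooth_xalpha => //; [exact: smooth_cst|exact: smooth_id]. Qed.

(** [smooth_conj] is stated for Lie groups, and [semi X] has only been given an atlas; the two
    components of the conjugation are therefore treated as words in the operations of [H] and
    [G]. *)
Lemma smooth_conj_semi (k : semi X) :
  smooth (fun x : semi X => gmul (gmul k x) (ginv k)).
Proof.
have s1 : smooth (fun x : S => x.1) by exact: smooth_fst.
have s2 : smooth (fun x : S => x.2) by exact: smooth_snd.
have sc (N : space R) (q : N) : smooth (fun _ : S => q) by exact: smooth_cst.
apply: (smooth_pair (N := H) (P := G)) => //=.
  apply: (smooth_mulr xH_lie cS).
    by apply: (smooth_mulr xH_lie cS) => //; apply: smooth_xalpha.
  by apply: smooth_xalpha => //; apply: (smooth_mulr xG_lie cS).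
by apply: (smooth_mulr xG_lie cS) => //; apply: (smooth_mulr xG_lie cS).
Qed.

Lemma ginv_one1 g : ginv (one1 g) = one1 (ginv g) :> semi X.
Proof. by rewrite /one1 /= (ginv1 aH) alpha1. Qed.

(* The differential of phi sends (lambda(t_* v), lambda(s_* v)) to the value  *)
(* on v of the arrow part of [olam lambda].                                  *)
Let phi (x : prodS H H) : S := (gmul x.1 (ginv x.2), xtau x.2).

(** For k = (h, g), the factor coming from the inverse of k is alpha at g tau(c) g^-1 =
    tau(alpha_g(c)), applied to h^-1. By the Peiffer identity this is the conjugate of h^-1 by
    alpha_g(c), which cancels the neighbouring alpha_g(c)^-1; what remains contains h alpha_g(a)
    h^-1, which is alpha of tau(h) g on a. *)
Let conj_phi (k : S) (a c : H) :
  gmul (gmul k (phi (a, c))) (ginv k) =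
  phi (xalpha (gmul (xtau k.1) k.2) a, xalpha k.2 c).
Proof.
case: k => h g; rewrite /phi /=; congr pair; last by rewrite tau_alpha.
rewrite -[xalpha (gmul g _) _]alphaMg -tau_alpha alpha_tau alphaMg alpha_tau.
by rewrite alphaM alphaV !(gmulA aH) (gmulgK aH).
Qed.

Let smooth_phi : smooth phi.
Proof.
have s1 : smooth (fun x : prodS H H => x.1) by exact: smooth_fst.
have s2 : smooth (fun x : prodS H H => x.2) by exact: smooth_snd.
apply: (smooth_pair (N := H) (P := G)) => //.
  apply: (smooth_mulr xH_lie cHH) => //; exact: (smooth_ginv xH_lie cHH).
exact: (smooth_comp cHH cH s2 smooth_tau).
Qed.

(** The differential of inversion is not computed. The map (x, y) |-> x y^-1 is the identity on the
    first factor and constant on the diagonal, and (A, C) = (A - C, 0) + (C, C). *)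
Let mder_div (w : 'rV[R]_(dim H + dim H)) :
  mder (fun x : prodS H H => gmul x.1 (ginv x.2)) (gone H, gone H) w =
  lsubmx w - rsubmx w.
Proof.
set m := (X in mder X _ _); set e : prodS H H := (gone H, gone H).
have s1 : smooth (fun x : prodS H H => x.1) by exact: smooth_fst.
have s2 : smooth (fun x : prodS H H => x.2) by exact: smooth_snd.
have sm : smooth m.
  by apply: (smooth_mulr xH_lie cHH) => //; exact: (smooth_ginv xH_lie cHH).
have sid := smooth_id atH.
have scst : smooth (fun _ : H => gone H) by exact: smooth_cst.
have L A : mder m e (row_mx A 0) = A.
  have sp : smooth (fun x : H => (x, gone H) : prodS H H) by exact: smooth_pair.
  have <- : mder (fun x : H => (x, gone H) : prodS H H) (gone H) A = row_mx A 0.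
    by rewrite mder_pair // mder_id // mder_cst.
  apply: etrans (esym (mder_comp (gone H) A cH cHH cH sp sm)) _.
  apply: etrans (eq_mder _ _ _) (mder_id (gone H) A atH).
  by move=> x; rewrite /m /= (ginv1 aH) (gmulg1 aH).
have D A : mder m e (row_mx A A) = 0.
  have sp : smooth (fun x : H => (x, x) : prodS H H) by exact: smooth_pair.
  have <- : mder (fun x : H => (x, x) : prodS H H) (gone H) A = row_mx A A.
    by rewrite mder_pair // mder_id.
  apply: etrans (esym (mder_comp (gone H) A cH cHH cH sp sm)) _.
  apply: etrans (eq_mder _ _ _) (mder_cst (gone H) (gone H) A).
  by move=> x; rewrite /m /= (gmulgV aH).
have -> : w = row_mx (lsubmx w - rsubmx w) 0 + row_mx (rsubmx w) (rsubmx w).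
  by rewrite add_row_mx add0r subrK hsubmxK.
have := mder_linear m e 1 (row_mx (lsubmx w - rsubmx w) 0) (row_mx (rsubmx w) (rsubmx w)).
rewrite !scale1r => ->; rewrite L D addr0.
by rewrite add_row_mx add0r subrK row_mxKl row_mxKr.
Qed.

Let mder_phi w : mder phi (gone H, gone H) w =
  Lpair (lsubmx w - rsubmx w) (dtau (rsubmx w : Lie H)).
Proof.
have s1 : smooth (fun x : prodS H H => x.1) by exact: smooth_fst.
have s2 : smooth (fun x : prodS H H => x.2) by exact: smooth_snd.
rewrite (mder_pair (N := H) (P := G)) //.
- congr row_mx; first exact: mder_div.
    apply: etrans (mder_comp ((gone H, gone H) : prodS H H) w cHH cH cG s2 smooth_tau) _.
  by rewrite mder_snd.
- apply: (smooth_mulr xH_lie cHH) => //; exact: (smooth_ginv xH_lie cHH).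
exact: (smooth_comp cHH cH s2 smooth_tau).
Qed.

(** The argument of [Ad k] is the differential of [phi] at the identity on (A, C). The formula is
    thus [conj_phi] differentiated there, where [phi] and [psi] preserve the identities. *)
Lemma Ad_olam (k : semi X) (A C : Lie (xH X)) :
  Ad k (Lpair ((A : 'rV[R]_(dim (xH X))) - C) (dtau C)) =
  Lpair ((dalpha (gmul (xtau k.1) k.2) A : 'rV[R]_(dim (xH X))) - dalpha k.2 C)
    (dtau (dalpha k.2 C)).
Proof.
set t := gmul _ _; set e : prodS H H := (gone H, gone H).
have s1 : smooth (fun x : prodS H H => x.1) by exact: smooth_fst.
have s2 : smooth (fun x : prodS H H => x.2) by exact: smooth_snd.
pose psi (x : prodS H H) : prodS H H := (xalpha t x.1, xalpha k.2 x.2).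
have spsi1 : smooth (fun x : prodS H H => xalpha t x.1).
  exact: (smooth_comp cHH cH s1 (smooth_alpha t)).
have spsi2 : smooth (fun x : prodS H H => xalpha k.2 x.2).
  exact: (smooth_comp cHH cH s2 (smooth_alpha k.2)).
have spsi : smooth psi by exact: smooth_pair.
have Epsi : mder psi e (row_mx A C) = row_mx (dalpha t A) (dalpha k.2 C).
  rewrite (mder_pair (N := H) (P := H)) //; congr row_mx.
    apply: etrans (mder_comp e _ cHH cH cH s1 (smooth_alpha t)) _.
    by rewrite mder_fst // row_mxKl.
  apply: etrans (mder_comp e _ cHH cH cH s2 (smooth_alpha k.2)) _.
  by rewrite mder_snd // row_mxKr.
have pe : psi e = e by rewrite /psi /e /= !alpha1.
have fe : phi e = gone S by rewrite /phi /= (ginv1 aH) (gmul1g aH) tau1.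
have := mder_phi (row_mx A C); rewrite row_mxKl row_mxKr => <-.
have := mder_phi (row_mx (dalpha t A) (dalpha k.2 C)); rewrite row_mxKl row_mxKr => <-.
rewrite -Epsi -[X in _ = mder phi X _]pe /Ad -fe.
have sk := smooth_conj_semi k.
apply: etrans (esym (mder_comp e _ cHH cS cS smooth_phi sk)) _.
apply: etrans _ (mder_comp e _ cHH cHH cS spsi smooth_phi).
by apply: eq_mder => -[a c]; exact: conj_phi.
Qed.

(** Conjugation by the unit arrow (1, g) does not mix the factors: it is alpha_g on [H] and
    conjugation by g on [G]. *)
Lemma Ad_one1 g A B : Ad (one1 g : semi X) (Lpair A B) = Lpair (dalpha g A) (Ad g B).
Proof.
have s1 : smooth (fun x : S => x.1) by exact: smooth_fst.
have s2 : smooth (fun x : S => x.2) by exact: smooth_snd.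
have sa := smooth_alpha g; have sc := smooth_conj g xG_lie.
have -> : Ad (one1 g : semi X) (Lpair A B) =
    mder (fun x : S => (xalpha g x.1, gmul (gmul g x.2) (ginv g)) : S) (gone S) (Lpair A B).
  apply: eq_mder => -[h x] /=.
  by rewrite (ginv1 aH) !alpha1 (gmulg1 aH) (gmul1g aH) //.
rewrite (mder_pair (N := H) (P := G)) //.
- congr row_mx.
    apply: etrans (mder_comp (gone S) _ cS cH cH s1 sa) _.
    by rewrite (mder_fst (M := H) (N := G)) // row_mxKl.
  apply: etrans (mder_comp (gone S) _ cS cG cG s2 sc) _.
  by rewrite (mder_snd (M := H) (N := G)) // row_mxKr.
- exact: (smooth_comp cS cH s1 sa).
- exact: (smooth_comp cS cG s2 sc).
Qed.

Lemma dtau_dalpha g A : dtau (dalpha g A) = Ad g (dtau A) :> Lie (xG X).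
Proof.
have sa := smooth_alpha g; have sc := smooth_conj g xG_lie; have st := smooth_tau.
have E1 := mder_comp (gone H) A cH cH cG sa st; rewrite (alpha1 g) in E1.
have E2 := mder_comp (gone H) A cH cG cG st sc; rewrite tau1 in E2.
apply: etrans (esym E1) (etrans _ E2).
by apply: eq_mder => h /=; rewrite tau_alpha.
Qed.

Lemma dtau_linear : linear (fun A : 'rV[R]_(dim (xH X)) =>
  dtau (A : Lie (xH X)) : 'rV[R]_(dim (xG X))).
Proof. exact: mder_linear. Qed.

Lemma dalpha_linear g : linear (fun A : 'rV[R]_(dim (xH X)) =>
  dalpha g (A : Lie (xH X)) : 'rV[R]_(dim (xH X))).
Proof. exact: mder_linear. Qed.

Lemma Ad_linear (K : group_data R) (k : K) :
  linear (fun A : 'rV[R]_(dim K) => Ad k (A : Lie K) : 'rV[R]_(dim K)).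
Proof. exact: mder_linear. Qed.

Lemma tgt_ginv (k : semi X) :
  gmul (xtau (ginv k).1) (ginv k).2 = ginv (gmul (xtau k.1) k.2) :> xG X.
Proof.
by rewrite /= tau_alpha tauV (gmulgK aG) (ginvM aG).
Qed.
End CrossedModules.

(** * Lie groupoids and their tangent groupoids *)

Section TangentMaps.
Context {R : realType}.
Implicit Types M N P Q : space R.

Lemma eq_tmap M N (f g : M -> N) x : f =1 g -> tmap f x = tmap g x.
Proof. by move=> /funext ->. Qed.

Lemma tmap_comm M N P Q (f : M -> N) (g : N -> Q) (f' : M -> P) (g' : P -> Q) x :
  charted M -> charted N -> charted P -> charted Q ->
  smooth f -> smooth g -> smooth f' -> smooth g' -> g \o f =1 g' \o f' ->
  tmap g (tmap f x) = tmap g' (tmap f' x).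
Proof.
move=> cM cN cP cQ sf sg sf' sg' e.
have E := tmap_comp x cM cN cQ sf sg; rewrite (eq_tmap x e) in E.
have E' := tmap_comp x cM cP cQ sf' sg'; rewrite E' in E; exact (esym E).
Qed.

Lemma tmap_comp1 M N P (f : M -> N) (g : N -> P) (h : M -> P) x :
  charted M -> charted N -> charted P -> smooth f -> smooth g ->
  g \o f =1 h -> tmap g (tmap f x) = tmap h x.
Proof.
move=> cM cN cP sf sg e.
have E := tmap_comp x cM cN cP sf sg; rewrite (eq_tmap x e) in E.
exact (esym E).
Qed.
End TangentMaps.

Section Groupoids.
Context {R : realType} (X : sgrpd R).
Hypothesis hX : is_lie_groupoid X.

Lemma ob_manifold : is_manifold (ob X). Proof. by case: hX => -[]. Qed.
Lemma ar_manifold : is_manifold (ar X). Proof. by case: hX => -[]. Qed.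
Lemma cp_manifold : is_manifold (cp X). Proof. by case: hX => -[]. Qed.
Lemma ob_atlas : is_atlas (ob X). Proof. exact: manifold_atlas ob_manifold. Qed.
Lemma ar_atlas : is_atlas (ar X). Proof. exact: manifold_atlas ar_manifold. Qed.
Lemma cp_atlas : is_atlas (cp X). Proof. exact: manifold_atlas cp_manifold. Qed.
Lemma ob_charted : charted (ob X). Proof. exact: atlas_charted ob_atlas. Qed.
Lemma ar_charted : charted (ar X). Proof. exact: atlas_charted ar_atlas. Qed.
Lemma cp_charted : charted (cp X). Proof. exact: atlas_charted cp_atlas. Qed.
Lemma smooth_src : smooth (@src R X). Proof. by case: hX => _ [[]]. Qed.
Lemma smooth_tgt : smooth (@tgt R X). Proof. by case: hX => _ [_ []]. Qed.
Lemma smooth_unit1 : smooth (@unit1 R X). Proof. by case: hX => _ _ _ []. Qed.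
Lemma smooth_inv1 : smooth (@inv1 R X). Proof. by case: hX => _ _ _ []. Qed.
Lemma smooth_mul : smooth (@mul R X). Proof. by case: hX => _ _ _ []. Qed.
Lemma smooth_pr2 : smooth (@pr2 R X). Proof. by case: hX => _ _ [[]]. Qed.
Lemma smooth_pr1 : smooth (@pr1 R X). Proof. by case: hX => _ _ [[]]. Qed.

Lemma cp_pair (g f : ar X) : tgt f = src g -> exists z : cp X, pr2 z = g /\ pr1 z = f.
Proof.
by move=> e; case: hX => _ _ [_ _ /(_ _ _ e) [z [h _]] _] _ _; exists z.
Qed.

Lemma cp_composable (z : cp X) : tgt (pr1 z) = src (pr2 z).
Proof. by case: hX => _ _ []. Qed.

Lemma composite_composable (g f h : ar X) : composite g f h -> tgt f = src g.
Proof. by case=> z [<- <- _]; exact: cp_composable. Qed.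

Lemma composite_uniq (g f h h' : ar X) : composite g f h -> composite g f h' -> h = h'.
Proof.
move=> c; have e := composite_composable c.
case: c => z [z2 z1 <-] [z' [z2' z1' <-]].
case: hX => _ _ [_ _ /(_ _ _ e) [w [_ u]] _] _ _.
by rewrite -(u z) // -(u z').
Qed.

(* The composite of [g] and [f], with junk value [f] when they do not compose. *)
Definition gc (g f : ar X) : ar X :=
  match pselect (exists h, composite g f h) with
  | left e => projT1 (cid e)
  | right _ => f
  end.

Lemma gcP g f : tgt f = src g -> composite g f (gc g f).
Proof.
move=> e; rewrite /gc; case: pselect => [c|[]]; first exact: (projT2 (cid c)).
by have [z [z2 z1]] := cp_pair e; exists (mul z); exists z.
Qed.

Lemma gcE g f h : composite g f h -> gc g f = h.
Proof. by move=> c; apply: composite_uniq (gcP (composite_composable c)) c. Qed.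

Lemma src_unit x : src (unit1 x) = x :> ob X.
Proof. by case: hX => _ _ _ _ [H _ _ _ _]; case: (H x). Qed.
Lemma tgt_unit x : tgt (unit1 x) = x :> ob X.
Proof. by case: hX => _ _ _ _ [H _ _ _ _]; case: (H x). Qed.
Lemma src_inv (f : ar X) : src (inv1 f) = tgt f.
Proof. by case: hX => _ _ _ _ [_ _ _ _ H]; case: (H f). Qed.
Lemma tgt_inv (f : ar X) : tgt (inv1 f) = src f.
Proof. by case: hX => _ _ _ _ [_ _ _ _ H]; case: (H f). Qed.
Lemma src_gc (g f : ar X) : tgt f = src g -> src (gc g f) = src f.
Proof. by move=> /gcP c; case: hX => _ _ _ _ [_ H _ _ _]; case: (H _ _ _ c). Qed.
Lemma tgt_gc (g f : ar X) : tgt f = src g -> tgt (gc g f) = tgt g.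
Proof. by move=> /gcP c; case: hX => _ _ _ _ [_ H _ _ _]; case: (H _ _ _ c). Qed.
Lemma gc1 (f : ar X) : gc f (unit1 (src f)) = f.
Proof. by apply: gcE; case: hX => _ _ _ _ [_ _ H _ _]; case: (H f). Qed.
Lemma gc1l (f : ar X) : gc (unit1 (tgt f)) f = f.
Proof. by apply: gcE; case: hX => _ _ _ _ [_ _ H _ _]; case: (H f). Qed.
Lemma gcVf (f : ar X) : gc (inv1 f) f = unit1 (src f).
Proof. by apply: gcE; case: hX => _ _ _ _ [_ _ _ _ H]; case: (H f). Qed.
Lemma gcfV (f : ar X) : gc f (inv1 f) = unit1 (tgt f).
Proof. by apply: gcE; case: hX => _ _ _ _ [_ _ _ _ H]; case: (H f). Qed.
Lemma gcA (h g f : ar X) : tgt f = src g -> tgt g = src h ->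
  gc h (gc g f) = gc (gc h g) f.
Proof.
move=> e1 e2; apply/esym/gcE.
have c1 := gcP e1; have c2 := gcP e2.
have e3 : tgt (gc g f) = src h by rewrite tgt_gc.
by case: hX => _ _ _ _ [_ _ _ H _]; apply: (H _ _ _ _ _ _ c1 c2 (gcP e3)).
Qed.
Lemma gcK (g f : ar X) : tgt f = src g -> gc (inv1 g) (gc g f) = f.
Proof. by move=> e; rewrite gcA ?tgt_inv ?src_inv // gcVf -e gc1l. Qed.

Lemma gc_lift (Z : space R) (a b : Z -> ar X) : is_manifold Z ->
  smooth a -> smooth b -> (forall z, tgt (b z) = src (a z)) ->
  exists c : Z -> cp X, [/\ smooth c, @pr2 R X \o c =1 a, @pr1 R X \o c =1 b &
    @mul R X \o c =1 fun z => gc (a z) (b z)].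
Proof.
(* The pairs are picked pointwise; the resulting map is smooth because its two projections are [a]
   and [b]. *)
move=> mZ sa sb e; have [c cP] := choice (fun z => cp_pair (e z)).
have E2 : @pr2 R X \o c = a by apply/funext => z; case: (cP z).
have E1 : @pr1 R X \o c = b by apply/funext => z; case: (cP z).
exists c; split=> [||| z].
- by case: hX => _ _ [_ _ _ H] _ _; apply: H => //; [rewrite E2|rewrite E1].
- by rewrite E2.
- by rewrite E1.
- by apply/esym/gcE; exists (c z); case: (cP z).
Qed.

Lemma smooth_gc (Z : space R) (a b : Z -> ar X) : is_manifold Z ->
  smooth a -> smooth b -> (forall z, tgt (b z) = src (a z)) ->
  smooth (fun z => gc (a z) (b z)).
Proof.
move=> mZ sa sb e; have [c [sc _ _ /funext <-]] := gc_lift mZ sa sb e.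
apply: smooth_comp sc smooth_mul; last exact: cp_charted.
exact: atlas_charted (manifold_atlas mZ).
Qed.

Lemma tangent_gc (Z : space R) (a b : Z -> ar X) x : is_manifold Z ->
  smooth a -> smooth b -> (forall z, tgt (b z) = src (a z)) ->
  composite (X := tanG X) (tmap a x) (tmap b x) (tmap (fun z => gc (a z) (b z)) x).
Proof.
move=> mZ sa sb e; have [c [sc e2 e1 em]] := gc_lift mZ sa sb e.
have cZ := atlas_charted (manifold_atlas mZ).
exists (tmap c x); split.
- exact: (tmap_comp1 x cZ cp_charted ar_charted sc smooth_pr2 e2).
- exact: (tmap_comp1 x cZ cp_charted ar_charted sc smooth_pr1 e1).
- exact: (tmap_comp1 x cZ cp_charted ar_charted sc smooth_mul em).
Qed.
End Groupoids.

Section Functors.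
Context {R : realType} (X Y : sgrpd R).
Hypotheses (hX : is_lie_groupoid X) (hY : is_lie_groupoid Y).

Lemma functor_gc (F : grpd_map X Y) (g f : ar X) : is_functor F -> tgt f = src g ->
  far F (gc g f) = gc (far F g) (far F f).
Proof. by case=> _ _ _ _ H /(gcP hX) /H /(gcE hY). Qed.

Lemma tan_functor (F : grpd_map X Y) : is_functor F -> is_functor (tanF F).
Proof.
move=> hF; have [[s0 s1] es et eu ec] := hF.
have cX0 := ob_charted hX; have cX1 := ar_charted hX.
have cY0 := ob_charted hY; have cY1 := ar_charted hY.
split.
- by split; apply: smooth_tmap => //; [exact: ob_atlas|exact: ob_atlas|
    exact: ar_atlas|exact: ar_atlas].
- move=> f; apply: (tmap_comm f cX1 cY1 cX0 cY0 s1 (smooth_src hY) (smooth_src hX) s0).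
  exact: es.
- move=> f; apply: (tmap_comm f cX1 cY1 cX0 cY0 s1 (smooth_tgt hY) (smooth_tgt hX) s0).
  exact: et.
- move=> f; apply: (tmap_comm f cX0 cX1 cY0 cY1 (smooth_unit1 hX) s1 s0 (smooth_unit1 hY)).
  exact: eu.
- move=> _ _ _ [z [<- <- <-]].
  (* A composable pair of tangent arrows is one tangent vector of [cp X]. Hence the maps to be
     lifted live on the manifold [cp X] itself. *)
  pose a := far F \o @pr2 R X; pose b := far F \o @pr1 R X.
  have sa : smooth a by exact: smooth_comp (cp_charted hX) cX1 (smooth_pr2 hX) s1.
  have sb : smooth b by exact: smooth_comp (cp_charted hX) cX1 (smooth_pr1 hX) s1.
  have eab w : tgt (b w) = src (a w) by rewrite /a /b /= es et cp_composable.
  have := tangent_gc hY z (cp_manifold hX) sa sb eab.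
  have -> : tmap a z = tmap (far F) (tmap (@pr2 R X) z).
    exact: (tmap_comp z (cp_charted hX) cX1 cY1 (smooth_pr2 hX) s1).
  have -> : tmap b z = tmap (far F) (tmap (@pr1 R X) z).
    exact: (tmap_comp z (cp_charted hX) cX1 cY1 (smooth_pr1 hX) s1).
  have -> : tmap (fun w => gc (a w) (b w)) z = tmap (far F) (tmap (@mul R X) z).
    apply/esym; apply: (tmap_comp1 z (cp_charted hX) cX1 cY1 (smooth_mul hX) s1).
    move=> w /=; rewrite /a /b /= -functor_gc ?cp_composable //.
    by congr (far F); apply/esym/(gcE hX); exists w.
  by [].
Qed.

(** Between functors both composites in the square exist, so naturality becomes an equation for the
    total operation [gc]. *)
Lemma natP (K K' : grpd_map X Y) (th : ob X -> ar Y) :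
  is_functor K -> is_functor K' ->
  is_nat K K' th <->
  [/\ smooth th, forall x, src (th x) = fob K x, forall x, tgt (th x) = fob K' x &
    forall f, gc (th (tgt f)) (far K f) = gc (far K' f) (th (src f))].
Proof.
case=> _ ks kt _ _ [_ ks' kt' _ _]; split=> -[s es et n]; split=> // f.
  by have [h [/(gcE hY) -> /(gcE hY) ->]] := n f.
exists (gc (th (tgt f)) (far K f)); split; first by apply: gcP; rewrite // kt es.
by rewrite n; apply: gcP; rewrite // et ks'.
Qed.

(** The naturality squares of all arrows together are one equation between two maps on the manifold
    [ar X], each a composite depending smoothly on the arrow; differentiating it gives the square
    for tangent arrows. *)
Lemma tan_natural (K K' : grpd_map X Y) (th : ob X -> ar Y) (w : tanS (ar X)) :
  is_functor K -> is_functor K' -> is_nat K K' th ->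
  exists h : tanS (ar Y),
   composite (X := tanG Y) (tmap th (tmap (@tgt R X) w)) (tmap (far K) w) h /\
   composite (X := tanG Y) (tmap (far K') w) (tmap th (tmap (@src R X) w)) h.
Proof.
move=> hK hK' /(natP _ hK hK') [s es et n].
have [[_ sK] ks kt _ _] := hK; have [[_ sK'] ks' kt' _ _] := hK'.
have cX0 := ob_charted hX; have cX1 := ar_charted hX; have cY1 := ar_charted hY.
have st := smooth_comp cX1 cX0 (smooth_tgt hX) s.
have ss := smooth_comp cX1 cX0 (smooth_src hX) s.
have e1 f : tgt (far K f) = src ((th \o @tgt R X) f) by rewrite /= kt es.
have e2 f : tgt ((th \o @src R X) f) = src (far K' f) by rewrite /= et ks'.
have H1 := tangent_gc hY w (ar_manifold hX) st sK e1.
have H2 := tangent_gc hY w (ar_manifold hX) sK' ss e2.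
have T1 := tmap_comp w cX1 cX0 cY1 (smooth_tgt hX) s.
have T2 := tmap_comp w cX1 cX0 cY1 (smooth_src hX) s.
exists (tmap (fun f => gc (th (tgt f)) (far K f)) w); split.
  exact (eq_ind _ (fun y => composite (X := tanG Y) y _ _) H1 _ T1).
have N := eq_tmap w n.
have H3 := eq_ind _ (fun y => composite (X := tanG Y) _ y _) H2 _ T2.
exact (eq_ind _ (fun y => composite (X := tanG Y) _ _ y) H3 _ (esym N)).
Qed.
End Functors.

(** * The gauge 2-group *)

Lemma gc_inv_uniq (R : realType) (X : sgrpd R) (hX : is_lie_groupoid X)
    (g f : ar X) : tgt f = src g -> gc g f = unit1 (src f) ->
  g = inv1 f.
Proof.
move=> e E; rewrite -[LHS](gc1 hX) -e -(gcfV hX) (gcA hX) ?tgt_inv // E.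
by rewrite -(tgt_inv hX) (gc1l hX).
Qed.

Section MoreGroupoids.
Context {R : realType} (X Y : sgrpd R).
Hypotheses (hX : is_lie_groupoid X) (hY : is_lie_groupoid Y).

Lemma functor_inv (F : grpd_map X Y) (f : ar X) : is_functor F ->
  far F (inv1 f) = inv1 (far F f).
Proof.
move=> hF; have [_ es et eu _] := hF; apply: (gc_inv_uniq hY).
  by rewrite et es (src_inv hX).
by rewrite -(functor_gc hX hY) ?(src_inv hX) // (gcVf hX) eu es.
Qed.

Lemma comp_functor (Z : sgrpd R) (F : grpd_map X Y) (G : grpd_map Y Z) :
  charted (ob X) -> charted (ar X) -> charted (ob Y) -> charted (ar Y) ->
  is_functor F -> is_functor G -> is_functor (compF G F).
Proof.
move=> ? ? ? ? [[a b] es et eu ec] [[a' b'] es' et' eu' ec']; split.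
- by split; apply: smooth_comp.
- by move=> f /=; rewrite es' es.
- by move=> f /=; rewrite et' et.
- by move=> f /=; rewrite eu eu'.
- by move=> g f h /ec /ec'.
Qed.

Lemma id_functor : is_functor (idF X).
Proof.
by split=> //; split; apply: smooth_id; [exact: ob_atlas|exact: ar_atlas].
Qed.

Lemma grpd_map_eq (F G : grpd_map X Y) : fob F =1 fob G -> far F =1 far G -> F = G.
Proof. by case: F => a b; case: G => c d /= /funext -> /funext ->. Qed.
End MoreGroupoids.

Section Gauge.
Context {R : realType} (X : xmod R) (E : bundle_data X).
Hypotheses (hX : is_lie_crossed_module X) (hE : is_principal_2bundle E).
Let T := tot E.

Lemma tot_groupoid : is_lie_groupoid (tot E). Proof. by case: hE => -[]. Qed.
Lemma base_groupoid : is_lie_groupoid (base E). Proof. by case: hE => -[]. Qed.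
Lemma proj_functor : is_functor (proj E). Proof. by case: hE. Qed.
Lemma rho_functor : is_functor (rho E). Proof. by case: hE. Qed.

Let hT := tot_groupoid.
Let hB := base_groupoid.

Lemma act0M p g h : act0 (act0 p g) h = act0 p (gmul g h) :> ob (tot E).
Proof. by case: hE => _ _ _ [_ _ [_ H] _ _] _; exact: H. Qed.
Lemma src_act1 p (k : semi X) : src (act1 p k) = act0 (src p) k.2 :> ob (tot E).
Proof. by case: rho_functor => _ H _ _ _; exact: (H (p, k)). Qed.
Lemma tgt_act1 p (k : semi X) :
  tgt (act1 p k) = act0 (tgt p) (gmul (xtau k.1) k.2) :> ob (tot E).
Proof. by case: rho_functor => _ _ H _ _; exact: (H (p, k)). Qed.
Lemma src_act1_one1 p (g : xG X) : src (act1 p (one1 g)) = act0 (src p) g :> ob (tot E).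
Proof. by rewrite src_act1. Qed.
Lemma tgt_act1_one1 p (g : xG X) : tgt (act1 p (one1 g)) = act0 (tgt p) g :> ob (tot E).
Proof. by rewrite tgt_act1 /= tau1 // (gmul1g (xG_group hX)). Qed.
Lemma unit_act0 p (g : xG X) : unit1 (act0 p g) = act1 (unit1 p) (one1 g) :> ar (tot E).
Proof. by case: rho_functor => _ _ _ H _; exact: esym (H (p, g)). Qed.

(** Functoriality of the action at the pairs (g, 1_x) and (f, 1_x), because 1_x composed with itself
    is 1_x. *)
Lemma gc_act1 (g f : ar (tot E)) (x : xG X) : tgt f = src g ->
  gc (act1 g (one1 x)) (act1 f (one1 x)) = act1 (gc g f) (one1 x).
Proof.
move=> /(gcP hT) [z [z2 z1 zm]]; apply: (gcE hT).
have [_ _ _ _ H] := rho_functor.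
apply: (H (g, one1 x) (f, one1 x) (gc g f, one1 x)).
(* In the encoding of composable pairs of the 2-group, the later arrow is recorded by its
   [H]-component only; here that is the identity. *)
exists (z, (gone (xH X), one1 x)); split => //=.
- by rewrite z2 tau1 // (gmul1g (xG_group hX)).
- by rewrite z1.
- by rewrite zm (gmul1g (xH_group hX)).
Qed.

Lemma inv_act1 (f : ar (tot E)) (x : xG X) :
  inv1 (act1 f (one1 x)) = act1 (inv1 f) (one1 x).
Proof.
apply/esym/(gc_inv_uniq hT).
  by rewrite src_act1_one1 tgt_act1_one1 (src_inv hT).
by rewrite gc_act1 ?(src_inv hT) // (gcVf hT) src_act1_one1 unit_act0.
Qed.

Lemma gauge_ob_eq (F F' : gauge_ob E) : gfun F = gfun F' -> F = F'.
Proof.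
case: F => f p; case: F' => f' p' /= e.
by subst f'; congr GaugeOb; exact: Prop_irrelevance.
Qed.

Lemma gauge_mor_eq (P Q : gauge_mor E) : gdom P = gdom Q -> gcod P = gcod Q ->
  gmap P =1 gmap Q -> P = Q.
Proof.
case: P => a b p hp; case: Q => a' b' q hq /= ea eb /funext eq.
by subst a' b' q; congr GaugeMor; apply: Prop_irrelevance.
Qed.

Lemma gauge_functor (F : gauge_ob E) : is_functor F.
Proof. by case: (gfunP F) => -[]. Qed.
Lemma gauge_act0 (F : gauge_ob E) p g : fob F (act0 p g) = act0 (fob F p) g.
Proof. by case: (gfunP F). Qed.
Lemma gauge_act1 (F : gauge_ob E) p k : far F (act1 p k) = act1 (far F p) k.
Proof. by case: (gfunP F). Qed.
Lemma gauge_proj (F : gauge_ob E) : compF (proj E) F = proj E.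
Proof. by case: (gfunP F). Qed.

Let comp_fun (F G : grpd_map T T) : is_functor F -> is_functor G -> is_functor (compF F G).
Proof.
move=> hF hG; apply: (comp_functor _ _ _ _ hG hF);
 [exact: ob_charted|exact: ar_charted|exact: ob_charted|exact: ar_charted].
Qed.

Lemma gauge_id_proof : [/\ is_automorphism (idF (tot E)),
    forall p g, fob (idF (tot E)) (act0 p g) = act0 (fob (idF (tot E)) p) g,
    forall p k, far (idF (tot E)) (act1 p k) = act1 (far (idF (tot E)) p) k &
    compF (proj E) (idF (tot E)) = proj E].
Proof.
have i := id_functor hT; split=> //; last by apply: grpd_map_eq.
by split=> //; exists (idF T).
Qed.

Definition gauge_id : gauge_ob E := GaugeOb gauge_id_proof.

Lemma gauge_mul_proof (F F' : gauge_ob E) : [/\ is_automorphism (compF F F'),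
    forall p g, fob (compF F F') (act0 p g) = act0 (fob (compF F F') p) g,
    forall p k, far (compF F F') (act1 p k) = act1 (far (compF F F') p) k &
    compF (proj E) (compF F F') = proj E].
Proof.
have [[fF [G [fG FG GF]]] _ _ pF] := gfunP F.
have [[fF' [G' [fG' FG' GF']]] _ _ pF'] := gfunP F'.
split.
- split; first exact: comp_fun.
  exists (compF G' G); split; first exact: comp_fun.
    rewrite -[LHS]/(compF F (compF (compF F' G') G)) FG' -[RHS]FG; by apply: grpd_map_eq.
  rewrite -[LHS]/(compF G' (compF (compF G F) F')) GF -[RHS]GF'; by apply: grpd_map_eq.
- by move=> p g /=; rewrite !gauge_act0.
- by move=> p g /=; rewrite !gauge_act1.
- by rewrite -[LHS]/(compF (compF (proj E) F) F') pF pF'.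
Qed.

Definition gauge_mul (F F' : gauge_ob E) : gauge_ob E := GaugeOb (gauge_mul_proof F F').

(** An inverse functor inherits equivariance and compatibility with the projection by inserting [F]
    and cancelling. *)
Lemma gauge_inv_ex (F : gauge_ob E) : exists G : gauge_ob E,
  compF F G = idF (tot E) /\ compF G F = idF (tot E).
Proof.
have [[fF [G [fG FG GF]]] a0 a1 pF] := gfunP F.
have FG0 x : fob F (fob G x) = x by rewrite -[LHS]/(fob (compF F G) x) FG.
have FG1 x : far F (far G x) = x by rewrite -[LHS]/(far (compF F G) x) FG.
have GF0 x : fob G (fob F x) = x by rewrite -[LHS]/(fob (compF G F) x) GF.
have GF1 x : far G (far F x) = x by rewrite -[LHS]/(far (compF G F) x) GF.
unshelve eexists (@GaugeOb _ _ _ G _); last by [].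
split.
- by split=> //; exists F.
- by move=> p g; rewrite -{1}(FG0 p) -gauge_act0 GF0.
- by move=> p g; rewrite -{1}(FG1 p) -gauge_act1 GF1.
- by rewrite -{1}pF -[LHS]/(compF (proj E) (compF F G)) FG; apply: grpd_map_eq.
Qed.

Definition gauge_inv (F : gauge_ob E) : gauge_ob E := projT1 (cid (gauge_inv_ex F)).

Lemma gauge_invP (F : gauge_ob E) : compF F (gauge_inv F) = idF (tot E) /\
  compF (gauge_inv F) F = idF (tot E).
Proof. exact: (projT2 (cid (gauge_inv_ex F))). Qed.

Lemma fobK (F : gauge_ob E) : cancel (fob F) (fob (gauge_inv F)).
Proof. by move=> x; rewrite -[LHS]/(fob (compF (gauge_inv F) F) x) (gauge_invP F).2. Qed.
Lemma fobVK (F : gauge_ob E) : cancel (fob (gauge_inv F)) (fob F).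
Proof. by move=> x; rewrite -[LHS]/(fob (compF F (gauge_inv F)) x) (gauge_invP F).1. Qed.
Lemma farK (F : gauge_ob E) : cancel (far F) (far (gauge_inv F)).
Proof. by move=> x; rewrite -[LHS]/(far (compF (gauge_inv F) F) x) (gauge_invP F).2. Qed.
Lemma farVK (F : gauge_ob E) : cancel (far (gauge_inv F)) (far F).
Proof. by move=> x; rewrite -[LHS]/(far (compF F (gauge_inv F)) x) (gauge_invP F).1. Qed.

Lemma gauge_mulP : is_group gauge_mul gauge_id gauge_inv.
Proof.
split=> [F F' F''|F|F|F|F]; apply: gauge_ob_eq => //.
- by apply: grpd_map_eq.
- by apply: grpd_map_eq.
- exact: (gauge_invP F).2.
- exact: (gauge_invP F).1.
Qed.

(** * Natural isomorphisms between gauge automorphisms *)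

Definition gauge_nat (F F' : gauge_ob E) (th : ob (tot E) -> ar (tot E)) :=
  [/\ is_nat F F' th,
    forall p g, th (act0 p g) = act1 (th p) (one1 g) &
    forall p, far (proj E) (th p) = unit1 (fob (proj E) p)].

Lemma gauge_proj0 (F : gauge_ob E) p : fob (proj E) (fob F p) = fob (proj E) p.
Proof. by rewrite -[LHS]/(fob (compF (proj E) F) p) gauge_proj. Qed.
Lemma gauge_proj1 (F : gauge_ob E) p : far (proj E) (far F p) = far (proj E) p.
Proof. by rewrite -[LHS]/(far (compF (proj E) F) p) gauge_proj. Qed.

Lemma gauge_natP (F F' : gauge_ob E) th : gauge_nat F F' th <->
  [/\ [/\ smooth th, forall x, src (th x) = fob F x & forall x, tgt (th x) = fob F' x],
    forall f, gc (th (tgt f)) (far F f) = gc (far F' f) (th (src f)),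
    forall p g, th (act0 p g) = act1 (th p) (one1 g) &
    forall p, far (proj E) (th p) = unit1 (fob (proj E) p)].
Proof.
have H := natP hT th (gauge_functor F) (gauge_functor F').
by split=> [[/H [? ? ? ?] ? ?]|[[? ? ?] ? ? ?]]; split=> //; apply/H.
Qed.

Let gsrc (F : gauge_ob E) f : src (far F f) = fob F (src f).
Proof. by case: (gauge_functor F). Qed.
Let gtgt (F : gauge_ob E) f : tgt (far F f) = fob F (tgt f).
Proof. by case: (gauge_functor F). Qed.
Let gunit (F : gauge_ob E) x : far F (unit1 x) = unit1 (fob F x).
Proof. by case: (gauge_functor F). Qed.
Let gsm0 (F : gauge_ob E) : smooth (fob F). Proof. by case: (gauge_functor F) => -[]. Qed.
Let gsm1 (F : gauge_ob E) : smooth (far F). Proof. by case: (gauge_functor F) => -[]. Qed.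
Let ggc (F : gauge_ob E) g f : tgt f = src g -> far F (gc g f) = gc (far F g) (far F f).
Proof. exact: (functor_gc hT hT (gauge_functor F)). Qed.
Let punit x : far (proj E) (unit1 x) = unit1 (fob (proj E) x).
Proof. by case: proj_functor. Qed.
Let c0 := ob_charted hT.
Let c1 := ar_charted hT.

Lemma gauge_nat_id F : gauge_nat F F (fun x => unit1 (fob F x)).
Proof.
apply/gauge_natP; split.
- split=> [|x|x]; last exact: (tgt_unit hT); last exact: (src_unit hT).
  exact: smooth_comp c0 c0 (gsm0 F) (smooth_unit1 hT).
- by move=> f; rewrite -gtgt (gc1l hT) -gsrc (gc1 hT).
- by move=> p g; rewrite gauge_act0 unit_act0.
- by move=> p; rewrite punit gauge_proj0.
Qed.

Lemma gauge_nat_comp F F' F'' th th' : gauge_nat F F' th -> gauge_nat F' F'' th' ->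
  gauge_nat F F'' (fun x => gc (th' x) (th x)).
Proof.
move=> /gauge_natP [[s es et] n a p] /gauge_natP [[s' es' et'] n' a' p'].
have e x : tgt (th x) = src (th' x) by rewrite et es'.
apply/gauge_natP; split.
- split=> [|x|x].
  + by apply: (smooth_gc hT) => //; exact: ob_manifold.
  + by rewrite src_gc.
  + by rewrite tgt_gc.
- move=> f; rewrite -(gcA hT) ?gtgt ?es // n.
  by rewrite !(gcA hT) ?gtgt ?gsrc ?es ?et ?es' ?et' ?n'.
- by move=> q g; rewrite a a' gc_act1.
- move=> q; rewrite (functor_gc hT hB proj_functor) // p p'.
  by rewrite -{2}(src_unit hB (fob (proj E) q)) (gc1 hB).
Qed.

Lemma gauge_nat_inv F F' th : gauge_nat F F' th ->
  gauge_nat F' F (fun x => inv1 (th x)).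
Proof.
move=> /gauge_natP [[s es et] n a p]; apply/gauge_natP; split.
- split=> [|x|x].
  + exact: smooth_comp c0 c1 s (smooth_inv1 hT).
  + by rewrite src_inv.
  + by rewrite tgt_inv.
- move=> f; rewrite -[X in _ = gc X _](gcK hT (g := th (tgt f))) ?gtgt ?es // n.
  rewrite -!(gcA hT) ?tgt_gc ?src_gc ?gtgt ?gsrc ?es ?et ?src_inv ?tgt_inv ?es ?et //.
  by rewrite (gcfV hT) et -gsrc (gc1 hT).
- by move=> q g; rewrite a inv_act1.
- move=> q; rewrite (functor_inv hT hB _ proj_functor) p.
  apply/esym/(gc_inv_uniq hB); rewrite ?(src_unit hB) ?(tgt_unit hB) //.
  by rewrite -{2}(src_unit hB (fob (proj E) q)) (gc1 hB).
Qed.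

Lemma gauge_nat_hcomp F F' K K' th ph : gauge_nat F F' th -> gauge_nat K K' ph ->
  gauge_nat (gauge_mul F K) (gauge_mul F' K') (fun x => gc (th (fob K' x)) (far F (ph x))).
Proof.
move=> /gauge_natP [[s es et] n a p] /gauge_natP [[s' es' et'] n' a' p'].
have e x : tgt (far F (ph x)) = src (th (fob K' x)) by rewrite gtgt et' es.
apply/gauge_natP; split=> /=.
- split=> [|x|x].
  + apply: (smooth_gc hT) => //; first exact: ob_manifold.
      exact: smooth_comp c0 c0 (gsm0 K') s.
    exact: smooth_comp c0 c1 s' (gsm1 F).
  + by rewrite src_gc // gsrc es'.
  + by rewrite tgt_gc // et.
(* First the image under [F] of the naturality square of [ph] at [f], then the square of [th] at the
   arrow [far K' f]. *)
- move=> f; pose ss := (gtgt, gsrc, es, et, es', et').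
  rewrite -(gcA hT) ?ss // -ggc ?ss // n' ggc ?ss // (gcA hT) ?ss //.
  by rewrite -(gtgt K') n (gcA hT) ?ss.
- by move=> q g; rewrite gauge_act0 a a' gauge_act1 gc_act1.
- move=> q; rewrite (functor_gc hT hB proj_functor) // p gauge_proj1 gauge_proj0 p'.
  by rewrite -{2}(src_unit hB (fob (proj E) q)) (gc1 hB).
Qed.

(** The horizontal inverse is the vertical inverse whiskered on both sides. At y = F'^-1 x, the
    inverse of [th y] is an arrow from x to F F'^-1 x, and F^-1 turns it into one from F^-1 x to
    F'^-1 x. *)
Lemma gauge_nat_hinv F F' th : gauge_nat F F' th ->
  gauge_nat (gauge_inv F) (gauge_inv F')
    (fun x => far (gauge_inv F) (inv1 (th (fob (gauge_inv F') x)))).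
Proof.
move=> H; have /gauge_natP [[s es et] n a p] := gauge_nat_inv H.
apply/gauge_natP; split=> /=.
- split=> [|x|x].
  + apply: (smooth_comp c0 c1 _ (gsm1 _)).
    exact: smooth_comp c0 c0 (gsm0 (gauge_inv F')) s.
  + by rewrite gsrc es fobVK.
  + by rewrite gtgt et fobK.
- move=> f; have N := n (far (gauge_inv F') f); rewrite farVK in N.
  rewrite -gtgt -gsrc -ggc; last by rewrite es gtgt fobVK.
  by rewrite N ggc ?farK //; exact: etrans (et _) (esym (gsrc _ _)).
- by move=> q g; rewrite gauge_act0 a gauge_act1.
- by move=> q; rewrite gauge_proj1 p gauge_proj0.
Qed.

Definition gmor_id F : gauge_mor E := GaugeMor (gauge_nat_id F).
(** The equation [e] transports only the proof of naturality. The underlying map is free of casts,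
    so the category laws can be checked pointwise. *)
Definition gmor_comp (g f : gauge_mor E) (e : gcod f = gdom g) : gauge_mor E :=
  GaugeMor (gauge_nat_comp (gmapP f)
    (eq_rect_r (fun F => gauge_nat F (gcod g) (gmap g)) (gmapP g) e)).
Definition gmor_vinv (f : gauge_mor E) : gauge_mor E := GaugeMor (gauge_nat_inv (gmapP f)).
Definition gmor_mul (P P' : gauge_mor E) : gauge_mor E :=
  GaugeMor (gauge_nat_hcomp (gmapP P) (gmapP P')).
Definition gmor_inv (P : gauge_mor E) : gauge_mor E := GaugeMor (gauge_nat_hinv (gmapP P)).
Definition gmor_one : gauge_mor E := gmor_id gauge_id.

Lemma gsrcP (P : gauge_mor E) x : src (gmap P x) = fob (gdom P) x.
Proof. by case: (gmapP P) => -[]. Qed.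
Lemma gtgtP (P : gauge_mor E) x : tgt (gmap P x) = fob (gcod P) x.
Proof. by case: (gmapP P) => -[]. Qed.
Lemma gnatP (P : gauge_mor E) f :
  gc (gmap P (tgt f)) (far (gdom P) f) = gc (far (gcod P) f) (gmap P (src f)).
Proof. by have /gauge_natP [] := gmapP P. Qed.

Definition gauge_category : category (@gdom R X E) (@gcod R X E).
Proof.
refine (@Category _ _ _ _ gmor_id gmor_comp _ _ _ _ _ _ _) => //.
- move=> f e; apply: gauge_mor_eq => //= x.
  by rewrite -gtgtP (gc1l hT).
- move=> f e; apply: gauge_mor_eq => //= x.
  by rewrite -gsrcP (gc1 hT).
- move=> h g f gf hg e e'; apply: gauge_mor_eq => //= x.
  by rewrite (gcA hT) // ?gtgtP ?gsrcP ?gf ?hg.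
Defined.

Lemma gmor_mulP : is_group gmor_mul gmor_one gmor_inv.
Proof.
(* These group laws of the gauge automorphisms settle the sources and targets; only the pointwise
   identities remain. *)
have [A l r v w] := gauge_mulP.
split=> [P P' P''|P|P|P|P]; apply: gauge_mor_eq => //=.
- move=> x; rewrite ggc ?gtgtP ?gsrcP ?gtgt ?gtgtP //.
  by rewrite (gcA hT) ?gtgtP ?gsrcP ?gtgt ?gsrc ?gtgtP ?gsrcP.
- by move=> x; rewrite -gtgtP (gc1l hT).
- by move=> x; rewrite gunit -gsrcP (gc1 hT).
- move=> x; rewrite fobK -ggc ?(src_inv hT) // (gcVf hT) gsrcP gunit.
  exact: congr1 (fobK _ _).
- move=> x; rewrite farVK (gcfV hT) gtgtP; exact: congr1 (fobVK _ _).
Qed.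

Definition gauge_2group : two_group gauge_category.
Proof.
refine (@TwoGroup _ _ _ _ gauge_category gauge_mul gauge_id gauge_inv
  gmor_mul gmor_one gmor_inv gauge_mulP gmor_mulP _ _ _ _ _) => //.
- move=> F F'; apply: gauge_mor_eq => //= x; rewrite gunit.
  by have := gc1 hT (unit1 (fob F (fob F' x))); rewrite (src_unit hT).
- move=> g f g' f' e e' e2; apply: gauge_mor_eq => //= x.
  rewrite ggc; last by rewrite gtgtP gsrcP e'.
  (* The interchange law rests on the naturality of [f] along the arrow [gmap g' x], which exchanges
     the two middle factors of a fourfold composite. *)
  have N := gnatP f (gmap g' x); rewrite gtgtP gsrcP -e' e in N.
  have Eg y : src (gmap g y) = fob (gcod f) y by rewrite gsrcP e.
  have Eg' y : src (gmap g' y) = fob (gcod f') y by rewrite gsrcP e'.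
  pose ss := (gtgt, gsrc, Eg', gtgtP, gsrcP).
  set A := gmap g _; set B := far (gdom g) _; set C := gmap f _.
  set D := far (gdom f) (gmap f' x); set B' := far (gdom f) (gmap g' x).
  rewrite -[X in gc X B']/(gmap f (fob (gcod g') x)) -/C -/B -/B' in N.
  set C' := gmap f _ in N *.
  have tB : tgt B = src A by rewrite /A /B ?ss.
  have tC : tgt C = src B by rewrite /B /C ?ss e.
  have tD : tgt D = src C by rewrite /D /C ?ss.
  have tC' : tgt C' = src A by rewrite /C' /A Eg gtgtP.
  have tB' : tgt B' = src C' by rewrite /C' /B' ?ss.
  have tD' : tgt D = src B' by rewrite /D /B' ?ss.
  rewrite -(gcA hT) ?tgt_gc // (gcA hT (h := B)) // -N.
  by rewrite -(gcA hT tD' tB') (gcA hT) ?tgt_gc.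
- move=> f; exists (gmor_vinv f), erefl, erefl.
  by split; apply: gauge_mor_eq => //= x; rewrite ?(gcVf hT) ?(gcfV hT) ?gsrcP ?gtgtP.
Defined.
End Gauge.

(** * The Lie 2-algebra of a crossed module *)

Section Lie2.
Context {R : realType} (X : xmod R).
Hypothesis hX : is_lie_crossed_module X.
Let VH := 'rV[R]_(dim (xH X)).
Let VG := 'rV[R]_(dim (xG X)).
Let VS := 'rV[R]_(dim (semi X)).

Lemma LH_pair (A : VH) (B : VG) : LH (Lpair A B) = A. Proof. exact: row_mxKl. Qed.
Lemma LG_pair (A : VH) (B : VG) : LG (Lpair A B) = B. Proof. exact: row_mxKr. Qed.
Lemma Lpair_eta (a : Lie (semi X)) : Lpair (LH a) (LG a) = a. Proof. exact: hsubmxK. Qed.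
Lemma Lpair_add (A A' : VH) (B B' : VG) :
  (Lpair A B : VS) + Lpair A' B' = Lpair (A + A') (B + B').
Proof. exact: add_row_mx. Qed.
Lemma Lpair_scale c (A : VH) (B : VG) : c *: (Lpair A B : VS) = Lpair (c *: A) (c *: B).
Proof. exact: scale_row_mx. Qed.
Lemma LH_add (a b : VS) : LH (a + b : VS) = LH a + LH b :> VH.
Proof. exact: linearD. Qed.
Lemma LG_add (a b : VS) : LG (a + b : VS) = LG a + LG b :> VG.
Proof. exact: linearD. Qed.
Lemma LH_scale c (a : VS) : LH (c *: a : VS) = c *: LH a :> VH.
Proof. exact: linearZ. Qed.

Lemma linear_func0 (m n : nat) (f : 'rV[R]_m -> 'rV[R]_n) : linear f -> f 0 = 0.
Proof.
by move=> lf; have := lf (-1) 0 0; rewrite scaler0 addr0 scaleN1r addNr.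
Qed.
Lemma linear_funcD (m n : nat) (f : 'rV[R]_m -> 'rV[R]_n) u v : linear f ->
  f (u + v) = f u + f v.
Proof. by move=> lf; have := lf 1 u v; rewrite !scale1r. Qed.
Lemma linear_funcN (m n : nat) (f : 'rV[R]_m -> 'rV[R]_n) u : linear f ->
  f (- u) = - f u.
Proof.
by move=> lf; have := lf (-1) u 0; rewrite (linear_func0 lf) !addr0 !scaleN1r.
Qed.

Lemma dtau0 : dtau (0 : Lie (xH X)) = 0 :> VG.
Proof. exact: (linear_func0 (@dtau_linear R X)). Qed.
Lemma dtauD (A B : VH) :
  dtau (A + B : Lie (xH X)) = dtau (A : Lie (xH X)) + dtau (B : Lie (xH X)) :> VG.
Proof. exact: (linear_funcD _ _ (@dtau_linear R X)). Qed.
Lemma dtauN (A : VH) : dtau (- A : Lie (xH X)) = - dtau (A : Lie (xH X)) :> VG.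
Proof. exact: (linear_funcN _ (@dtau_linear R X)). Qed.
Lemma dalpha0 g : dalpha g (0 : Lie (xH X)) = 0 :> VH.
Proof. exact: (linear_func0 (@dalpha_linear R X g)). Qed.
Lemma dalphaD g (A B : VH) :
  dalpha g (A + B : Lie (xH X)) = dalpha g (A : Lie (xH X)) + dalpha g (B : Lie (xH X)) :> VH.
Proof. exact: (linear_funcD _ _ (@dalpha_linear R X g)). Qed.
Lemma dalphaN g (A : VH) : dalpha g (- A : Lie (xH X)) = - dalpha g (A : Lie (xH X)) :> VH.
Proof. exact: (linear_funcN _ (@dalpha_linear R X g)). Qed.
Lemma AdD (K : group_data R) (k : K) (A B : 'rV[R]_(dim K)) :
  Ad k (A + B : Lie K) = Ad k (A : Lie K) + Ad k (B : Lie K) :> 'rV[R]_(dim K).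
Proof. exact: (linear_funcD _ _ (@Ad_linear R K k)). Qed.

(** Composability is a matter of ends, and composing adds the L(H)-components over the source of the
    first arrow; this eliminates the encoding of composable pairs. *)
Lemma lie2_composite (a b c : ar (lie2 X)) : composite a b c <->
  (dtau (LH b : Lie (xH X)) : VG) + LG b = LG a /\ c = Lpair (LH a + LH b) (LG b).
Proof.
split.
  case=> -[A2 b'] [/= ea eb ec]; rewrite -ea -ec -eb.
  by rewrite LG_pair LH_pair.
move=> [e ->]; exists ((LH a : Lie (xH X)), b); split => //=.
by rewrite e Lpair_eta.
Qed.

Lemma smooth_LH (M : space R) (f : M -> Lie (semi X)) : smooth f ->
  smooth (fun x => LH (f x) : Lie (xH X)).
Proof.
exact: (smooth_lin (m := (dim (xH X) + dim (xG X))%N) (f := f) (@lsubmx_linear R _ _)).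
Qed.

Lemma smooth_Lpair (M : space R) (f : M -> Lie (xH X)) (g : M -> Lie (xG X)) :
  smooth f -> smooth g -> smooth (fun x => Lpair (f x) (g x) : Lie (semi X)).
Proof. exact: smooth_row_mx. Qed.

Lemma smooth_dtau (M : space R) (f : M -> Lie (xH X)) : smooth f ->
  smooth (fun x => dtau (f x) : Lie (xG X)).
Proof. exact: (smooth_lin (@dtau_linear R X)). Qed.

Lemma smooth_oppv (M : space R) n (f : M -> eucl n) : smooth f ->
  smooth (fun x => - (f x : 'rV[R]_n) : eucl n).
Proof.
by move=> sf; apply: (smooth_lin (L := -%R) _ sf) => a u v; rewrite scalerN opprD.
Qed.

Variable Y : sgrpd R.
Implicit Types w : grpd_map Y (lie2 X).

(** The part of functoriality that a description of natural transformations requires. For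
    [compF w (deltaF E)] only this part is established, by differentiating source and target of the
    action. *)
Definition respects_ends w :=
  (forall f, LG (far w f) = fob w (src f)) /\
  (forall f, (dtau (LH (far w f) : Lie (xH X)) : VG) + LG (far w f) = fob w (tgt f)).

Lemma functor_ends w : is_functor w -> respects_ends w.
Proof. by case=> _ a b _ _; split. Qed.

(** The L(G)-component of an arrow is its source, so preserving composites means adding
    L(H)-components. The hypothesis supplies the ends of composites in [Y], which is to be a tangent
    groupoid, not shown here to be a Lie groupoid. *)
Lemma functor_lie2P w :
  (forall g f h : ar Y, composite g f h -> tgt f = src g /\ src h = src f) ->
  is_functor w <->
  [/\ smooth (fob w) /\ smooth (far w), respects_ends w,
    forall x, far w (unit1 x) = Lpair 0 (fob w x) &
    forall g f h, composite g f h -> LH (far w h) = LH (far w g) + LH (far w f)].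
Proof.
move=> hY; split.
  move=> hw; have re := functor_ends hw; case: hw => s es et eu ec; split=> //.
  by move=> g f h /ec /lie2_composite [_ ->]; rewrite LH_pair.
case=> s [es et] eu ec; split=> // g f h c; have [e1 e2] := hY _ _ _ c.
apply/lie2_composite; split; first by rewrite et es e1.
by rewrite -(ec _ _ _ c) es -e2 -es Lpair_eta.
Qed.

(** The source condition fixes the L(G)-component, the target condition says that tau of the
    L(H)-component is the difference of the two functors, and the square becomes an equation in the
    abelian group L(H). *)
Lemma nat_lie2P w w' (th : ob Y -> Lie (semi X)) : respects_ends w ->
  respects_ends w' ->
  is_nat w w' th <->
  [/\ smooth th, forall x, LG (th x) = fob w x,
    forall x, (dtau (LH (th x) : Lie (xH X)) : VG) + fob w x = fob w' x &
    forall f, LH (th (tgt f)) + LH (far w f) = LH (far w' f) + LH (th (src f))].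
Proof.
move=> [es et] [es' et']; split.
  case=> s a b n; split=> //; first by move=> x; rewrite -a -b.
  move=> f; have [h [/lie2_composite [_ e1] /lie2_composite [_ e2]]] := n f.
  by have := congr1 (@LH _ _) e1; rewrite e2 !LH_pair.
case=> s a b n; split=> // [x|f]; first by rewrite -b -a.
exists (Lpair (LH (th (tgt f)) + LH (far w f)) (LG (far w f))); split.
  by apply/lie2_composite; rewrite a et.
by apply/lie2_composite; rewrite n a b es' es.
Qed.
End Lie2.

(** * Equivariant functors to the Lie 2-algebra *)

(** The tangent map of the identity is the identity and is smooth by [smooth_tmap]; smoothness of
    the identity is exactly the remaining atlas conditions. *)
Lemma tanS_atlas (R : realType) (M : space R) : is_atlas M -> is_atlas (tanS M).
Proof.
move=> aM; have := smooth_tmap aM aM (smooth_id aM).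
have -> : tmap (fun x : M => x) = (fun x : tanS M => x).
  by apply/funext => x; exact: tmap_id.
move=> /smoothP s; split; first exact: tanS_charted.
  by move=> i j; have [ o _] := s i j.
by move=> i j; have [_ C] := s i j.
Qed.

Section Forms.
Context {R : realType} (X : xmod R) (E : bundle_data X).
Hypotheses (hX : is_lie_crossed_module X) (hE : is_principal_2bundle E).
Let T := tot E.
Let VH := 'rV[R]_(dim (xH X)).
Let VG := 'rV[R]_(dim (xG X)).
Let VS := 'rV[R]_(dim (semi X)).
Let hT := tot_groupoid hE.
Let a0 := ob_atlas hT.
Let a1 := ar_atlas hT.
Let c0 := ob_charted hT.
Let c1 := ar_charted hT.
Let aG := xG_atlas hX.
Let aS := semi_atlas hX.
Let cG := atlas_charted aG.
Let cS := atlas_charted aS.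
Let ct0 := tanS_charted a0.
Let ct1 := tanS_charted a1.

Lemma smooth_act0 (g : xG X) : smooth (fun p : ob (tot E) => act0 p g).
Proof.
have s : smooth (fun p : ob T => (p, g) : prodS (ob T) (xG X)).
  by apply: (smooth_pair c0); [exact: smooth_id|exact: smooth_cst].
have [[sr _] _ _ _ _] := rho_functor hE.
exact: smooth_comp c0 (atlas_charted (prodS_atlas a0 aG)) s sr.
Qed.

Lemma smooth_act1 (k : semi X) : smooth (fun p : ar (tot E) => act1 p k).
Proof.
have s : smooth (fun p : ar T => (p, k) : prodS (ar T) (semi X)).
  by apply: (smooth_pair c1); [exact: smooth_id|exact: smooth_cst].
have [[_ sr] _ _ _ _] := rho_functor hE.
exact: smooth_comp c1 (atlas_charted (prodS_atlas a1 aS)) s sr.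
Qed.

Lemma smooth_orbit0 (p : ob (tot E)) : smooth (@act0 R X E p).
Proof.
have s : smooth (fun g : xG X => (p, g) : prodS (ob T) (xG X)).
  by apply: (smooth_pair cG); [exact: smooth_cst|exact: smooth_id].
have [[sr _] _ _ _ _] := rho_functor hE.
exact: smooth_comp cG (atlas_charted (prodS_atlas a0 aG)) s sr.
Qed.

Lemma smooth_orbit1 (p : ar (tot E)) : smooth (@act1 R X E p).
Proof.
have s : smooth (fun k : semi X => (p, k) : prodS (ar T) (semi X)).
  by apply: (smooth_pair cS); [exact: smooth_cst|exact: smooth_id].
have [[_ sr] _ _ _ _] := rho_functor hE.
exact: smooth_comp cS (atlas_charted (prodS_atlas a1 aS)) s sr.
Qed.

Let gs0 (F : gauge_ob E) : smooth (fob F). Proof. by case: (gauge_functor F) => -[]. Qed.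
Let gs1 (F : gauge_ob E) : smooth (far F). Proof. by case: (gauge_functor F) => -[]. Qed.
Let ssrc := smooth_src hT.
Let stgt := smooth_tgt hT.

Lemma tmap_src_tact1 (y : tanS (ar (tot E))) (k : semi X) :
  tmap (@src R (tot E)) (tact1 y k) = tact0 (tmap (@src R (tot E)) y) k.2.
Proof.
apply: (tmap_comm y c1 c1 c0 c0 (smooth_act1 k) ssrc ssrc (smooth_act0 k.2)).
by move=> p; exact: src_act1.
Qed.

Lemma tmap_tgt_tact1 (y : tanS (ar (tot E))) (k : semi X) :
  tmap (@tgt R (tot E)) (tact1 y k) =
  tact0 (tmap (@tgt R (tot E)) y) (gmul (xtau k.1) k.2).
Proof.
apply: (tmap_comm y c1 c1 c0 c0 (smooth_act1 k) stgt stgt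
  (smooth_act0 (gmul (xtau k.1) k.2))).
by move=> p; exact: tgt_act1.
Qed.

Lemma tmap_gauge_tact0 (F : gauge_ob E) x (g : xG X) :
  tmap (fob F) (tact0 x g) = tact0 (tmap (fob F) x) g.
Proof.
apply: (tmap_comm x c0 c0 c0 c0 (smooth_act0 g) (gs0 F) (gs0 F) (smooth_act0 g)).
by move=> p; exact: gauge_act0.
Qed.

Lemma tmap_gauge_tact1 (F : gauge_ob E) y (k : semi X) :
  tmap (far F) (tact1 y k) = tact1 (tmap (far F) y) k.
Proof.
apply: (tmap_comm y c1 c1 c1 c1 (smooth_act1 k) (gs1 F) (gs1 F) (smooth_act1 k)).
by move=> p; exact: gauge_act1.
Qed.

Lemma tmap_src_far (F : gauge_ob E) y :
  tmap (@src R (tot E)) (tmap (far F) y) = tmap (fob F) (tmap (@src R (tot E)) y).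
Proof.
apply: (tmap_comm y c1 c1 c0 c0 (gs1 F) ssrc ssrc (gs0 F)).
by case: (gauge_functor F) => _ H1 H2 _ _ p; first [exact: H1|exact: H2].
Qed.

Lemma tmap_tgt_far (F : gauge_ob E) y :
  tmap (@tgt R (tot E)) (tmap (far F) y) = tmap (fob F) (tmap (@tgt R (tot E)) y).
Proof.
apply: (tmap_comm y c1 c1 c0 c0 (gs1 F) stgt stgt (gs0 F)).
by case: (gauge_functor F) => _ H1 H2 _ _ p; first [exact: H1|exact: H2].
Qed.

Lemma tan_composite_ends (g f h : ar (tanG (tot E))) : composite g f h ->
  [/\ tgt f = src g, src h = src f & tgt h = tgt g].
Proof.
case=> z [<- <- <-]; have cz := cp_charted hT.
have s2 := smooth_pr2 hT; have s1 := smooth_pr1 hT; have sm := smooth_mul hT.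
have E1 (w : cp T) : [/\ tgt (pr1 w) = src (pr2 w), src (mul w) = src (pr1 w) &
    tgt (mul w) = tgt (pr2 w)].
  have e := cp_composable hT w; have <- : gc (pr2 w) (pr1 w) = mul w.
    by apply: (gcE hT); exists w.
  by rewrite (src_gc hT) // (tgt_gc hT).
split.
- apply: (tmap_comm z cz c1 c1 c0 s1 stgt s2 ssrc) => w; by case: (E1 w).
- apply: (tmap_comm z cz c1 c1 c0 sm ssrc s1 ssrc) => w; by case: (E1 w).
- apply: (tmap_comm z cz c1 c1 c0 sm stgt s2 stgt) => w; by case: (E1 w).
Qed.

Lemma tan_functor_lie2P (w : grpd_map (tanG (tot E)) (lie2 X)) : is_functor w <->
  [/\ smooth (fob w) /\ smooth (far w), respects_ends w,
    forall x, far w (unit1 x) = Lpair 0 (fob w x) &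
    forall g f h, composite g f h -> LH (far w h) = LH (far w g) + LH (far w f)].
Proof. by apply: functor_lie2P => g f h /tan_composite_ends []. Qed.

(** The common ground of the two kinds of forms: everything in [is_semistrict] except [kappa]. The
    calculus of morphisms works for any class of such functors. *)
Definition equivariant_functor (w : grpd_map (tanG (tot E)) (lie2 X)) : Prop :=
  [/\ is_functor w,
      one_form (fob w : _ -> Lie (xG X)) /\ one_form (far w : _ -> Lie (semi X)),
      forall x g, fob w (tact0 x g) = Ad (ginv g) (fob w x) &
      forall x k, far w (tact1 x k) = Ad (ginv k) (far w x)].

Lemma semistrict_equivariant w : is_semistrict E w -> equivariant_functor w.
Proof. by case. Qed.

Let sm0 (w : grpd_map (tanG T) (lie2 X)) : is_functor w -> smooth (fob w).
Proof. by case=> -[]. Qed.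
Let sm1 (w : grpd_map (tanG T) (lie2 X)) : is_functor w -> smooth (far w).
Proof. by case=> -[]. Qed.

Lemma fibre_linear_tmap (M N : space R) n (f : M -> N) (w : tanS N -> eucl n) :
  fibre_linear w -> fibre_linear (w \o tmap f).
Proof. by move=> lw p a u v; rewrite /= /tmap /= (mder_linear f p) lw. Qed.

Lemma fibre_linear_comp (M : space R) m n (w : tanS M -> eucl m)
  (L : 'rV[R]_m -> 'rV[R]_n) :
  linear L -> fibre_linear w -> fibre_linear (L \o w : tanS M -> eucl n).
Proof. by move=> lL lw p a u v; rewrite /= lw lL. Qed.

Lemma fibre_linear_add (M : space R) n (w w' : tanS M -> eucl n) :
  fibre_linear w -> fibre_linear w' ->
  fibre_linear (fun x => (w x : 'rV[R]_n) + w' x : eucl n).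
Proof. by move=> lw lw' p a u v; rewrite lw lw' scalerDr addrACA. Qed.

Lemma fibre_linear_opp (M : space R) n (w : tanS M -> eucl n) :
  fibre_linear w -> fibre_linear (fun x => - (w x : 'rV[R]_n) : eucl n).
Proof. by move=> lw p a u v; rewrite lw opprD scalerN. Qed.

Lemma fibre_linear_Lpair (M : space R) (f : tanS M -> Lie (xH X)) (g : tanS M -> Lie (xG X)) :
  fibre_linear f -> fibre_linear g ->
  fibre_linear (fun x => Lpair (f x) (g x) : Lie (semi X)).
Proof. by move=> lf lg p a u v; rewrite lf lg Lpair_scale Lpair_add. Qed.

Lemma one_form_add (M : space R) n (w w' : tanS M -> eucl n) :
  one_form w -> one_form w' -> one_form (fun x => (w x : 'rV[R]_n) + w' x : eucl n).
Proof.
by move=> [s l] [s' l']; split; [exact: smooth_add|exact: fibre_linear_add].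
Qed.

Lemma one_form_tmap (M N : space R) n (f : M -> N) (w : tanS N -> eucl n) :
  is_atlas M -> is_atlas N -> smooth f -> one_form w -> one_form (w \o tmap f).
Proof.
move=> aM aN sf [s l]; split; last exact: fibre_linear_tmap.
exact: smooth_comp (tanS_charted aM) (tanS_charted aN) (smooth_tmap aM aN sf) s.
Qed.

Lemma addF_functor (w w' : grpd_map (tanG (tot E)) (lie2 X)) :
  is_functor w -> is_functor w' -> is_functor (addF w w').
Proof.
move=> /tan_functor_lie2P [[s t] [es et] eu ec].
move=> /tan_functor_lie2P [[s' t'] [es' et'] eu' ec']; apply/tan_functor_lie2P; split.
- by split; exact: smooth_add.
- split=> f /=; first by rewrite LG_add es es'.
  by rewrite LG_add LH_add dtauD addrACA et et'.
- by move=> x; rewrite /= eu eu' Lpair_add addr0.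
- by move=> g f h c; rewrite /= !LH_add (ec _ _ _ c) (ec' _ _ _ c) addrACA.
Qed.

Lemma pull_functor (w : grpd_map (tanG (tot E)) (lie2 X)) (F : gauge_ob E) :
  is_functor w -> is_functor (compF w (tanF F)).
Proof.
move=> hw; apply: (comp_functor (X := tanG T) (Y := tanG T) ct0 ct1 ct0 ct1 _ hw).
exact: (tan_functor hT hT (gauge_functor F)).
Qed.

Lemma equivariant_add w w' : equivariant_functor w -> equivariant_functor w' ->
  equivariant_functor (addF w w').
Proof.
move=> [f [p0 p1] e0 e1] [f' [p0' p1'] e0' e1']; split.
- exact: addF_functor.
- by split; exact: one_form_add.
- by move=> x g; rewrite /= e0 e0' AdD.
- by move=> x g; rewrite /= e1 e1' AdD.
Qed.

Lemma equivariant_pull w (F : gauge_ob E) : equivariant_functor w ->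
  equivariant_functor (compF w (tanF F)).
Proof.
move=> [f [p0 p1] e0 e1]; split.
- exact: pull_functor.
- by split; [exact: one_form_tmap a0 a0 (gs0 F) p0|exact: one_form_tmap a1 a1 (gs1 F) p1].
- by move=> x g /=; rewrite -e0 tmap_gauge_tact0.
- by move=> x g /=; rewrite -e1 tmap_gauge_tact1.
Qed.

Lemma olam_functor (lam : tanS (ob (tot E)) -> Lie (xH X)) : one_form lam ->
  is_functor (olam lam).
Proof.
move=> [sl ll].
have slt : smooth (fun w => lam (tmap (@tgt R T) w)).
  exact: smooth_comp ct1 ct0 (smooth_tmap a1 a0 stgt) sl.
have sls : smooth (fun w => lam (tmap (@src R T) w)).
  exact: smooth_comp ct1 ct0 (smooth_tmap a1 a0 ssrc) sl.
apply/tan_functor_lie2P; split.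
- split; first exact (smooth_dtau sl).
  apply: smooth_Lpair; last exact (smooth_dtau sls).
  exact (smooth_add slt (smooth_oppv sls)).
- split=> f /=; first by rewrite LG_pair.
  by rewrite LG_pair LH_pair dtauD dtauN subrK.
- move=> x; rewrite /=; have su := smooth_unit1 hT.
  have -> : tmap (@tgt R T) (tmap (@unit1 R T) x) = x.
    rewrite (tmap_comp1 x c0 c1 c0 su stgt (h := fun p => p)); first exact: tmap_id.
    exact: tgt_unit.
  have -> : tmap (@src R T) (tmap (@unit1 R T) x) = x.
    rewrite (tmap_comp1 x c0 c1 c0 su ssrc (h := fun p => p)); first exact: tmap_id.
    exact: src_unit.
  by rewrite subrr.
(* The differences of [lam] at target and source telescope along a composite. *)
- move=> g f h /tan_composite_ends [/= e1 e2 e3].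
  rewrite /= !LH_pair e2 e3 e1 addrA subrK //.
Qed.

Lemma olam_equivariant w : is_olam E w -> equivariant_functor w.
Proof.
move=> [lam [[sl ll] el] ->]; have hf := olam_functor (conj sl ll); split=> //.
- split; split; [exact: sm0 hf| |exact: sm1 hf|].
    exact: (fibre_linear_comp (@dtau_linear R X) ll).
  have lt := fibre_linear_tmap (@tgt R T) ll.
  have ls := fibre_linear_tmap (@src R T) ll.
  apply: fibre_linear_Lpair; last exact: (fibre_linear_comp (@dtau_linear R X) ls).
  exact: (fibre_linear_add lt (fibre_linear_opp ls)).
- by move=> x g; exact (etrans (congr1 (@dtau R X) (el x g)) (dtau_dalpha hX _ _)).
(* [f] is the arrow part of [olam lam] as a function of the target and source vectors. Under k these
   move by t(k) and s(k), the situation of [Ad_olam] for the inverse of k. *)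
- pose f a b : Lie (semi X) := Lpair ((lam a : VH) - lam b) (dtau (lam b)).
  have H (k : semi X) a b : f (tact0 a (gmul (xtau k.1) k.2)) (tact0 b k.2) =
      Ad (ginv k) (f a b).
    by rewrite /f !el (Ad_olam hX) (tgt_ginv hX).
  move=> x k; exact (etrans (congr2 f (tmap_tgt_tact1 x k) (tmap_src_tact1 x k))
    (H k _ _)).
Qed.

Lemma equivariant_form_pull lam (F : gauge_ob E) : equivariant_form lam ->
  equivariant_form (lam \o tmap (fob F)).
Proof.
move=> [ol el]; split; first exact: one_form_tmap a0 a0 (gs0 F) ol.
by move=> x g; rewrite /= tmap_gauge_tact0 el.
Qed.

Lemma olam_pull w (F : gauge_ob E) : is_olam E w -> is_olam E (compF w (tanF F)).
Proof.
move=> [lam hl ->]; exists (lam \o tmap (fob F)); first exact: equivariant_form_pull.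
by apply: grpd_map_eq => // y /=; rewrite tmap_tgt_far tmap_src_far.
Qed.

Lemma olam_add w w' : is_olam E w -> is_olam E w' -> is_olam E (addF w w').
Proof.
move=> [lam [ol el] ->] [lam' [ol' el'] ->].
exists (fun x => (lam x : VH) + lam' x).
  split; first exact: one_form_add.
  by move=> x g; rewrite el el' dalphaD.
apply: grpd_map_eq => y /=; first by rewrite dtauD.
by rewrite Lpair_add dtauD opprD addrACA.
Qed.

Definition oppF (w : grpd_map (tanG (tot E)) (lie2 X)) : grpd_map (tanG (tot E)) (lie2 X) :=
  @GrpdMap R (tanG (tot E)) (lie2 X) (fun x => - (fob w x : VG)) (fun y => - (far w y : VS)).

Definition zeroF : grpd_map (tanG (tot E)) (lie2 X) :=
  @GrpdMap R (tanG (tot E)) (lie2 X) (fun=> (0 : VG)) (fun=> (0 : VS)).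

Lemma olam_opp w : is_olam E w -> is_olam E (oppF w).
Proof.
move=> [lam [[sl ll] el] ->]; exists (fun x => - (lam x : VH)).
  split; first by split; [exact: smooth_oppv|exact: fibre_linear_opp].
  by move=> x g; rewrite el dalphaN.
apply: grpd_map_eq => y /=; first by rewrite dtauN.
by rewrite dtauN -opprD /Lpair -opp_row_mx.
Qed.

Lemma olam0 : is_olam E zeroF.
Proof.
exists (fun=> (0 : VH)).
  split; first split; [exact: smooth_cst _ (tanS_atlas a0)| |].
  - by move=> p a u v; rewrite scaler0 addr0.
  - by move=> x g; rewrite dalpha0.
apply: grpd_map_eq => y /=; first by rewrite dtau0.
by rewrite dtau0 subrr /Lpair row_mx0.
Qed.
End Forms.

(** * Semi-strict connections *)

Section Connections.
Context {R : realType} (X : xmod R) (E : bundle_data X).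
Hypotheses (hX : is_lie_crossed_module X) (hE : is_principal_2bundle E).
Let T := tot E.
Let VH := 'rV[R]_(dim (xH X)).
Let VG := 'rV[R]_(dim (xG X)).
Let VS := 'rV[R]_(dim (semi X)).
Let hT := tot_groupoid hE.
Let a0 := ob_atlas hT.
Let c0 := ob_charted hT.
Let c1 := ar_charted hT.
Let aG := xG_atlas hX.
Let aH := xH_atlas hX.
Let aS := semi_atlas hX.
Let cG := atlas_charted aG.
Let cH := atlas_charted aH.
Let cS := atlas_charted aS.
Let ct0 := tanS_charted a0.
Let gG := xG_group hX.

Let delta0 (y : prodS (ob T) (Lie (xG X))) : tanS (ob T) :=
  tmap (@act0 R X E y.1) (gone (xG X), y.2).
Let delta1 (y : prodS (ar T) (Lie (semi X))) : tanS (ar T) :=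
  tmap (@act1 R X E y.1) (gone (semi X), y.2).

(** The definition differentiates the orbit map of each point separately. Joint smoothness comes
    from writing it as the tangent map of the whole action at (p, 1), evaluated on the vector (0,
    B). *)
Let smooth_delta0 : smooth delta0.
Proof.
have [[sr _] _ _ _ _] := rho_functor hE.
have aP := prodS_atlas a0 aG; have cP := atlas_charted aP.
have sv := smooth_vertical (gone (xG X)) a0 aG.
have cL := atlas_charted (prodS_atlas a0 (eucl_atlas (dim (xG X)))).
have H := smooth_comp cL (tanS_charted aP) sv (smooth_tmap aP a0 sr).
suff -> : delta0 = tmap (fob (rho E)) \o (fun y : prodS (ob T) (eucl (dim (xG X))) =>
    ((y.1, gone (xG X)), row_mx (0 : 'rV[R]_(dim (ob T))) y.2) :
    tanS (prodS (ob T) (xG X))) by exact: H.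
apply/funext => -[p B]; rewrite /delta0 /=.
pose inc (g : xG X) : prodS (ob T) (xG X) := (p, g).
have sp : smooth (fun _ : xG X => p) by exact: smooth_cst.
have si := smooth_id aG.
have sinc : smooth inc by exact: (smooth_pair cG sp si).
have <- : tmap inc (gone (xG X), B) =
    ((p, gone (xG X)), row_mx (0 : 'rV[R]_(dim (ob T))) B).
  congr pair; rewrite /= (mder_pair (gone (xG X)) B cG c0 cG sp si).
  by rewrite mder_cst mder_id.
by apply/esym; apply: (tmap_comp1 _ cG cP c0 sinc sr).
Qed.

Let src_delta y : tmap (@src R T) (delta1 y) = delta0 (src y.1, LG y.2).
Proof.
have s2 : smooth (fun k : semi X => k.2) by exact: (smooth_snd aH aG).
have E1 := tmap_comm ((gone (semi X), y.2) : tanS (semi X)) cS c1 cG c0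
  (smooth_orbit1 hX hE y.1) (smooth_src hT) s2 (smooth_orbit0 hX hE (src y.1))
  (fun k => src_act1 hE y.1 k).
rewrite /delta0 /delta1 E1 /=; congr tmap; congr pair.
exact: (mder_snd (M := xH X) (N := xG X)).
Qed.

(** The target of the orbit of an arrow is the orbit of its target, reparametrised by t(h, g) =
    tau(h) g. The differential of t at the identity is found on the two factors separately and added
    by linearity. *)
Let tgt_delta y : tmap (@tgt R T) (delta1 y) =
  delta0 (tgt y.1, (dtau (LH y.2 : Lie (xH X)) : VG) + LG y.2).
Proof.
pose t (k : semi X) : xG X := gmul (xtau k.1) k.2.
have s1 : smooth (fun k : semi X => k.1) by exact: (smooth_fst aH aG).
have s2 : smooth (fun k : semi X => k.2) by exact: (smooth_snd aH aG).
have st : smooth t.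
  apply: (smooth_mulr (xG_lie hX) cS) => //.
  exact: (smooth_comp cS cH s1 (smooth_tau hX)).
have E1 := tmap_comm ((gone (semi X), y.2) : tanS (semi X)) cS c1 cG c0
  (smooth_orbit1 hX hE y.1) (smooth_tgt hT) st (smooth_orbit0 hX hE (tgt y.1))
  (fun k => tgt_act1 hE y.1 k).
rewrite /delta0 /delta1 E1 /=; congr tmap; congr pair.
  by rewrite /t /= (tau1 hX) (gmul1g gG).
have I1 A : mder t (gone (semi X)) (row_mx A 0) = dtau (A : Lie (xH X)).
  have sp : smooth (fun h : xH X => (h, gone (xG X)) : semi X).
    by apply: (smooth_pair (N := xH X) (P := xG X) cH); [exact: smooth_id|exact: smooth_cst].
  have <- : mder (fun h : xH X => (h, gone (xG X)) : semi X) (gone (xH X)) A = row_mx A 0.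
    rewrite (mder_pair (N := xH X) (P := xG X)) //.
    - by rewrite mder_id // mder_cst.
    - exact: smooth_id.
    - exact: smooth_cst.
  apply: etrans (esym (mder_comp (gone (xH X)) A cH cS cG sp st)) _.
  by apply: eq_mder => h; rewrite /t /= (gmulg1 gG).
have I2 B : mder t (gone (semi X)) (row_mx 0 B) = B.
  have sp : smooth (fun g : xG X => (gone (xH X), g) : semi X).
    by apply: (smooth_pair (N := xH X) (P := xG X) cG); [exact: smooth_cst|exact: smooth_id].
  have <- : mder (fun g : xG X => (gone (xH X), g) : semi X) (gone (xG X)) B = row_mx 0 B.
    rewrite (mder_pair (N := xH X) (P := xG X)) //.
    - by rewrite mder_id // mder_cst.
    - exact: smooth_cst.
    - exact: smooth_id.
  apply: etrans (esym (mder_comp (gone (xG X)) B cG cS cG sp st)) _.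
  apply: etrans (eq_mder _ _ _) (mder_id (gone (xG X)) B aG).
  by move=> g; rewrite /t /= (tau1 hX) (gmul1g gG).
rewrite -[X in mder _ _ X]Lpair_eta [Lpair _ _]row_mx_split.
apply: etrans (linear_funcD _ _ (mder_linear t (gone (semi X)))) _.
exact: congr2 (I1 _) (I2 _).
Qed.

Let gauge_delta0 (F : gauge_ob E) y : tmap (fob F) (delta0 y) = delta0 (fob F y.1, y.2).
Proof.
have [[s _] _ _ _ _] := gauge_functor F.
apply: (tmap_comp1 _ cG c0 c0 (smooth_orbit0 hX hE y.1) s).
by move=> g; exact: gauge_act0.
Qed.

Let gauge_delta1 (F : gauge_ob E) y : tmap (far F) (delta1 y) = delta1 (far F y.1, y.2).
Proof.
have [[_ s] _ _ _ _] := gauge_functor F.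
apply: (tmap_comp1 _ cS c1 c1 (smooth_orbit1 hX hE y.1) s).
by move=> g; exact: gauge_act1.
Qed.

(** Since (p g)(g^-1 x g) = (p x) g, the orbit map through p g after conjugation by g^-1 is the
    orbit map through p followed by g. *)
Let delta0_act p g B : delta0 (act0 p g, Ad (ginv g) B) = tact0 (delta0 (p, B)) g.
Proof.
have E1 : (gone (xG X), Ad (ginv g) B) =
    tmap (fun x : xG X => gmul (gmul (ginv g) x) (ginv (ginv g))) (gone (xG X), B).
  by congr pair; rewrite /= (gmulg1 gG) (gmulgV gG).
rewrite /delta0 /tact0 [X in tmap _ X]E1.
apply: (tmap_comm ((gone (xG X), B) : tanS (xG X)) cG cG c0 c0
  (smooth_conj (ginv g) (xG_lie hX)) (smooth_orbit0 hX hE (act0 p g))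
  (smooth_orbit0 hX hE p) (smooth_act0 hX hE g)).
move=> x /=; rewrite !(act0M hE) (ginvK gG) !(gmulA gG) (gmulgV gG).
by rewrite (gmul1g gG).
Qed.

Let delta0_linear (n : nat) (w : tanS (ob T) -> eucl n) p : fibre_linear w ->
  linear (fun B : VG => w (delta0 (p, B)) : 'rV[R]_n).
Proof.
move=> lw a u v; rewrite /delta0 /tmap /=.
by rewrite (mder_linear (@act0 R X E p) (gone (xG X))) lw.
Qed.

Let ends_delta (w : grpd_map (tanG T) (lie2 X)) : is_functor w -> respects_ends (compF w (deltaF E)).
Proof.
move=> /functor_ends [es et]; split=> y.
  exact: etrans (es (delta1 y)) (congr1 (fob w) (src_delta y)).
exact: etrans (et (delta1 y)) (congr1 (fob w) (tgt_delta y)).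
Qed.

Let ends_snd : respects_ends (X := X) (sndF T (lie2 X)).
Proof. by split. Qed.

Let connection_natP (w : grpd_map (tanG T) (lie2 X))
    (kappa : ob (prodG T (lie2 X)) -> ar (lie2 X)) : is_functor w ->
  is_nat (compF w (deltaF E)) (sndF T (lie2 X)) kappa <->
  [/\ smooth kappa, forall y, LG (kappa y) = fob w (delta0 y),
    forall y, (dtau (LH (kappa y) : Lie (xH X)) : VG) + fob w (delta0 y) = y.2 &
    forall y : ar (prodG T (lie2 X)),
      LH (kappa (tgt y.1, (dtau (LH y.2 : Lie (xH X)) : VG) + LG y.2)) +
        LH (far w (delta1 y)) = LH y.2 + LH (kappa (src y.1, LG y.2))].
Proof. by move=> hw; exact: (nat_lie2P _ (ends_delta hw) ends_snd). Qed.

Lemma semistrict_pull w (F : gauge_ob E) : is_semistrict E w ->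
  is_semistrict E (compF w (tanF F)).
Proof.
move=> hs; have [fw ow e0 e1 [kappa [/(connection_natP _ fw) [sk s t n] lk ek]]] := hs.
have hq := equivariant_pull hX hE F (semistrict_equivariant hs).
have [fw' ow' e0' e1'] := hq; split=> //.
have [[sF _] ss tt _ _] := gauge_functor F.
(* Gauge automorphisms commute with the fundamental vectors, so [kappa] only needs its base point
   moved by [F]. *)
exists (fun y => kappa (fob F y.1, y.2)); split.
- apply/(connection_natP _ fw'); split.
  + have aL := eucl_atlas (R := R) (dim (xG X)).
    have cP := atlas_charted (prodS_atlas a0 aL).
    have s1 : smooth (fun y : prodS (ob T) (Lie (xG X)) => y.1) by exact: smooth_fst.
    have s2 : smooth (fun y : prodS (ob T) (Lie (xG X)) => y.2) by exact: smooth_snd.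
    exact: (smooth_comp cP cP (smooth_pair cP (smooth_comp cP c0 s1 sF) s2) sk).
  + move=> y; exact: etrans (s _) (congr1 (fob w) (esym (gauge_delta0 F y))).
  + move=> y; have H := t (fob F y.1, y.2).
    exact: etrans (congr1 (fun z => _ + fob w z) (gauge_delta0 F y)) H.
  + move=> y; have H := n (far F y.1, y.2); rewrite /= ss tt in H.
    exact: etrans (congr1 (fun z => _ + LH (far w z)) (gauge_delta1 F y)) H.
- by move=> p; exact: (lk (fob F p)).
- by move=> p g B; rewrite /= gauge_act0 ek.
Qed.

Lemma semistrict_add w u : is_semistrict E w -> is_olam E u ->
  is_semistrict E (addF w u).
Proof.
move=> hs [lam [[sl ll] el] ->].
have hu : is_olam E (olam lam) by exists lam.
have hw := semistrict_equivariant hs.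
have [fw ow e0 e1 [kappa [/(connection_natP _ fw) [sk s t n] lk ek]]] := hs.
have hq := equivariant_add hE hw (olam_equivariant hX hE hu).
have [fw' ow' e0' e1'] := hq; split=> //.
have sld : smooth (lam \o delta0).
  have cP := atlas_charted (prodS_atlas a0 (eucl_atlas (R := R) (dim (xG X)))).
  exact: smooth_comp cP ct0 smooth_delta0 sl.
have slt : smooth (fun y => dtau ((lam \o delta0) y)) by exact: (smooth_dtau sld).
(* The L(H)-component is corrected by -lambda on the fundamental vector; the L(G)-component has to
   grow by tau(lambda), because the source is now the value of [addF w (olam lam)]. *)
exists (fun y => (kappa y : VS) + Lpair (- (lam (delta0 y) : VH)) (dtau (lam (delta0 y)))).
split.
- apply/(connection_natP _ fw'); split.
  + exact (smooth_add sk (smooth_Lpair (smooth_oppv sld) slt)).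
  + by move=> y; rewrite LG_add LG_pair s.
  + move=> y; rewrite LH_add LH_pair dtauD dtauN -[RHS](t y) /= addrACA.
    by rewrite addNr addr0.
  + move=> y; have H := n y.
    pose f a b : VS := Lpair ((lam a : VH) - lam b) (dtau (lam b)).
    have Ef : far (olam lam) (delta1 y) =
        f (delta0 (tgt y.1, (dtau (LH y.2 : Lie (xH X)) : VG) + LG y.2))
          (delta0 (src y.1, LG y.2)).
      exact (congr2 f (tgt_delta y) (src_delta y)).
    rewrite [far (addF _ _) _]/((far w (delta1 y) : VS) + far (olam lam) (delta1 y)).
    by rewrite Ef /f !LH_add !LH_pair addrACA H addKr -addrA.
- move=> p a u' v; rewrite lk.
  have E1 : lam (delta0 (p, a *: u' + v)) =
    a *: (lam (delta0 (p, u')) : VH) + lam (delta0 (p, v)) := delta0_linear p ll a u' v.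
  have E2 (A B : VH) : dtau (a *: A + B : Lie (xH X)) =
    a *: (dtau (A : Lie (xH X)) : VG) + dtau (B : Lie (xH X)) := @dtau_linear R X a A B.
  by rewrite E1 E2 opprD -scalerN -Lpair_add -Lpair_scale scalerDr addrACA.
(* The adjoint action of a unit arrow splits into components; the L(G)-part of the correction agrees
   because tau intertwines alpha_g with [Ad g]. *)
- move=> p g B; rewrite delta0_act el ek (ginv_one1 hX) -[kappa (p, B)]Lpair_eta.
  rewrite !(Ad_one1 hX) !Lpair_add !(Ad_one1 hX) dalphaD AdD dalphaN.
  by rewrite (dtau_dalpha hX).
Qed.
End Connections.

(** * Morphisms of forms *)

Section Zmodules.
Variable V : zmodType.
Implicit Types a b c d : V.

(** An equation [a + b = c + d] is read as a naturality square with composition written additively;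
    here two squares sharing the side [c] are pasted. The next lemmas invert, add and negate such
    squares. *)
Lemma addr_eq_comp a b c d a' c' d' :
  a + b = c + d -> a' + c = c' + d' -> a' + a + b = c' + (d' + d).
Proof. by move=> e e'; rewrite -addrA e addrA e' addrA. Qed.

Lemma addr_eq_inv a b c d : a + b = c + d -> - a + c = b + - d.
Proof. by move=> e; rewrite -[b](addKr a) e addrA addrK. Qed.

Lemma addr_eq_add a b c d a' b' c' d' : a + b = c + d -> a' + b' = c' + d' ->
  (a + a') + (b + b') = (c + c') + (d + d').
Proof. by move=> e e'; rewrite addrACA e e' addrACA. Qed.

Lemma addr_eq_opp a b c d : a + b = c + d -> - a + - b = - c + - d.
Proof. by move=> e; rewrite -!opprD e. Qed.

(** Additive form of the exchange of the two inner factors in a fourfold composite, as in the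
    interchange law. *)
Lemma addr_eq_middle a d b c b' c' : b + c = b' + c' ->
  (a + b) + (c + d) = (a + b') + (c' + d).
Proof. by move=> e; rewrite addrA -[a + b + c]addrA e !addrA. Qed.

Lemma addr_trans a b c a' c' : a + b = c -> a' + c = c' -> (a' + a) + b = c'.
Proof. by move=> e e'; rewrite -addrA e. Qed.
End Zmodules.

(** * L(H)-components of morphisms and their horizontal composites *)

Section Homs.
Context {R : realType} (X : xmod R) (E : bundle_data X).
Hypotheses (hX : is_lie_crossed_module X) (hE : is_principal_2bundle E).
Let T := tot E.
Let VH := 'rV[R]_(dim (xH X)).
Let VG := 'rV[R]_(dim (xG X)).
Let VS := 'rV[R]_(dim (semi X)).
Let hT := tot_groupoid hE.
Let a0 := ob_atlas hT.
Let a1 := ar_atlas hT.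
Let c0 := ob_charted hT.
Let c1 := ar_charted hT.
Let ct0 := tanS_charted a0.
Let ct1 := tanS_charted a1.

Let gs0 (F : gauge_ob E) : smooth (fob F). Proof. by case: (gauge_functor F) => -[]. Qed.
Let gs1 (F : gauge_ob E) : smooth (far F). Proof. by case: (gauge_functor F) => -[]. Qed.
Let gsP (P : gauge_mor E) : smooth (gmap P). Proof. by case: (gmapP P) => -[]. Qed.

Let Wfun := grpd_map (tanG T) (lie2 X).

(* [l] is the L(H)-component of a morphism from [w] to [w']; its             *)
(* L(G)-component is necessarily [fob w].                                    *)
Definition form_hom (w w' : grpd_map (tanG (tot E)) (lie2 X))
    (l : tanS (ob (tot E)) -> Lie (xH X)) : Prop :=
  [/\ smooth l,
      forall x, (dtau (l x) : VG) + fob w x = fob w' x,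
      forall f : tanS (ar (tot E)),
        (l (tmap (@tgt R (tot E)) f) : VH) + LH (far w f) =
        LH (far w' f) + l (tmap (@src R (tot E)) f),
      forall x g, l (tact0 x g) = dalpha (ginv g) (l x) &
      fibre_linear l].

(** The L(G)-component equals [fob w], so its smoothness, equivariance and linearity are inherited
    from [w], and all conditions fall on the L(H)-component. *)
Lemma form_natP (w w' : grpd_map (tanG (tot E)) (lie2 X))
    (th : tanS (ob (tot E)) -> Lie (semi X)) :
  equivariant_functor w -> equivariant_functor w' ->
  [/\ is_nat w w' th,
    forall x g, th (tact0 x g) = Ad (ginv (one1 g)) (th x) & fibre_linear th] <->
  form_hom w w' (fun x => LH (th x)) /\ forall x, LG (th x) = fob w x.
Proof.
move=> [fw [[ow lw] _] ew _] [fw' _ _ _].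
have N := nat_lie2P (Y := tanG T) th (functor_ends fw) (functor_ends fw'); split.
  move=> [/N [s a b n] e l]; split=> //; split=> //.
  - exact: smooth_LH s.
  - move=> x g; rewrite e (ginv_one1 hX) -[th x]Lpair_eta (Ad_one1 hX).
    by rewrite !LH_pair.
  - by move=> p c u v; rewrite l LH_add LH_scale.
move=> [[s b n e l] a]; have Eth : th = fun x => Lpair (LH (th x)) (fob w x).
  by apply/funext => x; rewrite -a Lpair_eta.
split.
- apply/N; split=> //; rewrite Eth.
  by case: fw => -[sw _] _ _ _ _; exact: (smooth_Lpair s sw).
- move=> x g; rewrite (ginv_one1 hX) -[th x]Lpair_eta (Ad_one1 hX).
  have E2 := etrans (a (tact0 x g)) (ew x g); rewrite -(a x) in E2.
  exact (etrans (esym (Lpair_eta _)) (congr2 (@Lpair R X) (e x g) E2)).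
- exact (eq_ind_r (fun h : tanS (ob (tot E)) -> Lie (semi X) => fibre_linear h)
    (fibre_linear_Lpair l lw) Eth).
Qed.

Lemma form_hom_id w : form_hom w w (fun=> (0 : VH)).
Proof.
split.
- exact: smooth_cst _ (tanS_atlas a0).
- by move=> x; rewrite dtau0 add0r.
- by move=> f; rewrite add0r addr0.
- by move=> x g; rewrite dalpha0.
- by move=> p c u v; rewrite scaler0 addr0.
Qed.

Lemma form_hom_comp w w' w'' l l' : form_hom w w' l -> form_hom w' w'' l' ->
  form_hom w w'' (fun x => (l' x : VH) + l x).
Proof.
move=> [s b n e i] [s' b' n' e' i']; split.
- exact: smooth_add.
- move=> x; exact (etrans (congr1 (fun z : VG => z + _) (dtauD _ _))
    (addr_trans (b x) (b' x))).
- move=> f; exact (addr_eq_comp (n f) (n' f)).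
- by move=> x g; rewrite e e' dalphaD.
- exact: fibre_linear_add.
Qed.

Lemma form_hom_inv w w' l : form_hom w w' l -> form_hom w' w (fun x => - (l x : VH)).
Proof.
move=> [s b n e i]; split.
- exact: smooth_oppv.
- by move=> x; rewrite -b dtauN addKr.
- move=> f; exact (addr_eq_inv (n f)).
- by move=> x g; rewrite e dalphaN.
- exact: fibre_linear_opp.
Qed.

Lemma form_hom_add w w' v v' l l' : form_hom w w' l -> form_hom v v' l' ->
  form_hom (addF w v) (addF w' v') (fun x => (l x : VH) + l' x).
Proof.
move=> [s b n e i] [s' b' n' e' i']; split.
- exact: smooth_add.
- move=> x; exact (etrans (congr1 (fun z : VG => z + _) (dtauD _ _))
    (etrans (addrACA _ _ _ _) (congr2 (fun y z : VG => y + z) (b x) (b' x)))).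
- move=> f; exact (etrans (congr1 (fun z : VH => _ + z) (LH_add _ _))
    (etrans (addr_eq_add (n f) (n' f))
      (congr1 (fun z : VH => z + _) (esym (LH_add _ _))))).
- by move=> x g; rewrite e e' dalphaD.
- exact: fibre_linear_add.
Qed.

Lemma LH_opp (a : VS) : LH (- a : VS) = - LH a :> VH.
Proof. exact: linearN. Qed.

Lemma form_hom_opp w w' l : form_hom w w' l ->
  form_hom (oppF w) (oppF w') (fun x => - (l x : VH)).
Proof.
move=> [s b n e i]; split.
- exact: smooth_oppv.
- by move=> x; rewrite /= dtauN -opprD b.
- move=> f; exact (etrans (congr1 (fun z : VH => _ + z) (LH_opp _))
    (etrans (addr_eq_opp (n f)) (congr1 (fun z : VH => z + _) (esym (LH_opp _))))).
- by move=> x g; rewrite e dalphaN.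
- exact: fibre_linear_opp.
Qed.

(* If [l] is the L(H)-component of a morphism out of [w], this is the one of *)
(* its horizontal composite with the differential of [P].                    *)
Definition pull_hom (l : tanS (ob (tot E)) -> VH) (w : grpd_map (tanG (tot E)) (lie2 X))
    (P : gauge_mor E) (x : tanS (ob (tot E))) : VH :=
  l (tmap (fob (gcod P)) x) + LH (far w (tmap (gmap P) x)).

Let src_gmap (P : gauge_mor E) x :
  tmap (@src R T) (tmap (gmap P) x) = tmap (fob (gdom P)) x.
Proof. exact: (tmap_comp1 x c0 c1 c0 (gsP P) (smooth_src hT) (gsrcP P)). Qed.

Let tgt_gmap (P : gauge_mor E) x :
  tmap (@tgt R T) (tmap (gmap P) x) = tmap (fob (gcod P)) x.
Proof. exact: (tmap_comp1 x c0 c1 c0 (gsP P) (smooth_tgt hT) (gtgtP P)). Qed.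

Let far_comp (w : Wfun) g f h : is_functor w -> composite (X := tanG T) g f h ->
  LH (far w h) = LH (far w g) + LH (far w f).
Proof. by move=> /(tan_functor_lie2P hE) [_ _ _ H] /H. Qed.

Lemma form_hom_pull w w' l (P : gauge_mor E) :
  equivariant_functor w -> equivariant_functor w' -> form_hom w w' l ->
  form_hom (compF w (tanF (gdom P))) (compF w' (tanF (gcod P))) (pull_hom l w P).
Proof.
move=> [fw [ow0 [sw lw]] e0 e1] [fw' _ _ _] [s b n e i].
have [ws wt] := functor_ends fw.
split.
- apply: smooth_add; first exact: smooth_comp ct0 ct0 (smooth_tmap a0 a0 (gs0 _)) s.
  have H := smooth_comp ct0 ct1 (smooth_tmap a0 a1 (gsP P)) sw.
  exact: (smooth_LH H).
- move=> x; have Es : fob w (tmap (fob (gdom P)) x) = LG (far w (tmap (gmap P) x)).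
    exact: etrans (congr1 (fob w) (esym (src_gmap P x))) (esym (ws _)).
  have Et := etrans (wt (tmap (gmap P) x)) (congr1 (fob w) (tgt_gmap P x)).
  exact (etrans (congr2 (fun y z : VG => y + z) (dtauD _ _) Es) (addr_trans Et (b _))).
- move=> f; have [h [h1 h2]] := tan_natural hT hT f (gauge_functor (gdom P))
    (gauge_functor (gcod P)) (let: And3 a _ _ := gmapP P in a).
  have n1 := n (tmap (far (gcod P)) f).
  have Et := congr1 l (tmap_tgt_far hE (gcod P) f).
  have Es := congr1 l (tmap_src_far hE (gcod P) f).
  have H := etrans (esym (far_comp fw h1)) (far_comp fw h2).
  have n2 := etrans (congr1 (fun z : VH => z + _) (esym Et))
    (etrans n1 (congr1 (fun z : VH => _ + z) Es)).
  (* [H] is the image under [w] of the differentiated naturality square of [P], and [n2] is the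
     square of [l] at the image of [f] under the target of [P]; they are pasted along that image. *)
  exact (addr_eq_comp H n2).
- move=> x g; rewrite /pull_hom.
  have E1 : l (tmap (fob (gcod P)) (tact0 x g)) =
      dalpha (ginv g) (l (tmap (fob (gcod P)) x)).
    exact: etrans (congr1 l (tmap_gauge_tact0 hX hE (gcod P) x g)) (e _ _).
  have sq : tmap (gmap P) (tact0 x g) = tact1 (tmap (gmap P) x) (one1 g).
    apply: (tmap_comm x c0 c0 c1 c1 (smooth_act0 hX hE g) (gsP P) (gsP P)
      (smooth_act1 hX hE (one1 g))).
    by case: (gmapP P) => _ H _ p; exact: H.
  have E2 := etrans (congr1 (far w) sq) (e1 _ _).
  have H (z : Lie (semi X)) : LH (Ad (ginv (one1 g)) z) = dalpha (ginv g) (LH z).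
    by rewrite (ginv_one1 hX) -{1}[z]Lpair_eta (Ad_one1 hX) LH_pair.
  exact (etrans (congr2 (fun y z : VH => y + z) E1 (etrans (congr1 (@LH R X) E2) (H _)))
    (esym (dalphaD _ _ _))).
- have L1 := fibre_linear_tmap (fob (gcod P)) i.
  have L2 := fibre_linear_tmap (gmap P) lw.
  have L3 : fibre_linear (fun x => LH (far w (tmap (gmap P) x)) : eucl (dim (xH X))).
    by move=> p c u v; have /= -> := L2 p c u v; rewrite LH_add LH_scale.
  exact: (fibre_linear_add L1 L3).
Qed.

Lemma tmap_fob_mul (F F' : gauge_ob E) x :
  tmap (fob (gauge_mul hE F F')) x = tmap (fob F) (tmap (fob F') x).
Proof. exact: (tmap_comp x c0 c0 c0 (gs0 F') (gs0 F)). Qed.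

Lemma tmap_far_mul (F F' : gauge_ob E) x :
  tmap (far (gauge_mul hE F F')) x = tmap (far F) (tmap (far F') x).
Proof. exact: (tmap_comp x c1 c1 c1 (gs1 F') (gs1 F)). Qed.

Lemma LH_far_gc (w : grpd_map (tanG (tot E)) (lie2 X)) (a b : ob (tot E) -> ar (tot E)) x : is_functor w ->
  smooth a -> smooth b -> (forall z, tgt (b z) = src (a z)) ->
  LH (far w (tmap (fun z => gc (a z) (b z)) x)) =
  LH (far w (tmap a x)) + LH (far w (tmap b x)) :> VH.
Proof.
move=> fw sa sb e; apply: (far_comp fw).
exact: (tangent_gc hT x (ob_manifold hT) sa sb e).
Qed.

(** At a point the product P P' is a composite of a value of P with the image of a value of P'. The
    functor [w] turns its differential into a sum, and regrouping shows that pulling back is a right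
    action. *)
Lemma pull_hom_mul l w (P P' : gauge_mor E) x : is_functor w ->
  pull_hom l w (gmor_mul hX hE P P') x =
  pull_hom (pull_hom l w P) (compF w (tanF (gdom P))) P' x.
Proof.
move=> fw; rewrite /pull_hom.
have E1 := congr1 l (tmap_fob_mul (gcod P) (gcod P') x).
have e z : tgt (far (gdom P) (gmap P' z)) = src (gmap P (fob (gcod P') z)).
  by case: (gauge_functor (gdom P)) => _ _ -> _ _; rewrite gtgtP gsrcP.
have sa := smooth_comp c0 c0 (gs0 (gcod P')) (gsP P).
have sb := smooth_comp c0 c1 (gsP P') (gs1 (gdom P)).
have E2 := LH_far_gc x fw sa sb e.
have E3 := congr1 (fun z : tanS (ar T) => LH (far w z)) (tmap_comp x c0 c0 c1 (gs0 (gcod P')) (gsP P)).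
have E4 := congr1 (fun z : tanS (ar T) => LH (far w z)) (tmap_comp x c0 c1 c1 (gsP P') (gs1 (gdom P))).
have E5 := etrans E2 (congr2 (fun z z' : VH => z + z') E3 E4).
exact: etrans (congr2 (fun z z' : VH => z + z') E1 E5) (addrA _ _ _).
Qed.

(** The additional term vanishes, as functors send units to arrows with zero L(H)-component. *)
Lemma pull_hom_id l w (F : gauge_ob E) x : is_functor w ->
  pull_hom l w (gmor_id hE F) x = l (tmap (fob F) x).
Proof.
move=> /(tan_functor_lie2P hE) [_ _ H _]; rewrite /pull_hom /=.
have E1 := tmap_comp x c0 c0 c1 (gs0 F) (smooth_unit1 hT).
have E2 := congr1 (fun z : tanS (ar T) => LH (far w z)) E1.
have E3 := etrans E2 (congr1 (@LH R X) (H _)); rewrite LH_pair in E3.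
exact: etrans (congr1 (fun z : VH => _ + z) E3) (addr0 _).
Qed.

Lemma pull_hom_add l l' w w' (P : gauge_mor E) x :
  pull_hom (fun y => (l y : VH) + l' y) (addF w w') P x =
  pull_hom l w P x + pull_hom l' w' P x.
Proof. by rewrite /pull_hom /= LH_add addrACA. Qed.

(* Interchange law: the naturality of [l] along the arrow [P x] moves [P] past [l]. *)
Lemma pull_hom_comp w w' l l' (P P' : gauge_mor E) (e : gcod P = gdom P') x :
  is_functor w -> form_hom w w' l ->
  pull_hom (fun y => (l' y : VH) + l y) w (gmor_comp hX hE e) x =
  pull_hom l' w' P' x + pull_hom l w P x.
Proof.
move=> fw [_ _ n _ _]; rewrite /pull_hom /=.
have e' z : tgt (gmap P z) = src (gmap P' z) by rewrite gtgtP gsrcP e.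
have E1 := LH_far_gc x fw (gsP P') (gsP P) e'.
have N := n (tmap (gmap P') x).
have Et := congr1 l (tgt_gmap P' x).
have Es := congr1 l (src_gmap P' x); rewrite -e in Es.
have N' := etrans (congr1 (fun z : VH => z + _) (esym Et))
  (etrans N (congr1 (fun z : VH => _ + z) Es)).
apply: etrans (congr1 (fun z : VH => _ + z) E1) _.
exact (addr_eq_middle _ _ N').
Qed.
End Homs.

(** * Semidirect products *)

Section Semidirect.
Variables (K A : Type) (km : K -> K -> K) (k1 : K) (kv : K -> K).
Variables (am : A -> A -> A) (a0 : A) (av : A -> A) (act : A -> K -> A).
Hypotheses (gK : is_group km k1 kv) (gA : is_group am a0 av).
Hypothesis actM : forall a k l, act (act a k) l = act a (km k l).
Hypothesis act1 : forall a, act a k1 = a.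
Hypothesis actD : forall a b k, act (am a b) k = am (act a k) (act b k).

(** The right action [act] enters through the inverse, which makes it a left action: (k, a)(l, b) =
    (k l, a + b.k^-1). Accordingly the inverse of (k, a) involves a.k without inversion. *)
Definition sd_mul (x y : K * A) := (km x.1 y.1, am x.2 (act y.2 (kv x.1))).
Definition sd_one := (k1, a0).
Definition sd_inv (x : K * A) := (kv x.1, av (act x.2 x.1)).

Let kvK k : kv (kv k) = k.
Proof.
by case: gK => m l r v w; rewrite -[LHS]r -(v k) m v l.
Qed.

Let kv1 : kv k1 = k1.
Proof. by case: gK => m l r v w; rewrite -[LHS]r v. Qed.

Let kvM k l : kv (km k l) = km (kv l) (kv k).
Proof.
case: gK => m l1 r v w.
rewrite -[LHS]r -[X in km _ X](w k) -[X in km _ (km X _)]r -(w l).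
by rewrite !m -[km (km (kv _) k) l]m v l1.
Qed.

Let act0 k : act a0 k = a0.
Proof.
case: gA => m l r v w; have e := actD a0 a0 k; rewrite l in e.
by have /esym := congr1 (am (av (act a0 k))) e; rewrite m v l.
Qed.

Let actN a k : act (av a) k = av (act a k).
Proof.
case: gA => m l r v w; rewrite -[LHS]r -(w (act a k)) m -actD v act0 l //.
Qed.

Lemma sd_group : is_group sd_mul sd_one sd_inv.
Proof.
case: (gK) => m l r v w; case: (gA) => m' l' r' v' w'.
split=> [[k a] [k' a'] [k'' a'']|[k a]|[k a]|[k a]|[k a]]; rewrite /sd_mul /sd_inv /sd_one /=.
- by rewrite m kvM actD actM m'.
- by rewrite l kv1 act1 l'.
- by rewrite r act0 r'.
- by rewrite v kvK v'.
- by rewrite w actN actM w act1 w'.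
Qed.

Variables (W : Type) (wa : W -> A -> W) (wp : W -> K -> W).
Hypothesis amC : forall a b, am a b = am b a.
Hypothesis wpM : forall w k l, wp (wp w k) l = wp w (km k l).
Hypothesis wp1 : forall w, wp w k1 = w.
Hypothesis waA : forall w a b, wa (wa w a) b = wa w (am a b).
Hypothesis wa0 : forall w, wa w a0 = w.
Hypothesis wpD : forall w a k, wp (wa w a) k = wa (wp w k) (act a k).

Definition sd_act (x : K * A) (w : W) := wa (wp w (kv x.1)) x.2.

Lemma sd_act1 w : sd_act sd_one w = w.
Proof. by rewrite /sd_act /= kv1 wp1 wa0. Qed.

(** With x = (k, a) and y = (l, b), one side adds a and then b.k^-1, the other the reverse; this is
    where commutativity of [A] enters. *)
Lemma sd_actM x y w : sd_act (sd_mul x y) w = sd_act x (sd_act y w).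
Proof. by rewrite /sd_act /= kvM wpD wpM waA amC. Qed.
End Semidirect.

(** * Categories of forms *)

Section FormCategory.
Context {R : realType} (X : xmod R) (E : bundle_data X).
Hypotheses (hX : is_lie_crossed_module X) (hE : is_principal_2bundle E).
Variable P : grpd_map (tanG (tot E)) (lie2 X) -> Prop.
Hypothesis PQ : forall w, P w -> equivariant_functor w.

Definition hom_part (a : form_mor P) (x : tanS (ob (tot E))) : Lie (xH X) := LH (wmap a x).

Let obQ (w : form_ob P) : equivariant_functor w. Proof. exact: PQ (wfunP w). Qed.

Lemma hom_partP a : form_hom (wdom a) (wcod a) (hom_part a).
Proof. exact (proj1 ((form_natP hX (wmap a) (obQ (wdom a)) (obQ (wcod a))).1 (wmapP a))). Qed.

Lemma LG_wmap (a : form_mor P) x : LG (wmap a x) = fob (wdom a) x.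
Proof. exact: ((form_natP hX _ (obQ (wdom a)) (obQ (wcod a))).1 (wmapP a)).2. Qed.

Lemma wmapE (a : form_mor P) x : wmap a x = Lpair (hom_part a x) (fob (wdom a) x).
Proof. by rewrite -(LG_wmap a x) Lpair_eta. Qed.

Lemma form_ob_eq (w w' : form_ob P) : wfun w = wfun w' -> w = w'.
Proof.
case: w => f p; case: w' => f' p' /= e.
by subst f'; congr FormOb; exact: Prop_irrelevance.
Qed.

(** The L(G)-component is dictated by the source, so ends and L(H)-component determine a morphism.
    This reduces the laws for morphisms to laws for objects and identities in L(H). *)
Lemma form_mor_eq (a b : form_mor P) : wdom a = wdom b -> wcod a = wcod b ->
  (forall x, hom_part a x = hom_part b x) -> a = b.
Proof.
move=> ed ec eh; have em : wmap a = wmap b.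
  by apply/funext => x; rewrite !wmapE eh ed.
case: a b ed ec em {eh} => [d c m p] [d' c' m' p'] /= ed ec em.
by subst d' c' m'; congr FormMor; exact: Prop_irrelevance.
Qed.

Lemma mk_form_mor_proof (w w' : form_ob P) l (h : form_hom w w' l) :
  [/\ is_nat w w' (fun x => Lpair (l x) (fob w x)),
    forall x g, Lpair (l (tact0 x g)) (fob w (tact0 x g)) =
      Ad (ginv (one1 g)) (Lpair (l x) (fob w x)) &
    fibre_linear (fun x => Lpair (l x) (fob w x) : Lie (semi X))].
Proof.
apply: (form_natP hX (fun x => Lpair (l x) (fob w x)) (obQ w) (obQ w')).2.
split; last by move=> x; rewrite LG_pair.
suff -> : (fun x => LH (Lpair (l x) (fob w x))) = l by [].
by apply/funext => x; rewrite LH_pair.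
Qed.

Definition mk_form_mor (w w' : form_ob P) l (h : form_hom w w' l) : form_mor P :=
  FormMor (mk_form_mor_proof h).

Lemma hom_part_mk (w w' : form_ob P) l (h : form_hom w w' l) x :
  hom_part (mk_form_mor h) x = l x.
Proof. exact: LH_pair. Qed.

Definition form_id (w : form_ob P) : form_mor P := mk_form_mor (form_hom_id hE w).

Definition form_comp (g f : form_mor P) (e : wcod f = wdom g) : form_mor P :=
  mk_form_mor (form_hom_comp (hom_partP f)
    (eq_rect_r (fun w : form_ob P => form_hom w (wcod g) (hom_part g)) (hom_partP g) e)).

Definition form_vinv (f : form_mor P) : form_mor P :=
  mk_form_mor (form_hom_inv (hom_partP f)).

Definition form_category : category (@wdom _ _ _ P) (@wcod _ _ _ P).
Proof.
refine (@Category _ _ _ _ form_id form_comp _ _ _ _ _ _ _) => //.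
- by move=> f e; apply: form_mor_eq => // x; rewrite !hom_part_mk add0r.
- by move=> f e; apply: form_mor_eq => // x; rewrite !hom_part_mk addr0.
- by move=> h g f gf hg e e'; apply: form_mor_eq => // x; rewrite !hom_part_mk addrA.
Defined.

Lemma form_vertical : vertical (@wfun _ _ _ P) (@wmap _ _ _ P) form_category.
Proof.
split=> // g f e p; apply/lie2_composite; rewrite LG_wmap; split.
  have [_ b _ _ _] := hom_partP f.
  by rewrite LG_wmap -e; exact: b.
by rewrite wmapE; congr Lpair; exact: hom_part_mk.
Qed.

Lemma form_vcomp_inv (f : form_mor P) : exists g e e',
    vcomp form_category (g := g) (f := f) e = form_id (wdom f) /\
    vcomp form_category (g := f) (f := g) e' = form_id (wcod f).
Proof.
exists (form_vinv f), erefl, erefl.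
by split; apply: form_mor_eq => // x; rewrite !hom_part_mk ?addrN ?addNr.
Qed.
End FormCategory.

(** * Sums and pullbacks of forms *)

Section FormOperations.
Context {R : realType} (X : xmod R) (E : bundle_data X).
Hypotheses (hX : is_lie_crossed_module X) (hE : is_principal_2bundle E).
Let VH := 'rV[R]_(dim (xH X)).
Variable P : grpd_map (tanG (tot E)) (lie2 X) -> Prop.
Hypothesis PQ : forall w, P w -> equivariant_functor w.
Hypothesis PA : forall w u, P w -> is_olam E u -> P (addF w u).
Hypothesis PP : forall w (F : gauge_ob E), P w -> P (compF w (tanF F)).

(** With [P] taken as [is_olam] this is the group law on forms; with [is_semistrict] it is the
    translation part of the action on connections. *)
Definition add_ob (w : form_ob P) (u : form_ob (is_olam E)) : form_ob P :=
  FormOb (PA (wfunP w) (wfunP u)).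

Definition pull_ob (w : form_ob P) (F : gauge_ob E) : form_ob P :=
  FormOb (PP F (wfunP w)).

Definition add_mor (a : form_mor P) (t : form_mor (is_olam E)) : form_mor P :=
  @mk_form_mor _ _ _ hX _ PQ (add_ob (wdom a) (wdom t)) (add_ob (wcod a) (wcod t)) _
    (form_hom_add (hom_partP hX PQ a) (hom_partP hX (olam_equivariant hX hE) t)).

Definition pull_mor (a : form_mor P) (Q : gauge_mor E) : form_mor P :=
  @mk_form_mor _ _ _ hX _ PQ (pull_ob (wdom a) (gdom Q)) (pull_ob (wcod a) (gcod Q)) _
    (form_hom_pull hX hE Q (PQ (wfunP (wdom a))) (PQ (wfunP (wcod a))) (hom_partP hX PQ a)).

Lemma hom_part_add a t :
  hom_part (add_mor a t) = fun x => (hom_part a x : VH) + hom_part t x.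
Proof. by apply/funext => x; exact: hom_part_mk. Qed.

Lemma hom_part_pull a Q : hom_part (pull_mor a Q) = pull_hom (hom_part a) (wdom a) Q.
Proof. by apply/funext => x; exact: hom_part_mk. Qed.

Lemma hom_part_id w : hom_part (form_id hX hE PQ w) = fun=> (0 : VH).
Proof. by apply/funext => x; exact: hom_part_mk. Qed.

Lemma hom_part_comp g f e :
  hom_part (@form_comp _ _ _ hX _ PQ g f e) = fun x => (hom_part g x : VH) + hom_part f x.
Proof. by apply/funext => x; exact: hom_part_mk. Qed.

Lemma wmap_add a t : wmap (add_mor a t) = addN (wmap a) (wmap t).
Proof.
apply/funext => x; rewrite /addN (wmapE hX PQ) hom_part_add (wmapE hX PQ a).
by rewrite (wmapE hX (olam_equivariant hX hE) t) Lpair_add.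
Qed.

(** Identifies the pulled-back morphism, constructed from its L(H)-component, with the horizontal
    composite: the ends match, the L(H)-components add up, and the source is that of the
    differential of [Q] under the functor [wdom a]. *)
Lemma pull_hcomp a Q : is_hcomp (wdom a) (wmap a) (tanF (gcod Q))
  (tmap (gmap Q)) (wmap (pull_mor a Q)).
Proof.
move=> x; have [fw _ _ _] := PQ (wfunP (wdom a)); have [es et] := functor_ends fw.
have c0 := ob_charted (tot_groupoid hE); have c1 := ar_charted (tot_groupoid hE).
have sQ : smooth (gmap Q) by case: (gmapP Q) => -[].
have Es := tmap_comp1 x c0 c1 c0 sQ (smooth_src (tot_groupoid hE)) (gsrcP Q).
have Et := tmap_comp1 x c0 c1 c0 sQ (smooth_tgt (tot_groupoid hE)) (gtgtP Q).
apply/lie2_composite; split.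
  exact (etrans (et (tmap (gmap Q) x)) (etrans (congr1 (fob (wdom a)) Et)
    (esym (LG_wmap hX PQ a _)))).
rewrite (wmapE hX PQ) hom_part_pull.
exact (congr1 (Lpair _) (etrans (congr1 (fob (wdom a)) (esym Es))
  (esym (es (tmap (gmap Q) x))))).
Qed.

Lemma add_mor_id w u : add_mor (form_id hX hE PQ w)
  (form_id hX hE (olam_equivariant hX hE) u) = form_id hX hE PQ (add_ob w u).
Proof.
apply: (form_mor_eq hX PQ); [by []|by []|move=> x].
by rewrite hom_part_add !hom_part_id (hom_part_mk hX) addr0.
Qed.

Lemma pull_mor_id w F : pull_mor (form_id hX hE PQ w) (gmor_id hE F) =
  form_id hX hE PQ (pull_ob w F).
Proof.
have [fw _ _ _] := PQ (wfunP w).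
apply: (form_mor_eq hX PQ); [by []|by []|move=> x].
by rewrite hom_part_pull !hom_part_id (pull_hom_id hE).
Qed.

Lemma add_mor_comp g f e t s e' e'' :
  add_mor (@form_comp _ _ _ hX _ PQ g f e)
    (@form_comp _ _ _ hX _ (olam_equivariant hX hE) t s e') =
  @form_comp _ _ _ hX _ PQ (add_mor g t) (add_mor f s) e''.
Proof.
apply: (form_mor_eq hX PQ); [by []|by []|move=> x].
rewrite hom_part_add !hom_part_comp !hom_part_add (hom_part_mk hX).
exact: addrACA.
Qed.

Lemma pull_mor_comp g f e (Q Q' : gauge_mor E) e' e'' :
  pull_mor (@form_comp _ _ _ hX _ PQ g f e) (@gmor_comp _ _ _ hX hE Q' Q e') =
  @form_comp _ _ _ hX _ PQ (pull_mor g Q') (pull_mor f Q) e''.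
Proof.
have [fw _ _ _] := PQ (wfunP (wdom f)).
apply: (form_mor_eq hX PQ); [by []|by []|move=> x].
rewrite hom_part_pull !hom_part_comp !hom_part_pull -e.
exact: (pull_hom_comp hX hE _ e' x fw (hom_partP hX PQ f)).
Qed.
End FormOperations.

(** * The extended gauge 2-group *)

Section Laws.
Context {R : realType} (X : xmod R) (E : bundle_data X).
Hypotheses (hX : is_lie_crossed_module X) (hE : is_principal_2bundle E).
Let VH := 'rV[R]_(dim (xH X)).

Let addO := add_ob (@olam_add R X E).
Let pullO := pull_ob (olam_pull hX hE).
Let OQ := olam_equivariant hX hE.
Let addM := add_mor hX hE OQ (@olam_add R X E).
Let pullM := pull_mor hX hE OQ (olam_pull hX hE).

Definition zero_ob : form_ob (is_olam E) := FormOb (olam0 hE).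
Definition opp_ob (u : form_ob (is_olam E)) : form_ob (is_olam E) :=
  FormOb (olam_opp (wfunP u)).
Definition zero_mor : form_mor (is_olam E) := form_id hX hE OQ zero_ob.
Definition opp_mor (t : form_mor (is_olam E)) : form_mor (is_olam E) :=
  @mk_form_mor _ _ _ hX _ OQ (opp_ob (wdom t)) (opp_ob (wcod t)) _
    (form_hom_opp (hom_partP hX OQ t)).

Let addOC u v : addO u v = addO v u.
Proof.
by apply: form_ob_eq; apply: grpd_map_eq => x /=; exact: addrC.
Qed.

Let addOP : is_group addO zero_ob opp_ob.
Proof.
split=> [u v w|u|u|u|u]; apply: form_ob_eq; apply: grpd_map_eq => x /=.
- exact: addrA.
- exact: addrA.
- exact: add0r.
- exact: add0r.
- exact: addr0.
- exact: addr0.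
- exact: addNr.
- exact: addNr.
- exact: addrN.
- exact: addrN.
Qed.

Let addMC s t : addM s t = addM t s.
Proof.
apply: (form_mor_eq hX OQ); [exact: addOC|exact: addOC|move=> x].
rewrite !hom_part_add; exact: addrC.
Qed.

Let hom_part_opp t : hom_part (opp_mor t) = fun x => - (hom_part t x : VH).
Proof. by apply/funext => x; exact: hom_part_mk. Qed.

Let addMP : is_group addM zero_mor opp_mor.
Proof.
have [m l r v w] := addOP.
split=> [s t u|t|t|t|t]; apply: (form_mor_eq hX OQ).
- exact: m.
- exact: m.
- by move=> x; rewrite !hom_part_add; exact: addrA.
- exact: l.
- exact: l.
- by move=> x; rewrite hom_part_add hom_part_id; exact: add0r.
- exact: r.
- exact: r.
- by move=> x; rewrite hom_part_add hom_part_id; exact: addr0.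
- exact: v.
- exact: v.
- by move=> x; rewrite hom_part_add hom_part_id hom_part_opp; exact: addNr.
- exact: w.
- exact: w.
- by move=> x; rewrite hom_part_add hom_part_id hom_part_opp; exact: addrN.
Qed.

Section Predicate.
Variable P : grpd_map (tanG (tot E)) (lie2 X) -> Prop.
Hypothesis PQ : forall w, P w -> equivariant_functor w.
Hypothesis PA : forall w u, P w -> is_olam E u -> P (addF w u).
Hypothesis PP : forall w (F : gauge_ob E), P w -> P (compF w (tanF F)).

Lemma add_obA w u v : add_ob PA (add_ob PA w u) v = add_ob PA w (addO u v).
Proof.
by apply: form_ob_eq; apply: grpd_map_eq => x /=; exact: esym (addrA _ _ _).
Qed.

Lemma add_ob0 w : add_ob PA w zero_ob = w.
Proof. by apply: form_ob_eq; apply: grpd_map_eq => x /=; exact: addr0. Qed.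

Lemma pull_ob_mul w F F' : pull_ob PP (pull_ob PP w F) F' = pull_ob PP w (gauge_mul hE F F').
Proof.
apply: form_ob_eq; apply: grpd_map_eq => x /=.
  exact (congr1 (fob w) (esym (tmap_fob_mul hE F F' x))).
exact (congr1 (far w) (esym (tmap_far_mul hE F F' x))).
Qed.

Lemma pull_ob1 w : pull_ob PP w (gauge_id hE) = w.
Proof.
have a0 := ob_atlas (tot_groupoid hE); have a1 := ar_atlas (tot_groupoid hE).
apply: form_ob_eq; apply: grpd_map_eq => x /=.
  exact (congr1 (fob w) (tmap_id x a0)).
exact (congr1 (far w) (tmap_id x a1)).
Qed.

Lemma pull_ob_add w u F : pull_ob PP (add_ob PA w u) F =
  add_ob PA (pull_ob PP w F) (pullO u F).
Proof. by apply: form_ob_eq; apply: grpd_map_eq. Qed.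

Lemma add_morA a s t : add_mor hX hE PQ PA (add_mor hX hE PQ PA a s) t =
  add_mor hX hE PQ PA a (addM s t).
Proof.
apply: (form_mor_eq hX PQ); [exact: add_obA|exact: add_obA|move=> x].
by rewrite !hom_part_add; exact: esym (addrA _ _ _).
Qed.

Lemma add_mor0 a : add_mor hX hE PQ PA a zero_mor = a.
Proof.
apply: (form_mor_eq hX PQ); [exact: add_ob0|exact: add_ob0|move=> x].
by rewrite hom_part_add hom_part_id; exact: addr0.
Qed.

Lemma pull_mor_mul a Q Q' : pull_mor hX hE PQ PP (pull_mor hX hE PQ PP a Q) Q' =
  pull_mor hX hE PQ PP a (gmor_mul hX hE Q Q').
Proof.
have [fw _ _ _] := PQ (wfunP (wdom a)).
apply: (form_mor_eq hX PQ); [exact: pull_ob_mul|exact: pull_ob_mul|move=> x].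
rewrite !hom_part_pull; exact (esym (pull_hom_mul hX hE _ Q Q' x fw)).
Qed.

Lemma pull_mor1 a : pull_mor hX hE PQ PP a (gmor_one hE) = a.
Proof.
have [fw _ _ _] := PQ (wfunP (wdom a)).
apply: (form_mor_eq hX PQ); [exact: pull_ob1|exact: pull_ob1|move=> x].
rewrite hom_part_pull; apply: etrans (pull_hom_id hE _ _ _ fw) _.
exact (congr1 (hom_part a) (tmap_id x (ob_atlas (tot_groupoid hE)))).
Qed.

Lemma pull_mor_add a t Q : pull_mor hX hE PQ PP (add_mor hX hE PQ PA a t) Q =
  add_mor hX hE PQ PA (pull_mor hX hE PQ PP a Q) (pullM t Q).
Proof.
apply: (form_mor_eq hX PQ); [exact: pull_ob_add|exact: pull_ob_add|move=> x].
rewrite hom_part_add !hom_part_pull hom_part_add; exact: pull_hom_add.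
Qed.
End Predicate.

(** * Inversion in the gauge 2-group, the extension and its action *)

Let gO := gauge_mulP hE.
Let gM := gmor_mulP hX hE.

Let CG := gauge_category hX hE.
Let CL := form_category hX hE OQ.
Let GE := gauge_2group hX hE.

Definition ext_ob_mul := sd_mul (gauge_mul hE) (@gauge_inv R X E) addO pullO.
Definition ext_mor_mul := sd_mul (gmor_mul hX hE) (gmor_inv hX hE) addM pullM.

Lemma ext_obP : is_group ext_ob_mul (sd_one (gauge_id hE) zero_ob)
  (sd_inv (@gauge_inv R X E) opp_ob pullO).
Proof.
apply: sd_group gO addOP _ _ _.
- exact: pull_ob_mul.
- exact: pull_ob1.
- exact: pull_ob_add.
Qed.

Lemma ext_morP : is_group ext_mor_mul (sd_one (gmor_one hE) zero_mor)
  (sd_inv (gmor_inv hX hE) opp_mor pullM).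
Proof.
apply: sd_group gM addMP _ _ _.
- exact: pull_mor_mul.
- exact: pull_mor1.
- exact: pull_mor_add.
Qed.

Lemma gmor_inv_uniq Q Q' : gmor_mul hX hE Q Q' = gmor_one hE -> Q' = gmor_inv hX hE Q.
Proof.
have [A l r v _] := gM.
by move=> e; rewrite -(l Q') -(v Q) -A e r.
Qed.

(** Forming identities is multiplicative, so the identity of the inverse is an inverse of the
    identity, and inverses are unique. *)
Lemma gmor_inv_id F : gmor_inv hX hE (gmor_id hE F) = gmor_id hE (gauge_inv F).
Proof.
have [_ _ _ _ w] := gO.
have e : gmor_mul hX hE (gmor_id hE F) (gmor_id hE (gauge_inv F)) = gmor_one hE.
  exact (etrans (esym (idm_mul GE F (gauge_inv F))) (congr1 (gmor_id hE) (w F))).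
exact: esym (gmor_inv_uniq e).
Qed.

(** By interchange, the product of the composite of g and f with the composite of g^-1 and f^-1 is
    the composite of g g^-1 and f f^-1, both equal to the unit; uniqueness of inverses concludes. *)
Lemma gmor_inv_comp g f e e' : gmor_inv hX hE (@gmor_comp _ _ _ hX hE g f e) =
  @gmor_comp _ _ _ hX hE (gmor_inv hX hE g) (gmor_inv hX hE f) e'.
Proof.
have [_ _ _ _ w] := gM.
have e2 : gcod (gmor_mul hX hE f (gmor_inv hX hE f)) =
  gdom (gmor_mul hX hE g (gmor_inv hX hE g)) by rewrite !w.
have E2 : gmor_mul hX hE (@gmor_comp _ _ _ hX hE g f e)
    (@gmor_comp _ _ _ hX hE (gmor_inv hX hE g) (gmor_inv hX hE f) e') =
    vcomp CG (g := gmor_mul hX hE g (gmor_inv hX hE g))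
      (f := gmor_mul hX hE f (gmor_inv hX hE f)) e2.
  exact (esym (@vcomp_mul _ _ _ _ _ GE _ _ _ _ e e' e2)).
apply/esym/gmor_inv_uniq; apply: etrans E2 _.
have e3 : gcod (gmor_one hE) = gdom (gmor_one hE) by [].
have -> : vcomp CG (g := gmor_mul hX hE g (gmor_inv hX hE g))
    (f := gmor_mul hX hE f (gmor_inv hX hE f)) e2 = vcomp CG (g := gmor_one hE)
    (f := gmor_one hE) e3.
  by move: e2 e3; rewrite !w => e2 e3; congr vcomp; exact: Prop_irrelevance.
exact (@vcomp_idl _ _ _ _ CG (gmor_one hE) e3).
Qed.

Definition ext_2group : two_group (prod_category CG CL).
Proof.
refine (@TwoGroup _ _ _ _ (prod_category CG CL) ext_ob_mul _ _ ext_mor_mul _ _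
  ext_obP ext_morP _ _ _ _ _).
- by [].
- by [].
- move=> x y; apply: (congr2 pair); first exact: (idm_mul GE).
  rewrite /= gmor_inv_id /pullM pull_mor_id /addM; exact: esym (add_mor_id hX hE OQ _ _ _).
(* The second component pulls back along the inverse of the first factor. Thus inversion must
   respect vertical composition before the functoriality of pullback and of addition can be
   applied. *)
- move=> g f g' f' e e' e2; apply: (congr2 pair); first exact: (@vcomp_mul _ _ _ _ _ GE).
  have ei : gcod (gmor_inv hX hE f.1) = gdom (gmor_inv hX hE g.1).
    exact (congr1 (fun z => gauge_inv z.1) e).
  rewrite /= (gmor_inv_comp _ ei).
  have ep : wcod (pullM f'.2 (gmor_inv hX hE f.1)) = wdom (pullM g'.2 (gmor_inv hX hE g.1)).
    exact (congr2 pullO (congr1 snd e') ei).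
  have E1 := pull_mor_comp (PQ := OQ) (PP := olam_pull hX hE) (congr1 snd e') ei ep.
  exact (esym (etrans (congr1 (addM _) E1) (add_mor_comp (congr1 snd e) ep (congr1 snd e2)))).
(* Vertical inverses are taken componentwise, as composition in the product category is. *)
- move=> [Q t]; have [g [e [e' [E1 E2]]]] := vcomp_inv GE Q.
  have [s [u [u' [U1 U2]]]] := form_vcomp_inv hX hE OQ t.
  have k : (gcod Q, wcod t) = (gdom g, wdom s) by rewrite e u.
  have k' : (gcod g, wcod s) = (gdom Q, wdom t) by rewrite e' u'.
  exists (g, s), k, k'; split; apply: (congr2 pair).
  + rewrite -E1; congr vcomp; exact: Prop_irrelevance.
  + rewrite /= -U1; congr form_comp; exact: Prop_irrelevance.
  + rewrite -E2; congr vcomp; exact: Prop_irrelevance.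
  + rewrite /= -U2; congr form_comp; exact: Prop_irrelevance.
Defined.

Let SQ := @semistrict_equivariant R X E.
Let CS := form_category hX hE SQ.
Let addS := add_ob (semistrict_add hX hE).
Let pullS := pull_ob (semistrict_pull hX hE).
Let addSM := add_mor hX hE SQ (semistrict_add hX hE).
Let pullSM := pull_mor hX hE SQ (semistrict_pull hX hE).

Definition ext_ob_act := sd_act (@gauge_inv R X E) addS pullS.
Definition ext_mor_act := sd_act (gmor_inv hX hE) addSM pullSM.

Lemma ext_action : is_2action ext_2group CS ext_ob_act ext_mor_act.
Proof.
split.
- by [].
- move=> x w; rewrite /ext_mor_act /sd_act /= gmor_inv_id /pullSM pull_mor_id.
  exact: add_mor_id.
- move=> b a z' z e e' e2.
  have ei : gcod (gmor_inv hX hE a.1) = gdom (gmor_inv hX hE b.1).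
    exact (congr1 (fun z => gauge_inv z.1) e).
  rewrite /ext_mor_act /sd_act /= (gmor_inv_comp _ ei).
  have ep : wcod (pullSM z (gmor_inv hX hE a.1)) = wdom (pullSM z' (gmor_inv hX hE b.1)).
    exact (congr2 pullS e' ei).
  have E1 := pull_mor_comp (PQ := SQ) (PP := semistrict_pull hX hE) e' ei ep.
  exact (etrans (congr1 (fun y => addSM y _) E1) (add_mor_comp ep (congr1 snd e) e2)).
- split.
    apply: (sd_act1 gO); [exact: pull_ob1|exact: add_ob0].
  apply: (sd_actM gO addOC).
  + exact: pull_ob_mul.
  + exact: add_obA.
  + exact: pull_ob_add.
- split.
    apply: (sd_act1 gM); [exact: pull_mor1|exact: add_mor0].
  apply: (sd_actM gM addMC).
  + exact: pull_mor_mul.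
  + exact: add_morA.
  + exact: pull_mor_add.
Qed.
End Laws.

Theorem mainTheorem10 (R : realType) (X : xmod R) (E : bundle_data X)
    (hX : is_lie_crossed_module X) (hE : is_principal_2bundle E) :
  exists (CG : category (@gdom R X E) (@gcod R X E))
         (CL : category (@wdom _ _ _ (is_olam E)) (@wcod _ _ _ (is_olam E)))
         (CS : category (@wdom _ _ _ (is_semistrict E)) (@wcod _ _ _ (is_semistrict E)))
         (GE : two_group CG),
  [/\ vertical (@gfun R X E) (@gmap R X E) CG,
      vertical (@wfun _ _ _ (is_olam E)) (@wmap _ _ _ (is_olam E)) CL,
      vertical (@wfun _ _ _ (is_semistrict E)) (@wmap _ _ _ (is_semistrict E)) CS,
      is_gauge_2group GE &
      exists Gext : two_group (prod_category CG CL),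
      [/\ forall x y : gauge_ob E * form_ob (is_olam E),
            (ob_mul Gext x y).1 = ob_mul GE x.1 y.1 /\
            wfun (ob_mul Gext x y).2 =
              addF x.2 (compF y.2 (tanF (ob_inv GE x.1))),
          forall a b : gauge_mor E * form_mor (is_olam E),
            (mor_mul Gext a b).1 = mor_mul GE a.1 b.1 /\
            exists2 r,
              is_hcomp (wdom b.2) (wmap b.2) (tanF (gcod (mor_inv GE a.1)))
                       (tmap (gmap (mor_inv GE a.1))) r &
              wmap (mor_mul Gext a b).2 = addN (wmap a.2) r &
          exists oact mact,
          [/\ is_2action Gext CS oact mact,
              forall x (w : form_ob (is_semistrict E)),
                wfun (oact x w) = addF (compF w (tanF (ob_inv GE x.1))) x.2 &
              forall a (z : form_mor (is_semistrict E)),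
                exists2 r,
                  is_hcomp (wdom z) (wmap z) (tanF (gcod (mor_inv GE a.1)))
                           (tmap (gmap (mor_inv GE a.1))) r &
                  wmap (mact a z) = addN r (wmap a.2)]]].
Proof.
pose OQ := olam_equivariant hX hE; pose SQ := @semistrict_equivariant R X E.
exists (gauge_category hX hE), (form_category hX hE OQ), (form_category hX hE SQ),
  (gauge_2group hX hE); split.
- split=> // g f e p; apply: (gcP (tot_groupoid hE)).
  by rewrite gtgtP gsrcP e.
- exact: form_vertical.
- exact: form_vertical.
- split=> // Q Q' x; apply: (gcP (tot_groupoid hE)).
  have [_ _ t _ _] := gauge_functor (gdom Q).
  by rewrite t gtgtP gsrcP.
exists (ext_2group hX hE); split.
- by [].
- move=> a b; split=> //.
  (* The required horizontal composite is realised by pulling [b.2] back along the inverse of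
     [a.1]. *)
  exists (wmap (pull_mor hX hE OQ (olam_pull hX hE) b.2 (gmor_inv hX hE a.1))).
    exact: pull_hcomp.
  exact: wmap_add.
exists (ext_ob_act hX hE), (ext_mor_act hX hE); split.
- exact: ext_action.
- by [].
- move=> a z.
  exists (wmap (pull_mor hX hE SQ (semistrict_pull hX hE) z (gmor_inv hX hE a.1))).
    exact: pull_hcomp.
  exact: wmap_add.
Qed.
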